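(* Let $G$ be a group with a linear character $\chi$, let $H$ be a $(G,\chi)$-module nonlocal vertex bialgebra, let $V$ be a $(G,\chi)$-module nonlocal vertex algebra with a structure $Y_V^H$ of $\phi$-compatible $H$-module nonlocal vertex algebra, let $\chi_\phi$ be a linear character of $G$ with $\phi(x,\chi(g)z)=\chi_\phi(g)\phi(\chi_\phi(g)^{-1}x,z)$ for $g\in G$, and let $(W,Y_W^H,Y_W^V)$ be a $(G,\chi_\phi)$-equivariant $\phi$-coordinated quasi $(H,V)$-module. In addition, assume $$R_V(g)Y_V^H(h,x)v=Y_V^H(R_H(g)h,\chi(g)x)R_V(g)v\quad\text{for }g\in G,\ h\in H,\ v\in V,$$ where $R_H,R_V$ denote the representations of $G$ on $H$ and $V$. For $h\in H$, $v\in V$, set $$Y_W^\sharp(v\otimes h,x)=Y_W^V(v,x)Y_W^H(h,x)\in(\mathrm{End}\,W)[[x,x^{-1}]].$$ Then $(W,Y_W^\sharp)$ is a $(G,\chi_\phi)$-equivariant $\phi$-coordinated quasi $V\sharp H$-module, where $V\sharp H$ is the $(G,\chi)$-module nonlocal vertex algebra with $R=R_V\otimes R_H$.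
   Context: All vector spaces are over $\mathbb C$; $W((x_1,x_2))=W[[x_1,x_2]][x_1^{-1},x_2^{-1}]$; powers $(x\pm z)^n$ are expanded in nonnegative powers of the second variable; $R^\times$ denotes the nonzero elements of a ring $R$. A nonlocal vertex algebra is a vector space $V$ with a linear map $Y(\cdot,x):V\to(\mathrm{End}\,V)[[x,x^{-1}]]$ and $\mathbf 1\in V$ such that $Y(u,x)v\in V((x))$; $Y(\mathbf 1,x)v=v$, $Y(v,x)\mathbf 1\in V[[x]]$ with $\lim_{x\to0}Y(v,x)\mathbf 1=v$; and for $u,v\in V$ there is $k\ge 0$ with $(x_1-x_2)^kY(u,x_1)Y(v,x_2)\in \mathrm{Hom}(V,V((x_1,x_2)))$ and $\big((x_1-x_2)^kY(u,x_1)Y(v,x_2)\big)|_{x_1=x_2+x_0}=x_0^kY(Y(u,x_0)v,x_2)$. Modules $(W,Y_W)$ satisfy the analogous axioms. A nonlocal vertex bialgebra is a nonlocal vertex algebra $H$ with a coalgebra structure $(\Delta,\varepsilon)$ such that $\Delta,\varepsilon$ are homomorphisms of nonlocal vertex algebras. An $H$-module nonlocal vertex algebra is a nonlocal vertex algebra $V$ with an $H$-module structure $Y_V^H$ with $Y_V^H(h,x)v\in V\otimes\mathbb C((x))$, $Y_V^H(h,x)\mathbf 1=\varepsilon(h)\mathbf 1$, $Y_V^H(h,x_1)Y(u,x_2)v=\sum Y(Y_V^H(h_{(1)},x_1-x_2)u,x_2)Y_V^H(h_{(2)},x_1)v$. The smash product $V\sharp H$ is the nonlocal vertex algebra $V\otimes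 H$ with vacuum $\mathbf 1\otimes\mathbf 1$ and $Y^\sharp(u\otimes h,x)(v\otimes h')=\sum Y(u,x)Y_V^H(h_{(1)},x)v\otimes Y(h_{(2)},x)h'$. A $(G,\chi)$-module nonlocal vertex algebra is a nonlocal vertex algebra $V$ with a representation $R:G\to\mathrm{GL}(V)$ such that $R(g)\mathbf 1=\mathbf 1$, $R(g)Y(v,x)R(g)^{-1}=Y(R(g)v,\chi(g)x)$. A $(G,\chi)$-module nonlocal vertex bialgebra is a nonlocal vertex bialgebra that is a $(G,\chi)$-module nonlocal vertex algebra on which $G$ acts by coalgebra automorphisms. Fix $\phi(x,z)=e^{zp(x)\frac{d}{dx}}x\in\mathbb C((x))[[z]]$ with $p(x)\in\mathbb C((x))$, $p\neq0$. $\mathbb C_*((x_1,x_2))$ is the fraction field of $\mathbb C((x_1,x_2))$. For $F\in\mathbb C_*((x_1,x_2))$, $F(\phi(x,z),x)\in\mathbb C((x))((z))$ is its image under the field embedding extending the ring embedding $f(x_1,x)\mapsto f(\phi(x,z),x)$, $\mathbb C((x_1,x))\to\mathbb C((x))[[z]]$. $\mathbb C_\phi((x_1,x_2))$ is the set of $F\in\mathbb C_*((x_1,x_2))$ with $p(x_1)\partial_{x_1}F=-p(x_2)\partial_{x_2}F$. For such $F$, $F(\phi(x,z),x)\in\mathbb C((z))$, and $\pi_\phi(F)=F(\phi(x,z),x)$ defines an injective algebra homomorphism $\pi_\phi:\mathbb C_\phi((x_1,x_2))\to\mathbb C((z))$ with image denoted $\mathbb C_\phi((z))$. $\mathbb C_{\chi_\phi(G)}[x]$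 is the multiplicative monoid generated in $\mathbb C[x]$ by $x-\chi_\phi(g)$, $g\in G$. $\iota_{x_2,x_1}:\mathbb C_*((x_1,x_2))\to\mathbb C((x_2))((x_1))$ is the canonical expansion embedding. A $\phi$-compatible $H$-module nonlocal vertex algebra ($H$ a $(G,\chi)$-module nonlocal vertex bialgebra) is an $H$-module nonlocal vertex algebra $(V,Y_V^H)$ with $Y_V^H(h,z)v\in V\otimes\mathbb C_\phi((z))$ for all $h,v$, and such that for $h\in H$, $v\in V$ there is $q(x)\in\mathbb C_{\chi_\phi(G)}[x]$ with $q(x_2/x_1)\widehat Y_V^H(h,x_1,x_2)v\in V\otimes\mathbb C((x_1,x_2))$, where $\widehat Y_V^H(h,x_1,x_2)v=(1\otimes\pi_\phi^{-1})Y_V^H(h,z)v\in V\otimes\mathbb C_\phi((x_1,x_2))$. A $\phi$-coordinated quasi $V$-module is a vector space $W$ with a linear map $Y_W(\cdot,x):V\to(\mathrm{End}\,W)[[x,x^{-1}]]$ with $Y_W(u,x)w\in W((x))$, $Y_W(\mathbf 1,x)=1_W$, and for $u,v\in V$ there is $f\in\mathbb C((x_1,x_2))^\times$ with $f(x_1,x_2)Y_W(u,x_1)Y_W(v,x_2)\in\mathrm{Hom}(W,W((x_1,x_2)))$ and $\big(f(x_1,x_2)Y_W(u,x_1)Y_W(v,x_2)\big)|_{x_1=\phi(x_2,z)}=f(\phi(x_2,z),x_2)Y_W(Y(u,z)v,x_2)$. For a $(G,\chi)$-module nonlocal vertex algebra $V$ and $\chi_\phi$ satisfying the stated relation, it is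 $(G,\chi_\phi)$-equivariant if $Y_W(R(g)v,x)=Y_W(v,\chi_\phi(g)^{-1}x)$ and for $u,v\in V$ there is $q(x)\in\mathbb C_{\chi_\phi(G)}[x]$ with $q(x_1/x_2)Y_W(u,x_1)Y_W(v,x_2)\in\mathrm{Hom}(W,W((x_1,x_2)))$. A $(G,\chi_\phi)$-equivariant $\phi$-coordinated quasi $(H,V)$-module is a vector space $W$ with a $(G,\chi_\phi)$-equivariant $\phi$-coordinated quasi $H$-module structure $Y_W^H$ and a $(G,\chi_\phi)$-equivariant $\phi$-coordinated quasi $V$-module structure $Y_W^V$ such that for $h\in H$, $v\in V$, $w\in W$: $Y_W^H(h,x)w\in W\otimes\mathbb C((x))$ and $Y_W^H(h,x_1)Y_W^V(v,x_2)=\sum Y_W^V\big(\iota_{x_2,x_1}\widehat Y_V^H(h_{(1)},x_1,x_2)v,x_2\big)Y_W^H(h_{(2)},x_1)$. *)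

(* Defs.v *)
From HB Require Import structures.
From mathcomp Require Import all_boot all_order all_algebra.
From mathcomp Require Import generic_quotient fraction.
From mathcomp Require Import zify.
From mathcomp Require Import finmap boolp classical_sets functions cardinality fsbigop.

Set Implicit Arguments.
Unset Strict Implicit.
Unset Printing Implicit Defensive.

Import Order.TTheory GRing.Theory Num.Theory.
Local Open Scope ring_scope.

Lemma fsum_range (V : zmodType) (F : int -> V) (N : int) (L : nat) :
    (forall n, n < N -> F n = 0) -> (forall n, N + L%:Z <= n -> F n = 0) ->
  \sum_(i \in [set: int]) F i = \sum_(k < L) F (N + k%:Z).
Proof.
move=> lo hi.
rewrite -(big_mkord xpredT (fun k => F (N + k%:Z))) /=.
rewrite -(big_map (fun k : nat => N + k%:Z) xpredT F) /=.
set r := map _ _.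
have Ur : uniq r by rewrite map_inj_uniq ?iota_uniq // => x y /addrI [].
rewrite [RHS]fsbig_seq //; apply/esym/fsbig_widen => // i [_ /= /negP ni].
case: (ltP i N) => [/lo //|Ni]; case: (leP (N + L%:Z) i) => [/hi //|iL].
case/negP: ni; apply/mapP; exists `|i - N|%N; last by lia.
by rewrite mem_index_iota; lia.
Qed.

Section CauchyProduct.
Variable R : comNzRingType.
Implicit Types f g h : int -> R.

Definition bounded_at (N : int) (f : int -> R) := forall n, n < N -> f n = 0.

Lemma bounded_atW N M f : M <= N -> bounded_at N f -> bounded_at M f.
Proof. by move=> MN bf n nM; apply: bf; apply: lt_le_trans MN. Qed.

(* [\sum_(i \in A)] is the finitely supported sum of fsbigop: below, it is *)
(* only applied to families that have finite support.                       *)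
Definition cauchy (f g : int -> R) : int -> R :=
  fun n => \sum_(i \in [set: int]) f i * g (n - i).

Definition poly_part (N : int) (L : nat) f : {poly R} :=
  \poly_(k < L) f (N + k%:Z).

Lemma cauchy_bounded N M f g :
  bounded_at N f -> bounded_at M g -> bounded_at (N + M) (cauchy f g).
Proof.
move=> bf bg n nNM; apply: fsbig1 => i _; case: (ltP i N) => iN.
  by rewrite bf // mul0r.
by rewrite bg ?mulr0 //; lia.
Qed.

Lemma cauchyE N M f g (n L : nat) :
    bounded_at N f -> bounded_at M g -> (n < L)%N ->
  cauchy f g (N + M + n%:Z) = (poly_part N L f * poly_part M L g)`_n.
Proof.
move=> bf bg nL; rewrite /cauchy (@fsum_range _ _ N n.+1).
- rewrite coefM; apply: eq_bigr => k _; rewrite !coef_poly.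
  have kL : (k < L)%N by have := ltn_ord k; lia.
  have nkL : (n - k < L)%N by lia.
  by rewrite kL nkL; congr (_ * g _); have := ltn_ord k; lia.
- by move=> i /bf ->; rewrite mul0r.
- by move=> i iN; rewrite bg ?mulr0 //; lia.
Qed.

Lemma bounded_at_eq N f g :
    bounded_at N f -> bounded_at N g ->
  (forall n : nat, f (N + n%:Z) = g (N + n%:Z)) -> f = g.
Proof.
move=> bf bg fg; apply/funext => n; case: (ltP n N) => nN; first by rewrite bf ?bg.
by have -> : n = N + `|n - N|%N%:Z by lia.
Qed.

Lemma cauchyC f g N : bounded_at N f -> bounded_at N g ->
  cauchy f g = cauchy g f.
Proof.
move=> bf bg; apply: (@bounded_at_eq (N + N)) => [||n]; try exact: cauchy_bounded.
by rewrite !(cauchyE bf bg (ltnSn n)) !(cauchyE bg bf (ltnSn n)) mulrC.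
Qed.

Lemma cauchyDl f g h N : bounded_at N f -> bounded_at N g -> bounded_at N h ->
  cauchy (fun n => f n + g n) h = (fun n => cauchy f h n + cauchy g h n).
Proof.
move=> bf bg bh.
have bfg : bounded_at N (fun n => f n + g n).
  by move=> n nN; rewrite bf ?bg ?addr0.
apply: (@bounded_at_eq (N + N)) => [|n nN|n]; first exact: cauchy_bounded.
  by rewrite !(cauchy_bounded _ bh nN) ?addr0.
rewrite (cauchyE bfg bh (ltnSn n)) (cauchyE bf bh (ltnSn n)).
rewrite (cauchyE bg bh (ltnSn n)) -coefD -mulrDl.
suff -> : poly_part N n.+1 (fun n => f n + g n) =
    poly_part N n.+1 f + poly_part N n.+1 g by [].
by apply/polyP => i; rewrite coefD !coef_poly; case: ifP => // _; rewrite addr0.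
Qed.

Lemma cauchyA f g h N : bounded_at N f -> bounded_at N g -> bounded_at N h ->
  cauchy f (cauchy g h) = cauchy (cauchy f g) h.
Proof.
move=> bf bg bh; have bgh := cauchy_bounded bg bh.
have bfg := cauchy_bounded bf bg.
apply: (@bounded_at_eq (N + N + N)) => [||n].
- by rewrite -addrA; exact: cauchy_bounded.
- exact: cauchy_bounded.
rewrite -[in LHS](addrA N N N) (cauchyE bf bgh (ltnSn n)) (cauchyE bfg bh (ltnSn n)).
transitivity ((poly_part N n.+1 f * (poly_part N n.+1 g * poly_part N n.+1 h))`_n).
  rewrite !coefM; apply: eq_bigr => k _; congr (_ * _).
  by rewrite [LHS]coef_poly ltnS leq_subr (cauchyE bg bh (L := n.+1)) // ltnS leq_subr.
rewrite mulrA [LHS]coefM [RHS]coefM; apply: eq_bigr => k _; congr (_ * _).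
by rewrite [RHS]coef_poly ltn_ord (cauchyE bf bg (L := n.+1)).
Qed.

Definition delta0 (V : zmodType) (v : V) : int -> V :=
  fun n => if n == 0 then v else 0.

Lemma delta0_bounded (a : R) : bounded_at 0 (delta0 a).
Proof. by move=> n n0; rewrite /delta0; case: eqP n0 => // ->. Qed.

Lemma cauchy_delta (a : R) f : cauchy (delta0 a) f = (fun n => a * f n).
Proof.
apply/funext => n; rewrite /cauchy (@fsum_range _ _ 0 1).
- by rewrite big_ord1 addr0 subr0.
- by move=> i /delta0_bounded ->; rewrite mul0r.
- by move=> i i0; rewrite /delta0 ifN ?mul0r //; lia.
Qed.

Lemma cauchy_lead N M f g : bounded_at N f -> bounded_at M g ->
  cauchy f g (N + M) = f N * g M.
Proof.
move=> bf bg; have := cauchyE bf bg (ltnSn 0); rewrite addr0 => ->.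
by rewrite coef0M !coef_poly !addr0.
Qed.

End CauchyProduct.

(* Units and inverses chosen classically, for rings without explicit ones. *)
Section ClassicalInverse.
Variable T : comNzRingType.

Definition cl_unit (f : T) : bool := `[< exists g, g * f = 1 >].
Definition cl_inv (f : T) : T :=
  if pselect (exists g, g * f = 1) is left ex then projT1 (cid ex) else f.

Fact cl_mulV : {in cl_unit, left_inverse 1 cl_inv *%R}.
Proof. by move=> f /asboolP fU; rewrite /cl_inv; case: pselect => // ex; case: cid. Qed.
Fact cl_unitP f g : g * f = 1 -> cl_unit f.
Proof. by move=> fg; apply/asboolP; exists g. Qed.
Fact cl_inv_out : {in [predC cl_unit], cl_inv =1 id}.
Proof. by move=> f /asboolP nU; rewrite /cl_inv; case: pselect. Qed.

End ClassicalInverse.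

Section Laurent.
Variable R : comNzRingType.

Definition lbounded (f : int -> R) : bool :=
  `[< exists N : int, bounded_at N f >].

(* R((x)) *)
Record laurent := Laurent {lcoef :> int -> R; _ : lbounded lcoef}.
HB.instance Definition _ := [isSub for lcoef].
HB.instance Definition _ := [Choice of laurent by <:].

Implicit Types f g h : laurent.

Lemma laurentP f : exists N : int, bounded_at N f.
Proof. by case: f => f /= /asboolP. Qed.

Lemma laurentP2 f g : exists N : int, bounded_at N f /\ bounded_at N g.
Proof.
have [[N bN] [M bM]] := (laurentP f, laurentP g).
by exists (Order.min N M); split; [apply: bounded_atW bN | apply: bounded_atW bM];
   rewrite ge_min lexx ?orbT.
Qed.

Lemma laurentP3 f g h :
  exists N : int, [/\ bounded_at N f, bounded_at N g & bounded_at N h].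
Proof.
have [[N [bN cN]] [M bM]] := (laurentP2 f g, laurentP h).
by exists (Order.min N M); split; [apply: bounded_atW bN|apply: bounded_atW cN
   |apply: bounded_atW bM]; rewrite ge_min lexx ?orbT.
Qed.

Lemma laurent_ext f g : (forall n, f n = g n) -> f = g.
Proof. by move=> fg; apply: val_inj; apply/funext. Qed.

Fact lzero_bounded : lbounded (fun=> 0).
Proof. by apply/asboolP; exists 0. Qed.
Definition lzero := Laurent lzero_bounded.

Fact lopp_bounded f : lbounded (fun n => - f n).
Proof. by have [N bN] := laurentP f; apply/asboolP; exists N => n /bN ->; rewrite oppr0. Qed.
Definition lopp f := Laurent (lopp_bounded f).

Fact ladd_bounded f g : lbounded (fun n => f n + g n).
Proof.
have [N [bN cN]] := laurentP2 f g; apply/asboolP; exists N => n nN.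
by rewrite bN ?cN ?addr0.
Qed.
Definition ladd f g := Laurent (ladd_bounded f g).

Fact lconst_bounded (a : R) : lbounded (delta0 a).
Proof. by apply/asboolP; exists 0; exact: delta0_bounded. Qed.
Definition lconst (a : R) := Laurent (lconst_bounded a).

Fact lmul_bounded f g : lbounded (cauchy f g).
Proof.
have [N [bN cN]] := laurentP2 f g; apply/asboolP; exists (N + N).
exact: cauchy_bounded.
Qed.
Definition lmul f g := Laurent (lmul_bounded f g).

Fact laddA : associative ladd.
Proof. by move=> f g h; apply: laurent_ext => n /=; rewrite addrA. Qed.
Fact laddC : commutative ladd.
Proof. by move=> f g; apply: laurent_ext => n /=; rewrite addrC. Qed.
Fact ladd0 : left_id lzero ladd.
Proof. by move=> f; apply: laurent_ext => n /=; rewrite add0r. Qed.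
Fact laddN : left_inverse lzero lopp ladd.
Proof. by move=> f; apply: laurent_ext => n /=; rewrite addNr. Qed.
HB.instance Definition _ := GRing.isZmodule.Build laurent laddA laddC ladd0 laddN.

Fact lmulA : associative lmul.
Proof.
move=> f g h; apply: val_inj => /=.
by have [N [bf bg bh]] := laurentP3 f g h; exact: cauchyA bf bg bh.
Qed.
Fact lmulC : commutative lmul.
Proof.
move=> f g; apply: val_inj => /=.
by have [N [bf bg]] := laurentP2 f g; exact: cauchyC bf bg.
Qed.
Fact lmul1 : left_id (lconst 1) lmul.
Proof.
by move=> f; apply: val_inj; rewrite /= cauchy_delta; apply/funext => n; rewrite mul1r.
Qed.
Fact lmulD : left_distributive lmul ladd.
Proof.
move=> f g h; apply: val_inj => /=.
by have [N [bf bg bh]] := laurentP3 f g h; rewrite (cauchyDl bf bg bh).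
Qed.
Fact lone_neq0 : lconst 1 != 0.
Proof.
apply/eqP => /(congr1 (fun f : laurent => f 0)) /eqP.
by rewrite /= /delta0 eqxx oner_eq0.
Qed.
HB.instance Definition _ :=
  GRing.Zmodule_isComNzRing.Build laurent lmulA lmulC lmul1 lmulD lone_neq0.

Lemma lcoef0 n : (0 : laurent) n = 0. Proof. by []. Qed.
Lemma lcoefD f g n : (f + g) n = f n + g n. Proof. by []. Qed.
Lemma lcoefN f n : (- f) n = - f n. Proof. by []. Qed.
Lemma lcoefM f g n : (f * g) n = \sum_(i \in [set: int]) f i * g (n - i).
Proof. by []. Qed.
Lemma lcoef1 n : (1 : laurent) n = delta0 1 n. Proof. by []. Qed.
Lemma lcoefC a n : lconst a n = delta0 a n. Proof. by []. Qed.

Fact lconst_zmod : zmod_morphism lconst.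
Proof.
move=> a b; apply: laurent_ext => n; rewrite lcoefD lcoefN !lcoefC /delta0.
by case: ifP => _; rewrite ?subr0.
Qed.
Fact lconst_monoid : monoid_morphism lconst.
Proof.
split=> // a b; apply: laurent_ext => n.
rewrite -[RHS]/(cauchy (delta0 a) (delta0 b) n) cauchy_delta lcoefC /delta0.
by case: ifP => _ //; rewrite mulr0.
Qed.
HB.instance Definition _ := GRing.isZmodMorphism.Build R laurent lconst lconst_zmod.
HB.instance Definition _ := GRing.isMonoidMorphism.Build R laurent lconst lconst_monoid.

Definition lscale (a : R) f : laurent := lconst a * f.
Fact lscaleA a b f : lscale a (lscale b f) = lscale (a * b) f.
Proof. by rewrite /lscale rmorphM mulrA. Qed.
Fact lscale1 : left_id 1 lscale.
Proof. by move=> f; rewrite /lscale rmorph1 mul1r. Qed.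
Fact lscaleDr : right_distributive lscale +%R.
Proof. by move=> a f g; rewrite /lscale mulrDr. Qed.
Fact lscaleDl f : {morph lscale^~ f : a b / a + b}.
Proof. by move=> a b; rewrite /lscale rmorphD mulrDl. Qed.
HB.instance Definition _ := GRing.Zmodule_isLmodule.Build R laurent
  lscaleA lscale1 lscaleDr lscaleDl.

Lemma lcoefZ a f n : (a *: f) n = a * f n.
Proof. by rewrite /= cauchy_delta. Qed.

HB.instance Definition _ := GRing.ComNzRing_hasMulInverse.Build laurent
  (@cl_mulV laurent) (@cl_unitP laurent) (@cl_inv_out laurent).

(* The series with coefficients f, or 0 if f is not bounded below. *)
Definition mklaurent (f : int -> R) : laurent := insubd (0 : laurent) f.

Lemma mklaurentE N (f : int -> R) n : bounded_at N f -> mklaurent f n = f n.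
Proof.
by move=> bf; rewrite /mklaurent insubdK //; apply/asboolP; exists N.
Qed.

Lemma laurent_lead f : f != 0 -> exists2 N, bounded_at N f & f N != 0.
Proof.
move=> f0; have [N bf] := laurentP f.
have ex : exists n, f (N + n%:Z) != 0.
  apply: contrapT => nex; case/eqP: f0; apply: val_inj => /=.
  apply: (bounded_at_eq bf) => // n; apply/eqP.
  by apply: contra_notT nex => nz; exists n.
exists (N + (ex_minn ex)%:Z); case: ex_minnP => // m _ mmin n nm.
case: (ltP n N) => [/bf //|Nn]; apply/eqP; apply: contraTT nm => fn0.
have /mmin : f (N + `|n - N|%N%:Z) != 0 by have -> : N + `|n - N|%N%:Z = n by lia.
by lia.
Qed.

End Laurent.

Section LaurentIdomain.
Variable R : idomainType.

Fact laurent_mulf_eq0 (f g : laurent R) : f * g = 0 -> (f == 0) || (g == 0).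
Proof.
move=> fg0; apply/negP => /negP; rewrite negb_or => /andP[/laurent_lead[N bf fN]].
case/laurent_lead => M bg gM; have /eqP := congr1 (fun h : laurent R => h (N + M)) fg0.
by rewrite /= cauchy_lead // mulf_eq0 (negPf fN) (negPf gM).
Qed.
HB.instance Definition _ :=
  GRing.ComUnitRing_isIntegral.Build (laurent R) laurent_mulf_eq0.

End LaurentIdomain.

Section LaurentField.
Variable K : fieldType.

(* The coefficients of the inverse power series of \sum_n u n x^n. *)
Fixpoint inv_seq (u : nat -> K) (n : nat) : seq K :=
  if n is n'.+1 then
    let s := inv_seq u n' in
    rcons s ((u 0)^-1 * ((n' == 0)%:R - \sum_(k < n') u (n' - k)%N * s`_k))
  else [::].

Lemma size_inv_seq u n : size (inv_seq u n) = n.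
Proof. by elim: n => //= n IH; rewrite size_rcons IH. Qed.

Lemma nth_inv_seq u n m : (n < m)%N -> (inv_seq u m)`_n = (inv_seq u n.+1)`_n.
Proof.
elim: m => // m IH; rewrite ltnS leq_eqVlt => /predU1P[->//|nm].
by rewrite [LHS]nth_rcons size_inv_seq nm IH.
Qed.

Lemma inv_seqP u n : u 0 != 0 ->
  \sum_(k < n.+1) u (n - k)%N * (inv_seq u k.+1)`_k = (n == 0)%:R.
Proof.
move=> u0; rewrite big_ord_recr /= subnn nth_rcons size_inv_seq ltnn eqxx mulVKf //.
under [X in _ - X]eq_bigr => k _ do rewrite nth_inv_seq //.
by rewrite addrC subrK.
Qed.

Fact laurent_unit (f : laurent K) : f != 0 -> f \is a GRing.unit.
Proof.
case/laurent_lead => N bf fN; apply/asboolP.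
pose u k := f (N + k%:Z); have u0 : u 0 != 0 by rewrite /u addr0.
pose g n := if n < - N then 0 else (inv_seq u (absz (n + N)).+1)`_(absz (n + N)).
have bg : bounded_at (- N) g by move=> n nN; rewrite /g nN.
exists (mklaurent g); apply: val_inj => /=.
have -> : lcoef (mklaurent g) = g.
  by apply/funext => n; rewrite (mklaurentE _ bg).
apply: (@bounded_at_eq _ 0); last 1 first.
- move=> n; have := cauchyE bg bf (ltnSn n); rewrite addNr => ->.
  rewrite coefM /delta0; transitivity ((n == 0)%:R : K); last first.
    by rewrite add0r; case: (n).
  rewrite -(inv_seqP n u0); apply: eq_bigr => k _.
  rewrite !coef_poly ltn_ord ltnS leq_subr mulrC /u; congr (_ * _).
  rewrite /g ifN; last by lia.
  by have -> : absz (- N + k%:Z + N) = k :> nat by lia.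
- by rewrite -(addNr N); exact: cauchy_bounded.
- exact: delta0_bounded.
Qed.
HB.instance Definition _ := GRing.UnitRing_isField.Build (laurent K) laurent_unit.

End LaurentField.

Section LaurentSeries2.
Variable K : fieldType.

(* [laurent (laurent K)] is K((x2))((x1)): the outer index is the exponent of *)
(* x1, the inner one that of x2.                                              *)
Definition s2bounded : {pred laurent (laurent K)} :=
  fun F => `[< exists N : int, forall m, bounded_at N (F m) >].

Lemma bounded_at_sum (I : Type) (r : seq I) (F : I -> laurent K) (N : int) :
  (forall i, bounded_at N (F i)) -> bounded_at N (\sum_(i <- r) F i : laurent K).
Proof.
move=> bF; elim/big_ind: _ => // f g bf bg n nN.
by rewrite lcoefD bf ?bg ?addr0.
Qed.

Fact s2bounded_subring : subring_closed s2bounded.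
Proof.
split=> [|F G /asboolP[N bF] /asboolP[M bG]|F G /asboolP[N bF] /asboolP[M bG]].
- apply/asboolP; exists 0 => m n n0; rewrite lcoef1 /delta0; case: ifP => // _.
  exact: delta0_bounded n0.
- apply/asboolP; exists (Order.min N M) => m n nNM.
  rewrite -[LHS]/(F m n - G m n).
  by rewrite bF ?bG ?subr0 //; apply: lt_le_trans nNM _; rewrite ge_min lexx ?orbT.
- apply/asboolP; exists (N + M) => m; rewrite lcoefM; apply: bounded_at_sum => i.
  exact: cauchy_bounded.
Qed.
HB.instance Definition _ := GRing.isSubringClosed.Build _ s2bounded s2bounded_subring.

(* K((x1,x2)): the exponents of x2 have a common lower bound. *)
Record series2 := Series2 {s2val :> laurent (laurent K); _ : s2bounded s2val}.
HB.instance Definition _ := [isSub for s2val].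
HB.instance Definition _ := [Choice of series2 by <:].
HB.instance Definition _ := [SubChoice_isSubComNzRing of series2 by <:].
HB.instance Definition _ := GRing.ComNzRing_hasMulInverse.Build series2
  (@cl_mulV series2) (@cl_unitP series2) (@cl_inv_out series2).

Fact series2_mulf_eq0 (f g : series2) : f * g = 0 -> (f == 0) || (g == 0).
Proof.
move=> /(congr1 (fun h : series2 => s2val h)) fg0.
have /eqP : s2val f * s2val g = 0 by exact: fg0.
by rewrite mulf_eq0.
Qed.
HB.instance Definition _ :=
  GRing.ComUnitRing_isIntegral.Build series2 series2_mulf_eq0.

(* The series \sum A m n x1^m x2^n, or 0 if A is not the coefficient family of *)
(* an element of K((x1,x2)).                                                   *)
Definition mks2 (A : int -> int -> K) : series2 :=
  insubd (0 : series2) (mklaurent (fun m => mklaurent (A m))).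

Lemma mks2E N (A : int -> int -> K) m n :
  (forall m n, m < N \/ n < N -> A m n = 0) -> mks2 A m n = A m n.
Proof.
move=> bA; pose B m := mklaurent (A m).
have bA1 k : bounded_at N (A k) by move=> i iN; apply: bA; right.
have bB : bounded_at N B.
  move=> i iN; apply: laurent_ext => j.
  by rewrite /B (mklaurentE _ (bA1 i)) bA //; left.
rewrite /mks2 insubdK; last first.
  by apply/asboolP; exists N => k; rewrite (mklaurentE _ bB) => j jN;
     rewrite /B (mklaurentE _ (bA1 k)) bA1.
by rewrite (mklaurentE _ bB) /B (mklaurentE _ (bA1 m)).
Qed.

Fact s2const_bounded (a : K) : s2bounded (lconst (lconst a)).
Proof.
apply/asboolP; exists 0 => m n n0; rewrite lcoefC /delta0; case: ifP => // _.
exact: delta0_bounded n0.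
Qed.
Definition s2const (a : K) := Series2 (s2const_bounded a).

Fact s2const_zmod : zmod_morphism s2const.
Proof. by move=> a b; apply: val_inj; rewrite /= !rmorphB. Qed.
Fact s2const_monoid : monoid_morphism s2const.
Proof. by split=> [|a b]; apply: val_inj; rewrite /= ?rmorph1 ?rmorphM. Qed.
HB.instance Definition _ := GRing.isZmodMorphism.Build K series2 s2const s2const_zmod.
HB.instance Definition _ := GRing.isMonoidMorphism.Build K series2 s2const s2const_monoid.

Definition frac2 := {fraction series2}.
HB.instance Definition _ := GRing.Field.on frac2.

Definition s2frac : series2 -> frac2 := @FracField.tofrac series2.
HB.instance Definition _ := GRing.RMorphism.on s2frac.

Definition fscale (a : K) (F : frac2) : frac2 := s2frac (s2const a) * F.
Fact fscaleA a b F : fscale a (fscale b F) = fscale (a * b) F.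
Proof. by rewrite /fscale !rmorphM mulrA. Qed.
Fact fscale1 : left_id 1 fscale.
Proof. by move=> F; rewrite /fscale !rmorph1 mul1r. Qed.
Fact fscaleDr : right_distributive fscale +%R.
Proof. by move=> a F G; rewrite /fscale mulrDr. Qed.
Fact fscaleDl F : {morph fscale^~ F : a b / a + b}.
Proof. by move=> a b; rewrite /fscale !rmorphD mulrDl. Qed.
HB.instance Definition _ := GRing.Zmodule_isLmodule.Build K frac2
  fscaleA fscale1 fscaleDr fscaleDl.

End LaurentSeries2.

Section Tensor.
Variables (K : fieldType) (V W : lmodType K).

(* Formal sums of pairs, modulo the congruence generated by bilinearity. *)
Inductive tens_rel : seq (V * W) -> seq (V * W) -> Prop :=
| tens_refl s : tens_rel s s
| tens_sym s t : tens_rel s t -> tens_rel t s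
| tens_trans s t u : tens_rel s t -> tens_rel t u -> tens_rel s u
| tens_cat s s' t t' : tens_rel s s' -> tens_rel t t' ->
    tens_rel (s ++ t) (s' ++ t')
| tens_catC s t : tens_rel (s ++ t) (t ++ s)
| tens_addl v v' w : tens_rel [:: (v + v', w)] [:: (v, w); (v', w)]
| tens_addr v w w' : tens_rel [:: (v, w + w')] [:: (v, w); (v, w')]
| tens_scale a v w : tens_rel [:: (a *: v, w)] [:: (v, a *: w)]
| tens_0 w : tens_rel [:: (0, w)] [::].

Definition tens_relb (s t : seq (V * W)) : bool := `[< tens_rel s t >].

Fact tens_relb_refl : reflexive tens_relb.
Proof. by move=> s; apply/asboolP; exact: tens_refl. Qed.
Fact tens_relb_sym : symmetric tens_relb.
Proof. by move=> s t; apply/asboolP/asboolP => /tens_sym. Qed.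
Fact tens_relb_trans : transitive tens_relb.
Proof.
by move=> t s u /asboolP st /asboolP tu; apply/asboolP; exact: tens_trans tu.
Qed.
Canonical tens_equiv :=
  EquivRel tens_relb tens_relb_refl tens_relb_sym tens_relb_trans.

Definition tensor := {eq_quot tens_equiv}%qT.
HB.instance Definition _ := EqQuotient.on tensor.
HB.instance Definition _ := Choice.on tensor.

Definition tens_of (s : seq (V * W)) : tensor := (\pi_tensor s)%qT.

Lemma tens_ofP s t : tens_of s = tens_of t <-> tens_rel s t.
Proof. by split=> [/eqmodP /asboolP|/asboolP st]; last exact/eqmodP. Qed.

Lemma tens_ofK (x : tensor) : tens_of (repr x) = x.
Proof. by rewrite /tens_of reprK. Qed.

Lemma tens_repr s : tens_rel (repr (tens_of s)) s.
Proof. by apply/tens_ofP; rewrite tens_ofK. Qed.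

Lemma tens_rel_map (f : V -> V) s t : (forall v v', f (v + v') = f v + f v') ->
    (forall a v, f (a *: v) = a *: f v) -> tens_rel s t ->
  tens_rel [seq (f p.1, p.2) | p <- s] [seq (f p.1, p.2) | p <- t].
Proof.
move=> fD fZ; have f0 : f 0 = 0 by rewrite -(scale0r 0) fZ !scale0r.
elim=> {s t} /=.
- by move=> s; exact: tens_refl.
- by move=> s t _; exact: tens_sym.
- by move=> s t u _ IH1 _; exact: tens_trans.
- by move=> s s' t t' _ IH1 _ IH2; rewrite !map_cat; exact: tens_cat.
- by move=> s t; rewrite !map_cat; exact: tens_catC.
- by move=> v v' w; rewrite fD; exact: tens_addl.
- by move=> v w w'; exact: tens_addr.
- by move=> a v w; rewrite fZ; exact: tens_scale.
- by move=> w; rewrite f0; exact: tens_0.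
Qed.

Definition tens_add (x y : tensor) := tens_of (repr x ++ repr y).
Definition tens_opp (x : tensor) := tens_of [seq (- p.1, p.2) | p <- repr x].
Definition tens_scal (a : K) (x : tensor) :=
  tens_of [seq (a *: p.1, p.2) | p <- repr x].

Lemma tens_addE s t : tens_add (tens_of s) (tens_of t) = tens_of (s ++ t).
Proof. by apply/tens_ofP; apply: tens_cat; exact: tens_repr. Qed.

Lemma tens_oppE s : tens_opp (tens_of s) = tens_of [seq (- p.1, p.2) | p <- s].
Proof.
apply/tens_ofP; apply: (@tens_rel_map -%R); last exact: tens_repr.
  exact: opprD.
by move=> a v; rewrite scalerN.
Qed.

Lemma tens_scalE a s :
  tens_scal a (tens_of s) = tens_of [seq (a *: p.1, p.2) | p <- s].
Proof.
apply/tens_ofP; apply: (@tens_rel_map ( *:%R a)); last exact: tens_repr.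
  exact: scalerDr.
by move=> b v; rewrite !scalerA mulrC.
Qed.

Lemma tens_catE s t : tens_of (s ++ t) = tens_add (tens_of s) (tens_of t).
Proof. by rewrite tens_addE. Qed.

Lemma tens_consE p s : tens_of (p :: s) = tens_add (tens_of [:: p]) (tens_of s).
Proof. by rewrite tens_addE. Qed.

Fact tens_addA : associative tens_add.
Proof.
by move=> x y z; rewrite -(tens_ofK x) -(tens_ofK y) -(tens_ofK z) !tens_addE catA.
Qed.
Fact tens_addC : commutative tens_add.
Proof.
move=> x y; rewrite -(tens_ofK x) -(tens_ofK y) !tens_addE.
by apply/tens_ofP; exact: tens_catC.
Qed.
Fact tens_add0 : left_id (tens_of [::]) tens_add.
Proof. by move=> x; rewrite -(tens_ofK x) tens_addE. Qed.
Fact tens_addN : left_inverse (tens_of [::]) tens_opp tens_add.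
Proof.
move=> x; rewrite -(tens_ofK x) tens_oppE.
elim: (repr x) => [|[v w] s IH] /=; first by rewrite tens_addE.
rewrite (tens_consE (- v, w)) (tens_consE (v, w)).
rewrite (tens_addC (tens_of [:: (v, w)])) tens_addA.
rewrite -(tens_addA (tens_of [:: (- v, w)])) IH (tens_addC _ (tens_of [::])).
rewrite tens_add0 tens_addE; apply/tens_ofP.
apply: tens_trans (tens_0 w); rewrite -(addNr v); apply: tens_sym.
exact: tens_addl.
Qed.
HB.instance Definition _ :=
  GRing.isZmodule.Build tensor tens_addA tens_addC tens_add0 tens_addN.

Fact tens_scalA a b x : tens_scal a (tens_scal b x) = tens_scal (a * b) x.
Proof.
rewrite -(tens_ofK x) !tens_scalE -map_comp; congr tens_of.
by apply: eq_map => p /=; rewrite scalerA.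
Qed.
Fact tens_scal1 : left_id 1 tens_scal.
Proof.
move=> x; rewrite -(tens_ofK x) tens_scalE; congr tens_of.
by rewrite -[RHS]map_id; apply: eq_map => -[v w] /=; rewrite scale1r.
Qed.
Fact tens_scalDr : right_distributive tens_scal +%R.
Proof.
move=> a x y; rewrite -(tens_ofK x) -(tens_ofK y) /GRing.add /=.
by rewrite tens_addE !tens_scalE tens_addE map_cat.
Qed.
Fact tens_scalDl x : {morph tens_scal^~ x : a b / a + b}.
Proof.
move=> a b; rewrite -(tens_ofK x) !tens_scalE.
elim: (repr x) => [|[v w] s IH] /=; first by rewrite add0r.
rewrite (tens_consE ((a + b) *: v, w)) (tens_consE (a *: v, w)).
rewrite (tens_consE (b *: v, w)) IH.
have addE (y z : tensor) : tens_add y z = y + z by [].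
rewrite !addE addrACA; congr (_ + _).
by rewrite -addE tens_addE scalerDl; apply/tens_ofP; exact: tens_addl.
Qed.
HB.instance Definition _ := GRing.Zmodule_isLmodule.Build K tensor
  tens_scalA tens_scal1 tens_scalDr tens_scalDl.

Definition tens (v : V) (w : W) : tensor := tens_of [:: (v, w)].

Lemma tens_sum s : tens_of s = \sum_(p <- s) tens p.1 p.2.
Proof.
elim: s => [|[v w] s IH]; first by rewrite big_nil.
by rewrite big_cons tens_consE IH.
Qed.

Lemma tensDl v v' w : tens (v + v') w = tens v w + tens v' w.
Proof.
by rewrite -[RHS]/(tens_add _ _) tens_addE; apply/tens_ofP; exact: tens_addl.
Qed.
Lemma tensDr v w w' : tens v (w + w') = tens v w + tens v w'.
Proof.
by rewrite -[RHS]/(tens_add _ _) tens_addE; apply/tens_ofP; exact: tens_addr.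
Qed.
Lemma tensZl a v w : tens (a *: v) w = a *: tens v w.
Proof. by rewrite -[RHS]/(tens_scal _ _) tens_scalE. Qed.
Lemma tensZr a v w : tens v (a *: w) = a *: tens v w.
Proof. by rewrite -tensZl; apply/tens_ofP; apply: tens_sym; exact: tens_scale. Qed.

Definition bilin (X : lmodType K) (B : V -> W -> X) : Prop :=
  (forall w, linear (B^~ w)) /\ (forall v, linear (B v)).

(* The linear map induced by a bilinear map B. *)
Definition tlift (X : lmodType K) (B : V -> W -> X) (x : tensor) : X :=
  \sum_(p <- repr x) B p.1 p.2.

Lemma tlift_of (X : lmodType K) (B : V -> W -> X) s :
  bilin B -> tlift B (tens_of s) = \sum_(p <- s) B p.1 p.2.
Proof.
case=> Bl Br; rewrite /tlift; move: (repr _) (tens_repr s) => t.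
elim=> {s t} //=.
- by move=> s t u _ -> _ ->.
- by move=> s s' t t' _ IH1 _ IH2; rewrite !big_cat /= IH1 IH2.
- by move=> s t; rewrite !big_cat /= addrC.
- move=> v v' w; rewrite !big_cons !big_nil /= !addr0.
  by have := Bl w 1 v v'; rewrite !scale1r.
- move=> v w w'; rewrite !big_cons !big_nil /= !addr0.
  by have := Br v 1 w w'; rewrite !scale1r.
- have B0l w : B 0 w = 0.
    by have /eqP := Bl w 1 0 0; rewrite !scale1r addr0 -subr_eq subrr => /eqP.
  have B0r v : B v 0 = 0.
    by have /eqP := Br v 1 0 0; rewrite !scale1r addr0 -subr_eq subrr => /eqP.
  move=> a v w; rewrite !big_cons !big_nil /= !addr0.
  by have := Bl w a v 0; have := Br v a w 0; rewrite !addr0 B0l B0r !addr0 => -> ->.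
- move=> w; rewrite big_cons !big_nil /= addr0.
  by have /eqP := Bl w 1 0 0; rewrite !scale1r addr0 -subr_eq subrr => /eqP.
Qed.

Lemma tlift_tens (X : lmodType K) (B : V -> W -> X) v w :
  bilin B -> tlift B (tens v w) = B v w.
Proof. by move=> bB; rewrite tlift_of // big_seq1. Qed.

Lemma tlift_linear (X : lmodType K) (B : V -> W -> X) :
  bilin B -> linear (tlift B).
Proof.
move=> bB a x y; rewrite -(tens_ofK x) -(tens_ofK y).
rewrite -[_ *: _ + _]/(tens_add (tens_scal _ _) _) tens_scalE tens_addE.
rewrite !tlift_of // big_cat /= big_map /= scaler_sumr; congr (_ + _).
apply: eq_bigr => -[v w] _ /=.
have B0 : B 0 w = 0.
  by have /eqP := bB.1 w 1 0 0; rewrite !scale1r addr0 -subr_eq subrr => /eqP.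
by have := bB.1 w a v 0; rewrite !addr0 B0 addr0.
Qed.

(* Membership in V (x) P, for a subspace P of W. *)
Definition tens_in (P : W -> Prop) (x : tensor) : Prop :=
  exists2 s : seq (V * W), (forall p, p \in s -> P p.2) & x = tens_of s.

End Tensor.

Notation "v *t w" := (tens v w) (at level 40, left associativity) : ring_scope.

Section TensorMaps.
Variable K : fieldType.

Definition tens_map (A B A' B' : lmodType K) (f : A -> A') (g : B -> B')
    (t : tensor A B) : tensor A' B' :=
  tlift (fun a b => f a *t g b) t.

Definition tens_assoc (A B C : lmodType K) (t : tensor (tensor A B) C) :
    tensor A (tensor B C) :=
  tlift (fun ab c => tlift (fun a b => a *t (b *t c)) ab) t.

End TensorMaps.

(* A formal series in x (resp. in x1, x2) is its family of coefficients: *)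
(* f n is the coefficient of x^n, and A m n that of x1^m x2^n.           *)
Section FormalSeries.
Variables (K : fieldType) (W : lmodType K).

Definition in_laurent (f : int -> W) : Prop :=
  exists N : int, forall n, n < N -> f n = 0.

Definition in_laurent2 (A : int -> int -> W) : Prop :=
  exists N : int, forall m n, m < N \/ n < N -> A m n = 0.

(* W (x) K((x)) -> W((x)) *)
Definition tens_series (t : tensor W (laurent K)) : int -> W :=
  fun n => tlift (fun w (f : laurent K) => f n *: w) t.

(* W (x) P, as a subspace of W((x)), for a subspace P of K((x)). *)
Definition in_tens_laurent (P : laurent K -> Prop) (f : int -> W) : Prop :=
  exists2 t : tensor W (laurent K), tens_in P t & f = tens_series t.

(* f(cx) *)
Definition dilate (c : K) (f : int -> W) : int -> W := fun n => c ^ n *: f n.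

Definition smul (F : laurent (laurent K)) (A : int -> int -> W) :
    int -> int -> W :=
  fun m n => \sum_(ij \in [set: int * int])
    F ij.1 ij.2 *: A (m - ij.1) (n - ij.2).

(* A(x1,x2) |_{x1 = a(x2,z)} for a in K((x2))((z)), as a series in (z,x2). *)
Definition subst1 (a : laurent (laurent K)) (A : int -> int -> W) :
    int -> int -> W :=
  fun k l => \sum_(mn \in [set: int * int])
    (a ^ mn.1) k (l - mn.2) *: A mn.1 mn.2.

End FormalSeries.

Section ScalarSeries.

Definition lX (R : comNzRingType) : laurent R :=
  mklaurent (fun n => (n == 1)%:R).

Definition lderiv (R : comNzRingType) (f : laurent R) : laurent R :=
  mklaurent (fun n => f (n + 1) *~ (n + 1)).

Variable K : fieldType.

(* x + z and x - z in K((x))((z)): their powers are the expansions in *)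
(* nonnegative powers of z.                                           *)
Definition x_plus_z : laurent (laurent K) := lconst (lX K) + lX (laurent K).
Definition x_minus_z : laurent (laurent K) := lconst (lX K) - lX (laurent K).

(* p(x1) and p(x2) *)
Definition s2in1 (p : laurent K) : series2 K :=
  mks2 (fun m n => if n == 0 then p m else 0).
Definition s2in2 (p : laurent K) : series2 K :=
  mks2 (fun m n => if m == 0 then p n else 0).

Definition s2X1 : series2 K := s2in1 (lX K).
Definition s2X2 : series2 K := s2in2 (lX K).

Definition s2poly (q : {poly K}) (u : series2 K) : series2 K :=
  (map_poly (@s2const K) q).[u].

Definition s2d1 (f : series2 K) : series2 K :=
  mks2 (fun m n => f (m + 1) n *~ (m + 1)).
Definition s2d2 (f : series2 K) : series2 K :=
  mks2 (fun m n => f m (n + 1) *~ (n + 1)).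

Definition fnum (F : frac2 K) : series2 K := \n_(repr (F : {fraction series2 K})).
Definition fden (F : frac2 K) : series2 K := \d_(repr (F : {fraction series2 K})).

(* The extension of a derivation of K((x1,x2)) to its fraction field. *)
Definition fderiv (d : series2 K -> series2 K) (F : frac2 K) : frac2 K :=
  s2frac (d (fnum F) * fden F - fnum F * d (fden F)) / s2frac (fden F ^+ 2).

(* The extension of a ring embedding of K((x1,x2)) into a field. *)
Definition fextend (L : fieldType) (e : series2 K -> L) (F : frac2 K) : L :=
  e (fnum F) / e (fden F).

Definition iota21 : frac2 K -> laurent (laurent K) := fextend (@s2val K).

(* f(a(x,z),x) for f in K((x1,x2)) and a in K((x))((z)) *)
Definition s2eval (a : laurent (laurent K)) (f : series2 K) :
    laurent (laurent K) :=
  mklaurent (fun k =>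
    mklaurent (subst1 a (fun m n => (f m n : K^o)) k : int -> K)).

End ScalarSeries.

Section Phi.
Variables (K : fieldType) (p : laurent K).

(* e^{z p(x) d/dx} x, as an element of K((x))((z)) *)
Definition phi : laurent (laurent K) :=
  mklaurent (fun n =>
    if n is Posz k then (k`!%:R : K)^-1 *: iter k (fun f => p * lderiv f) (lX K)
    else 0).

Definition phi_eval : frac2 K -> laurent (laurent K) := fextend (s2eval phi).

Definition Cphi2 (F : frac2 K) : Prop :=
  s2frac (s2in1 p) * fderiv (@s2d1 K) F = - (s2frac (s2in2 p) * fderiv (@s2d2 K) F).

(* On Cphi2, [phi_eval F] has coefficients in K, so that its value in K((z)) *)
(* is obtained by taking the coefficient of x^0.                             *)
Definition pi_phi (F : frac2 K) : laurent K :=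
  mklaurent (fun n => phi_eval F n 0).

Definition Cphi (f : laurent K) : Prop := exists2 F, Cphi2 F & pi_phi F = f.

(* The element of V (x) Cphi2 that 1 (x) pi_phi sends to f. *)
Definition pi_phi_inv (V : lmodType K) (f : int -> V) : tensor V (frac2 K) :=
  xget 0 [set t | tens_in Cphi2 t /\ tens_series (tens_map id pi_phi t) = f]%classic.

End Phi.

Section VertexAlgebra.
Variable K : fieldType.

(* Y u w n is the coefficient of x^n in Y(u,x)w. *)
Definition is_vertex_map (V W : lmodType K) (Y : V -> W -> int -> W) : Prop :=
  (forall n, bilin (fun u w => Y u w n)) /\ (forall u w, in_laurent (Y u w)).

(* Y1(u,x1) Y2(v,x2) w *)
Definition Ycomp (A B W : lmodType K) (Y1 : A -> W -> int -> W)
    (Y2 : B -> W -> int -> W) (u : A) (v : B) (w : W) : int -> int -> W :=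
  fun m n => Y1 u (Y2 v w n) m.

(* Y1(u,x) Y2(v,x) w *)
Definition Ydiag (A B W : lmodType K) (Y1 : A -> W -> int -> W)
    (Y2 : B -> W -> int -> W) (u : A) (v : B) (w : W) : int -> W :=
  fun n => \sum_(i \in [set: int]) Y1 u (Y2 v w i) (n - i).

Definition weak_assoc (V W : lmodType K) (YV : V -> V -> int -> V)
    (YW : V -> W -> int -> W) : Prop :=
  forall u v, exists k : nat, forall w,
    let A := smul ((s2X1 K - s2X2 K) ^+ k) (Ycomp YW YW u v w) in
    in_laurent2 A /\
    subst1 (x_plus_z K) A = (fun i j => YW (YV u v (i - k%:Z)) w j).

Record is_nlva (V : lmodType K) (Y : V -> V -> int -> V) (one : V) : Prop := {
  nlva_vertex_map : is_vertex_map Y;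
  nlva_vacuum : forall v, Y one v = delta0 v;
  nlva_creation : forall v, (forall n, n < 0 -> Y v one n = 0) /\ Y v one 0 = v;
  nlva_weak_assoc : weak_assoc Y Y
}.

Record is_nlva_module (V W : lmodType K) (YV : V -> V -> int -> V) (one : V)
    (YW : V -> W -> int -> W) : Prop := {
  nlvm_vertex_map : is_vertex_map YW;
  nlvm_vacuum : forall w, YW one w = delta0 w;
  nlvm_weak_assoc : weak_assoc YV YW
}.

Record is_nlva_hom (A B : lmodType K) (YA : A -> A -> int -> A) (oneA : A)
    (YB : B -> B -> int -> B) (oneB : B) (f : A -> B) : Prop := {
  nlva_hom_linear : linear f;
  nlva_hom_one : f oneA = oneB;
  nlva_hom_Y : forall u v n, f (YA u v n) = YB (f u) (f v) n
}.

Definition Yscal (a b : K^o) : int -> K^o := delta0 (a * b : K^o).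

(* The product of f in A((x)) and g in B((x)), in (A (x) B)((x)). *)
Definition tens_conv (A B : lmodType K) (f : int -> A) (g : int -> B) :
    int -> tensor A B :=
  fun n => \sum_(i \in [set: int]) f i *t g (n - i).

Definition Ytens (A B : lmodType K) (YA : A -> A -> int -> A)
    (YB : B -> B -> int -> B) (x y : tensor A B) : int -> tensor A B :=
  fun n => tlift (fun a b => tlift (fun a' b' =>
    tens_conv (YA a a') (YB b b') n) y) x.

Record is_coalgebra (H : lmodType K) (Delta : H -> tensor H H) (eps : H -> K) :
    Prop := {
  coalg_Delta_linear : linear Delta;
  coalg_eps_linear : linear (eps : H -> K^o);
  coalg_coassoc : forall h,
    tens_assoc (tens_map Delta id (Delta h)) = tens_map id Delta (Delta h);
  coalg_counitl : forall h, tlift (fun a b => eps a *: b) (Delta h) = h;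
  coalg_counitr : forall h, tlift (fun a b => eps b *: a) (Delta h) = h
}.

Record is_nlvb (H : lmodType K) (Y : H -> H -> int -> H) (one : H)
    (Delta : H -> tensor H H) (eps : H -> K) : Prop := {
  nlvb_nlva : is_nlva Y one;
  nlvb_coalgebra : is_coalgebra Delta eps;
  nlvb_Delta : is_nlva_hom Y one (Ytens Y Y) (one *t one) Delta;
  nlvb_eps : is_nlva_hom Y one Yscal (1 : K^o) (eps : H -> K^o)
}.

(* Y(a(x1 - x2), x2) b(x1), with a(x1 - x2) = \sum_k a_k (x1 - x2)^k *)
Definition Yshift (V : lmodType K) (Y : V -> V -> int -> V) (a b : int -> V) :
    int -> int -> V :=
  fun m n => \sum_(ijk \in [set: int * int * int])
    (x_minus_z K ^ ijk.2) ijk.1.2 ijk.1.1 *: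
      Y (a ijk.2) (b (m - ijk.1.1)) (n - ijk.1.2).

Record is_Hmodule_nlva (H V : lmodType K) (YH : H -> H -> int -> H) (oneH : H)
    (Delta : H -> tensor H H) (eps : H -> K)
    (YV : V -> V -> int -> V) (oneV : V) (YHV : H -> V -> int -> V) : Prop := {
  Hnlva_nlva : is_nlva YV oneV;
  Hnlva_module : is_nlva_module YH oneH YHV;
  Hnlva_tens : forall h v, in_tens_laurent (fun=> True) (YHV h v);
  Hnlva_vacuum : forall h, YHV h oneV = delta0 (eps h *: oneV);
  Hnlva_Y : forall h u v m n,
    YHV h (YV u v n) m =
    tlift (fun h1 h2 => Yshift YV (YHV h1 u) (YHV h2 v) m n) (Delta h)
}.

Definition Ysmash (H V : lmodType K) (YH : H -> H -> int -> H)
    (Delta : H -> tensor H H) (YV : V -> V -> int -> V)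
    (YHV : H -> V -> int -> V) (x y : tensor V H) : int -> tensor V H :=
  fun n => tlift (fun u h => tlift (fun v h' => tlift (fun h1 h2 =>
    tens_conv (Ydiag YV YHV u h1 v) (YH h2 h') n) (Delta h)) y) x.

End VertexAlgebra.

Section Equivariance.
Variables (K : fieldType) (G : groupType).

Definition is_linear_character (chi : G -> K) : Prop :=
  chi 1%g = 1 /\ forall g g', chi (g * g')%g = chi g * chi g'.

Record is_representation (V : lmodType K) (R : G -> V -> V) : Prop := {
  rep_linear : forall g, linear (R g);
  rep_one : forall v, R 1%g v = v;
  rep_mul : forall g g' v, R (g * g')%g v = R g (R g' v)
}.

Record is_Gnlva (chi : G -> K) (V : lmodType K) (Y : V -> V -> int -> V)
    (one : V) (R : G -> V -> V) : Prop := {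
  Gnlva_nlva : is_nlva Y one;
  Gnlva_rep : is_representation R;
  Gnlva_one : forall g, R g one = one;
  Gnlva_Y : forall g u v,
    (fun n => R g (Y u (R g^-1%g v) n)) = dilate (chi g) (Y (R g u) v)
}.

Record is_Gnlvb (chi : G -> K) (H : lmodType K) (Y : H -> H -> int -> H)
    (one : H) (Delta : H -> tensor H H) (eps : H -> K) (R : G -> H -> H) :
    Prop := {
  Gnlvb_nlvb : is_nlvb Y one Delta eps;
  Gnlvb_Gnlva : is_Gnlva chi Y one R;
  Gnlvb_Delta : forall g h, Delta (R g h) = tens_map (R g) (R g) (Delta h);
  Gnlvb_eps : forall g h, eps (R g h) = eps h
}.

(* The multiplicative monoid generated by the x - c g. *)
Definition linear_factor_monoid (c : G -> K) (q : {poly K}) : Prop :=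
  exists s : seq G, q = \prod_(g <- s) ('X - (c g)%:P).

Variables (p : laurent K) (chiphi : G -> K).

(* phi(x, chi(g) z) = chiphi(g) phi(chiphi(g)^-1 x, z) *)
Definition phi_character_rel (chi : G -> K) : Prop :=
  forall g k l, chi g ^ k * phi p k l = chiphi g * ((chiphi g)^-1 ^ l * phi p k l).

Record is_phi_compatible (H V : lmodType K) (YH : H -> H -> int -> H) (oneH : H)
    (Delta : H -> tensor H H) (eps : H -> K)
    (YV : V -> V -> int -> V) (oneV : V) (YHV : H -> V -> int -> V) : Prop := {
  phic_Hmodule : is_Hmodule_nlva YH oneH Delta eps YV oneV YHV;
  phic_tens : forall h v, in_tens_laurent (Cphi p) (YHV h v);
  phic_poly : forall h v, exists2 q, linear_factor_monoid chiphi q &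
    tens_in (fun F => exists f, F = s2frac f)
      (tens_map id (fun F => s2frac (s2poly q (s2X2 K / s2X1 K)) * F)
        (pi_phi_inv p (YHV h v)))
}.

Record is_phi_quasi_module (V W : lmodType K) (YV : V -> V -> int -> V)
    (one : V) (YW : V -> W -> int -> W) : Prop := {
  phiq_vertex_map : is_vertex_map YW;
  phiq_vacuum : forall w, YW one w = delta0 w;
  phiq_weak_assoc : forall u v, exists2 f : series2 K, f != 0 & forall w,
    let A := smul f (Ycomp YW YW u v w) in
    in_laurent2 A /\
    subst1 (phi p) A = smul (s2eval (phi p) f) (fun i j => YW (YV u v i) w j)
}.

Record is_equivariant_module (V W : lmodType K) (YV : V -> V -> int -> V)
    (one : V) (R : G -> V -> V) (YW : V -> W -> int -> W) : Prop := {
  eqm_module : is_phi_quasi_module YV one YW;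
  eqm_rep : forall g v w, YW (R g v) w = dilate (chiphi g)^-1 (YW v w);
  eqm_poly : forall u v, exists2 q, linear_factor_monoid chiphi q &
    forall w, in_laurent2 (smul (s2poly q (s2X1 K / s2X2 K)) (Ycomp YW YW u v w))
}.

Record is_equivariant_HV_module (H V W : lmodType K)
    (YH : H -> H -> int -> H) (oneH : H) (Delta : H -> tensor H H)
    (RH : G -> H -> H) (YV : V -> V -> int -> V) (oneV : V) (RV : G -> V -> V)
    (YHV : H -> V -> int -> V)
    (YWH : H -> W -> int -> W) (YWV : V -> W -> int -> W) : Prop := {
  HVm_H : is_equivariant_module YH oneH RH YWH;
  HVm_V : is_equivariant_module YV oneV RV YWV;
  HVm_tens : forall h w, in_tens_laurent (fun=> True) (YWH h w);
  HVm_comm : forall h v w m n,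
    YWH h (YWV v w n) m =
    tlift (fun h1 h2 => tlift (fun u F =>
        smul (iota21 F) (fun i j => YWV u (YWH h2 w i) j) m n)
      (pi_phi_inv p (YHV h1 v))) (Delta h)
}.

End Equivariance.

Definition YWsharp (K : fieldType) (H V W : lmodType K)
    (YWH : H -> W -> int -> W) (YWV : V -> W -> int -> W) (x : tensor V H) (w : W) :
    int -> W :=
  fun n => tlift (fun v h => Ydiag YWV YWH v h w n) x.

(* Main.v *)
Require Import Defs.
From mathcomp Require Import all_boot all_order all_algebra.
From mathcomp Require Import complex reals.
From mathcomp Require Import fraction zify boolp classical_sets fsbigop.

Set Implicit Arguments.
Unset Strict Implicit.
Unset Printing Implicit Defensive.

Import Order.TTheory GRing.Theory Num.Theory.
Local Open Scope ring_scope.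

(** To associate Y#(u (x) h, x1) Y#(v (x) h', x2), move Y_W^H(h, x1) to the
right of Y_W^V(v, x2): by compatibility this is possible after multiplication
by some q(x2/x1) clearing the poles of the extension of Y_V^H(h, z)v to two
variables. What remains is a sum of products
Y_W^V(u, x1) Y_W^V(v', x2) Y_W^H(h2, x1) Y_W^H(h', x2), to which the weak
associativity of Y_W^V and of Y_W^H applies; the condition
Y_W^H(h, x)w in W (x) C((x)) gives the uniform truncation bounds that allow
the two substitutions x1 = phi(x2, z) to be carried out independently. All
multipliers are units times some q(x1/x2), which yields equivariance; those
given by weak associativity are brought to this form by cancelling
f(phi(x2, z), x2), since f |-> f(phi(x2, z), x2) is injective.

That V # H is a nonlocal vertex algebra is the same statement for p = 1 and
multipliers (x1 - x2)^k, applied to W = V (x) H on which V acts through the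
first factor and H through Delta: there Y# is the smash product itself. *)

(** Two obstacles shape the argument. First, once the fields of H have acted, the fields of V are
    applied to the whole infinite family of coefficients [YWH h (YWH h' w j) i], whereas weak
    associativity bounds a product for one vector at a time. The notion [tame] asks for a subspace
    on which these bounds are uniform. In W a finite-dimensional one suffices. In V (x) H the
    subspace is (finite span) (x) H, and bounds at finitely many v (x) 1 propagate to it, since v
    (x) x is the image of v (x) 1 under a map that commutes with the fields of V. Second, products
    of fields lie in W((x1))((x2)), iterates and everything expanded by iota_{x2,x1} in
    W((x2))((x1)), with z in place of x1 for iterates. Only C((x1,x2)) acts on the former, while the
    latter is a vector space over the field C((x2))((x1)). A multiplier acquired on the way is
    therefore carried along into the final one, unless it is a unit or its substituted image can be
    inverted in C((x2))((z)). *)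

Definition irange (a b : int) : seq int := [seq a + k%:Z | k <- iota 0 `|b - a|.+1].

Lemma in_irange (a b i : int) : a <= i -> i <= b -> i \in irange a b.
Proof.
by move=> ai ib; apply/mapP; exists `|i - a|%N; [rewrite mem_iota|]; lia.
Qed.

(** * Finitely supported sums *)

Section FiniteSums.
Variable V : zmodType.

(** A sum over [[set: I]] is 0 by convention when its support is infinite, so additivity,
    interchange of sums and passing a linear map under the sum each require a proof of finiteness.
    The list may exceed the support. *)
Definition fs (I : choiceType) (F : I -> V) : Prop :=
  exists s : seq I, forall i, F i != 0 -> i \in s.

Lemma fs_finite (I : choiceType) (F : I -> V) :
  fs F -> exists2 s, uniq s & forall i, i \notin s -> F i = 0.
Proof.
case=> s Fs; exists (undup s) => [|i]; first exact: undup_uniq.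
by rewrite mem_undup => nis; apply/eqP; apply: contraNT nis => /Fs.
Qed.

Lemma fsumE (I : choiceType) (F : I -> V) (s : seq I) :
  uniq s -> (forall i, i \notin s -> F i = 0) ->
  \sum_(i \in [set: I]) F i = \sum_(i <- s) F i.
Proof.
move=> us Fs; rewrite (@fsbigE _ _ _ _ _ s) //; last by move=> i _; exact: Fs.
by apply: eq_bigl => i; rewrite in_setT.
Qed.

Lemma eq_fsum (I : choiceType) (F G : I -> V) :
  (forall i, F i = G i) -> \sum_(i \in [set: I]) F i = \sum_(i \in [set: I]) G i.
Proof. by move=> FG; apply: eq_fsbigr => i _; exact: FG. Qed.

Lemma fsum0 (I : choiceType) (F : I -> V) :
  (forall i, F i = 0) -> \sum_(i \in [set: I]) F i = 0.
Proof. by move=> F0; apply: fsbig1 => i _. Qed.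

Lemma fsum_neq0 (I : choiceType) (F : I -> V) :
  \sum_(i \in [set: I]) F i != 0 -> exists i, F i != 0.
Proof.
move=> F0; apply: contrapT => nex; case/eqP: F0; apply: fsum0 => i.
by apply/eqP; apply: contra_notT nex => Fi; exists i.
Qed.

Lemma fsum1 (I : choiceType) (i0 : I) (F : I -> V) :
  (forall i, i != i0 -> F i = 0) -> \sum_(i \in [set: I]) F i = F i0.
Proof.
move=> F0; rewrite (@fsumE _ _ [:: i0]) //; first by rewrite big_seq1.
by move=> i; rewrite inE => /F0.
Qed.

Lemma fs_pair (I J : choiceType) (F : I * J -> V) (s : seq I) :
  (forall i j, F (i, j) != 0 -> i \in s) -> (forall i, fs (fun j => F (i, j))) ->
  fs F.
Proof.
move=> Fs /boolp.choice [t Ft]; exists (flatten [seq [seq (i, j) | j <- t i] | i <- s]).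
case=> i j nz; apply/flattenP; exists [seq (i, j) | j <- t i].
  by apply/mapP; exists i => //; exact: Fs nz.
by apply/mapP; exists j => //; exact: Ft.
Qed.

Lemma fs_int (F : int -> V) (a b : int) :
  (forall i, F i != 0 -> a <= i /\ i <= b) -> fs F.
Proof. by move=> Fab; exists (irange a b) => i /Fab []; exact: in_irange. Qed.

Lemma fs_int_pair (J : choiceType) (F : int * J -> V) (a b : int) :
  (forall i j, F (i, j) != 0 -> a <= i /\ i <= b) ->
  (forall i, fs (fun j => F (i, j))) -> fs F.
Proof.
by move=> Fab; apply: (@fs_pair _ _ _ (irange a b)) => i j /Fab []; exact: in_irange.
Qed.

Lemma fsum_pair (I J : choiceType) (F : I * J -> V) : fs F ->
  \sum_(x \in [set: I * J]) F x =
  \sum_(i \in [set: I]) \sum_(j \in [set: J]) F (i, j).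
Proof.
case/fs_finite => s us Fs.
pose t1 := undup (unzip1 s); pose t2 := undup (unzip2 s).
have t1P i j : i \notin t1 -> F (i, j) = 0.
  rewrite mem_undup => it; apply: Fs; apply: contraNN it => ijs.
  by apply/mapP; exists (i, j).
have t2P i j : j \notin t2 -> F (i, j) = 0.
  rewrite mem_undup => it; apply: Fs; apply: contraNN it => ijs.
  by apply/mapP; exists (i, j).
rewrite (@fsumE _ _ t1) ?undup_uniq //; last first.
  by move=> i it; apply: fsum0 => j; exact: t1P.
have rowE i : \sum_(j \in [set: J]) F (i, j) = \sum_(j <- t2) F (i, j).
  by rewrite (@fsumE _ _ t2) ?undup_uniq // => j; exact: t2P.
under [RHS]eq_bigr => i _ do rewrite rowE.
rewrite (@fsumE _ _ [seq (i, j) | i <- t1, j <- t2]).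
- by rewrite big_allpairs.
- by apply: allpairs_uniq; rewrite ?undup_uniq // => -[i j] [k l].
- move=> [i j] nij; case: (boolP (i \in t1)) => [it|/t1P -> //].
  case: (boolP (j \in t2)) => [jt|/t2P -> //].
  by case/negP: nij; apply/allpairsP; exists (i, j).
Qed.

Lemma fs_fst (I J : choiceType) (F : I * J -> V) : fs F ->
  fs (fun i => \sum_(j \in [set: J]) F (i, j)).
Proof.
by case=> s Fs; exists (map fst s) => i /fsum_neq0 [j /Fs ijs]; apply/mapP; exists (i, j).
Qed.

Lemma fsum_reindex (I J : choiceType) (h : I -> J) (k : J -> I) (F : J -> V) :
  cancel h k -> cancel k h ->
  \sum_(j \in [set: J]) F j = \sum_(i \in [set: I]) F (h i).
Proof. by move=> hk kh; apply: reindex_fsbigT; exists k. Qed.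

Lemma fs_reindex (I J : choiceType) (h : I -> J) (k : J -> I) (F : J -> V) :
  cancel h k -> fs F -> fs (fun i => F (h i)).
Proof.
move=> hk [s Fs]; exists (map k s) => i /Fs his.
by apply/mapP; exists (h i); rewrite ?hk.
Qed.

Lemma fsum_exch (I J : choiceType) (F : I -> J -> V) :
  fs (fun x : I * J => F x.1 x.2) ->
  \sum_(i \in [set: I]) \sum_(j \in [set: J]) F i j =
  \sum_(j \in [set: J]) \sum_(i \in [set: I]) F i j.
Proof.
move=> fF; rewrite -(fsum_pair fF).
have fF' : fs (fun x : J * I => F x.2 x.1).
  by apply: (@fs_reindex _ _ (fun x : J * I => (x.2, x.1)) (fun x => (x.2, x.1)) _ _ fF) => -[].
rewrite -(fsum_pair fF').
by apply: (@fsum_reindex _ _ (fun x : J * I => (x.2, x.1)) (fun x => (x.2, x.1))) => -[].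
Qed.

Lemma fsumD (I : choiceType) (F G : I -> V) : fs F -> fs G ->
  \sum_(i \in [set: I]) (F i + G i) =
  \sum_(i \in [set: I]) F i + \sum_(i \in [set: I]) G i.
Proof.
case=> s Fs [t Gt]; pose r := undup (s ++ t).
have Fr i : i \notin r -> F i = 0.
  by rewrite mem_undup mem_cat => nr; apply/eqP; apply: contraNT nr => /Fs ->.
have Gr i : i \notin r -> G i = 0.
  by rewrite mem_undup mem_cat => nr; apply/eqP; apply: contraNT nr => /Gt ->; rewrite orbT.
rewrite !(@fsumE _ _ r) ?undup_uniq ?big_split //.
by move=> i ir; rewrite Fr ?Gr ?addr0.
Qed.

Lemma fs_big (I : choiceType) (T : Type) (r : seq T) (F : T -> I -> V) :
  (forall t, fs (F t)) -> fs (fun i => \sum_(t <- r) F t i).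
Proof.
move=> fF; elim: r => [|t r [s rs]]; first by exists [::] => i; rewrite big_nil eqxx.
have [s' Fs'] := fF t; exists (s' ++ s) => i; rewrite big_cons mem_cat => nz.
case: (eqVneq (F t i) 0) nz => [->|/Fs' ->//]; rewrite add0r => /rs ->.
by rewrite orbT.
Qed.

Lemma fsum_big (I : choiceType) (T : Type) (r : seq T) (F : T -> I -> V) :
  (forall t, fs (F t)) ->
  \sum_(i \in [set: I]) \sum_(t <- r) F t i = \sum_(t <- r) \sum_(i \in [set: I]) F t i.
Proof.
move=> fF; elim: r => [|t r IH].
  by rewrite big_nil; apply: fsum0 => i; rewrite big_nil.
rewrite big_cons -IH -fsumD //; last exact: fs_big.
by apply: eq_fsum => i; rewrite big_cons.
Qed.

End FiniteSums.

Lemma fsum_morph (I : choiceType) (V W : zmodType) (g : V -> W) (F : I -> V) :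
  {morph g : x y / x + y} -> fs F ->
  g (\sum_(i \in [set: I]) F i) = \sum_(i \in [set: I]) g (F i).
Proof.
move=> gD /fs_finite [s us Fs].
have g0 : g 0 = 0 by apply: (@addrI _ (g 0)); rewrite -gD !addr0.
rewrite (fsumE us Fs) (fsumE us) => [|i /Fs -> //].
by rewrite (big_morph g gD g0).
Qed.

Lemma fs_morph (I : choiceType) (V W : zmodType) (g : V -> W) (F : I -> V) :
  g 0 = 0 -> fs F -> fs (fun i => g (F i)).
Proof.
move=> g0 [s Fs]; exists s => i gF; apply: Fs; apply: contra_neq gF => ->.
exact: g0.
Qed.

Section LinearMaps.
Variables (K : fieldType) (U W : lmodType K) (f : U -> W).
Hypothesis lf : linear f.

Lemma lin_add : {morph f : x y / x + y}.
Proof. by move=> x y; have := lf 1 x y; rewrite !scale1r. Qed.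
Lemma lin_0 : f 0 = 0.
Proof. by apply: (@addrI _ (f 0)); rewrite -lin_add !addr0. Qed.
Lemma lin_scale a x : f (a *: x) = a *: f x.
Proof. by have := lf a x 0; rewrite lin_0 !addr0. Qed.
Lemma lin_sum (I : Type) (r : seq I) (F : I -> U) :
  f (\sum_(i <- r) F i) = \sum_(i <- r) f (F i).
Proof. by rewrite (big_morph f lin_add lin_0). Qed.
Lemma lin_fsum (I : choiceType) (F : I -> U) : fs F ->
  f (\sum_(i \in [set: I]) F i) = \sum_(i \in [set: I]) f (F i).
Proof. by move=> fF; exact: fsum_morph lin_add fF. Qed.
Lemma lin_fs (I : choiceType) (F : I -> U) : fs F -> fs (fun i => f (F i)).
Proof. by move=> fF; exact: fs_morph lin_0 fF. Qed.
Lemma lin_neq0 x : f x != 0 -> x != 0.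
Proof. by apply: contra_neq => ->; exact: lin_0. Qed.

End LinearMaps.

Lemma linear_comp (K : fieldType) (U V W : lmodType K) (f : V -> W) (g : U -> V) :
  linear f -> linear g -> linear (fun x => f (g x)).
Proof. by move=> lf lg a x y; rewrite lg lf. Qed.

Lemma linear_scaler (K : fieldType) (W : lmodType K) (c : K) : linear (fun w : W => c *: w).
Proof. by move=> b x y; rewrite scalerDr !scalerA mulrC. Qed.

Lemma linear_scalel (K : fieldType) (W : lmodType K) (w : W) : linear (fun c : K^o => c *: w).
Proof. by move=> b x y; rewrite scalerDl scalerA. Qed.

Lemma linear_big (K : fieldType) (U W : lmodType K) (I : Type) (r : seq I)
    (F : I -> U -> W) :
  (forall i, linear (F i)) -> linear (fun x => \sum_(i <- r) F i x).
Proof.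
move=> lF a x y; rewrite scaler_sumr -big_split /=; apply: eq_bigr => i _.
exact: lF.
Qed.

Lemma linear_fsum (K : fieldType) (U W : lmodType K) (I : choiceType)
    (F : I -> U -> W) :
  (forall i, linear (F i)) -> (forall x, fs (fun i => F i x)) ->
  linear (fun x => \sum_(i \in [set: I]) F i x).
Proof.
move=> lF fF a x y; rewrite (lin_fsum (@linear_scaler _ W a)) // -fsumD //.
  by apply: eq_fsum => i; exact: lF.
exact: (@lin_fs _ _ _ (fun w => a *: w) (@linear_scaler _ W a) _ _ (fF x)).
Qed.

(* The coefficients of \sum_(i, j) x1^i x2^j G_ij(x1, x2). *)
Definition conv2 (W : zmodType) (G : int -> int -> int -> int -> W) :
    int -> int -> W :=
  fun m n => \sum_(ij \in [set: int * int]) G ij.1 ij.2 (m - ij.1) (n - ij.2).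

(** For fixed x the sum runs over all of [Y], hence is invariant under the bijection [s x]. With [s]
    a subtraction of exponents, the interchange moves a multiplier from the total exponents to those
    of one factor. *)
Lemma fsum_exch_shift (X Y : choiceType) (W : zmodType) (H : X -> Y -> W)
    (s s' : X -> Y -> Y) :
  (forall x, cancel (s x) (s' x)) -> (forall x, cancel (s' x) (s x)) ->
  fs (fun xy : X * Y => H xy.1 xy.2) ->
  \sum_(y \in [set: Y]) \sum_(x \in [set: X]) H x (s x y) =
  \sum_(x \in [set: X]) \sum_(y \in [set: Y]) H x y.
Proof.
move=> ss' s's fH.
have fH' : fs (fun xy : X * Y => H xy.1 (s xy.1 xy.2)).
  apply: (@fs_reindex _ _ _ (fun xy : X * Y => (xy.1, s xy.1 xy.2))
    (fun xy => (xy.1, s' xy.1 xy.2)) _ _ fH).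
  by case=> x y /=; rewrite ss'.
rewrite -fsum_exch //; apply: eq_fsum => x.
by rewrite [RHS](@fsum_reindex _ _ _ (s x) (s' x)).
Qed.

(** * Contractions of series in two variables *)

Section Contraction.
Variables (K : fieldType) (W : lmodType K).
Implicit Types (f : laurent (laurent K)) (G : int -> int -> int -> int -> W).

(** [x.1] is the exponent pair of the multiplier and [x.2] the first exponent pair of [G]. Having
    one finite list for both justifies the three ways below of letting [f] act on two of the four
    exponents. *)
Definition summable2 f G := forall m n, exists s : seq ((int * int) * (int * int)),
  forall x, f x.1.1 x.1.2 != 0 ->
    G x.2.1 x.2.2 (m - x.1.1 - x.2.1) (n - x.1.2 - x.2.2) != 0 -> x \in s.

Lemma smulE f (A : int -> int -> W) : smul f A = conv2 (fun i j m n => f i j *: A m n).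
Proof. by []. Qed.

Lemma summable2_fs f G m n : summable2 f G ->
  fs (fun x : (int * int) * (int * int) => f x.1.1 x.1.2 *:
    G x.2.1 x.2.2 (m - x.1.1 - x.2.1) (n - x.1.2 - x.2.2)).
Proof.
move=> /(_ m n)[s sP]; exists s => x; rewrite scaler_eq0 negb_or => /andP[].
exact: sP.
Qed.

Lemma smul_conv2 f G m n : summable2 f G ->
  smul f (conv2 G) m n = \sum_(x \in [set: int * int]) \sum_(y \in [set: int * int])
    f x.1 x.2 *: G y.1 y.2 (m - x.1 - y.1) (n - x.2 - y.2).
Proof.
move=> /(_ m n)[s sP]; apply: eq_fsum => x.
have [->|f0] := eqVneq (f x.1 x.2) 0.
  by rewrite scale0r fsum0 // => y; rewrite scale0r.
rewrite (lin_fsum (@linear_scaler _ W (f x.1 x.2))) //.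
exists (map snd s) => y Gy; apply/mapP; exists (x, y) => //.
exact: sP.
Qed.

Lemma smul_conv2_in f G : summable2 f G ->
  smul f (conv2 G) = conv2 (fun i j => smul f (G i j)).
Proof.
move=> fG; apply/funext => m; apply/funext => n; rewrite smul_conv2 //.
rewrite -(@fsum_exch_shift _ _ _ _ (fun _ => id) (fun _ => id)) //; last first.
  exact: summable2_fs.
apply: eq_fsum => x; apply: eq_fsum => y /=.
by congr (_ *: G _ _ _ _); rewrite -!addrA; congr (_ + _); rewrite addrC.
Qed.

Lemma smul_conv2_out f G : summable2 f G ->
  smul f (conv2 G) = conv2 (fun i j m n => smul f (fun i j => G i j m n) i j).
Proof.
move=> fG; apply/funext => m; apply/funext => n; rewrite smul_conv2 //.
rewrite -(@fsum_exch_shift _ _ _ _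
  (fun x y => (y.1 - x.1, y.2 - x.2)) (fun x y => (y.1 + x.1, y.2 + x.2))) //.
- apply: eq_fsum => x; apply: eq_fsum => y /=.
  by congr (_ *: G _ _ _ _); lia.
- by move=> x [a b] /=; rewrite !subrK.
- by move=> x [a b] /=; rewrite !addrK.
- exact: summable2_fs.
Qed.

(** The pair (i, n) takes one exponent from each factor. In a product of four fields these are the
    exponents of the two neighbouring fields in the middle, the ones that the multiplier is meant to
    commute. *)
Lemma smul_conv2_mid f G : summable2 f G ->
  smul f (conv2 G) = conv2 (fun i j m n => smul f (fun i n => G i j m n) i n).
Proof.
move=> fG; apply/funext => m; apply/funext => n; rewrite smul_conv2 //.
rewrite -(@fsum_exch_shift _ _ _ _
  (fun x y => (y.1 - x.1, y.2)) (fun x y => (y.1 + x.1, y.2))) //.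
- apply: eq_fsum => x; apply: eq_fsum => y /=.
  by congr (_ *: G _ _ _ _); lia.
- by move=> x [a b] /=; rewrite subrK.
- by move=> x [a b] /=; rewrite addrK.
- exact: summable2_fs.
Qed.

End Contraction.

Lemma unif_range (P : int -> int -> Prop) (a b : int) :
  (forall i, exists N, P i N) -> (forall i N N', N' <= N -> P i N -> P i N') ->
  exists N, forall i, a <= i -> i <= b -> P i N.
Proof.
move=> exP monP.
suff [N NP] : exists N, forall k : nat, (k <= `|b - a|)%N -> P (a + k%:Z) N.
  exists N => i ai ib; have -> : i = a + `|i - a|%N%:Z by lia.
  by apply: NP; lia.
elim: `|b - a|%N => [|l [N IH]].
  by have [N NP] := exP a; exists N => k; rewrite leqn0 => /eqP ->; rewrite addr0.
have [N' N'P] := exP (a + l.+1%:Z); exists (Order.min N N') => k.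
rewrite leq_eqVlt => /predU1P[->|kl].
  by apply: monP N'P; rewrite ge_min lexx orbT.
by apply: monP (IH _ kl); rewrite ge_min lexx.
Qed.

(** * Regions of exponents in which products and iterates are expanded *)

Section Cones.
Variable W : zmodType.
Implicit Types (A : int -> int -> W) (G : int -> int -> int -> int -> W).

(* Membership in W((x1))((x2)) and in W((x2))((x1)). *)
Definition in_l12 A :=
  (exists N : int, forall m n, A m n != 0 -> N <= n) /\
  (forall M : int, exists N : int, forall m n, n <= M -> A m n != 0 -> N <= m).

Definition in_l21 A :=
  (exists N : int, forall m n, A m n != 0 -> N <= m) /\
  (forall M : int, exists N : int, forall m n, m <= M -> A m n != 0 -> N <= n).

Definition bounded2 (N : int) A := forall m n, A m n != 0 -> N <= m /\ N <= n.

(** The analogue of [in_l12] for four exponents, with i, m belonging to x1 and j, n to x2. The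
    bounds are joint, since [G] need not be a product of a series in (i, j) and a series in (m,
    n). *)
Definition cone12 G :=
  (exists N : int, forall i j m n, G i j m n != 0 -> N <= j /\ N <= n) /\
  (forall M : int, exists N : int, forall i j m n, j <= M -> n <= M ->
     G i j m n != 0 -> N <= i /\ N <= m).

Definition cone21 G :=
  (exists N : int, forall i j m n, G i j m n != 0 -> N <= i /\ N <= m) /\
  (forall M : int, exists N : int, forall i j m n, i <= M -> m <= M ->
     G i j m n != 0 -> N <= j /\ N <= n).

Lemma bounded2_l12 N A : bounded2 N A -> in_l12 A.
Proof.
by move=> bA; split=> [|M]; exists N => m n; [case/bA|move=> _ /bA[]].
Qed.

Lemma bounded2W N M A : M <= N -> bounded2 N A -> bounded2 M A.
Proof. by move=> MN bA m n /bA []; split; lia. Qed.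

Lemma in_l21P A : (exists N : int, forall m n, A m n != 0 -> N <= m) ->
  (forall m, exists N : int, forall n, A m n != 0 -> N <= n) -> in_l21 A.
Proof.
move=> [N AN] Am; split=> [|M]; first by exists N.
have [||N' N'P] := @unif_range (fun m N => forall n, A m n != 0 -> N <= n) N M.
- exact: Am.
- by move=> m k k' kk' kP n /kP; lia.
- by exists N' => m n mM nz; apply: (N'P m) => //; exact: AN nz.
Qed.

Lemma in_l12P A : (exists N : int, forall m n, A m n != 0 -> N <= n) ->
  (forall n, exists N : int, forall m, A m n != 0 -> N <= m) -> in_l12 A.
Proof.
move=> [N AN] An; split=> [|M]; first by exists N.
have [||N' N'P] := @unif_range (fun n N => forall m, A m n != 0 -> N <= m) N M.
- exact: An.
- by move=> m k k' kk' kP n /kP; lia.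
- by exists N' => m n mM nz; apply: (N'P n) => //; exact: AN nz.
Qed.

Lemma delta0_l21 (T : int -> W) : (exists N : int, forall k, T k != 0 -> N <= k) ->
  in_l21 (fun i => delta0 (T i)).
Proof.
move=> [N TN]; split=> [|M].
  by exists N => m n; rewrite /delta0; case: ifP => _; [exact: TN | rewrite eqxx].
by exists 0 => m n _; rewrite /delta0; case: (eqVneq n 0) => [->|_] //; rewrite eqxx.
Qed.

Lemma conv2_l12 G : cone12 G -> in_l12 (conv2 G).
Proof.
move=> [[N GN] GM]; split.
  by exists (N + N) => m n /fsum_neq0 [[i j]] /= /GN; lia.
move=> M; have [N' GN'] := GM (M - N); exists (N' + N') => m n nM.
case/fsum_neq0 => -[i j] /= nz; have [Nj Nn] := GN _ _ _ _ nz.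
by have := GN' _ _ _ _ _ _ nz; lia.
Qed.

Lemma conv2_l21 G : cone21 G -> in_l21 (conv2 G).
Proof.
move=> [[N GN] GM]; split.
  by exists (N + N) => m n /fsum_neq0 [[i j]] /= /GN; lia.
move=> M; have [N' GN'] := GM (M - N); exists (N' + N') => m n nM.
case/fsum_neq0 => -[i j] /= nz; have [Nj Nn] := GN _ _ _ _ nz.
by have := GN' _ _ _ _ _ _ nz; lia.
Qed.

Lemma conv2_fs12 G m n : cone12 G ->
  fs (fun ij : int * int => G ij.1 ij.2 (m - ij.1) (n - ij.2)).
Proof.
move=> [[N GN] GM]; have [L GL] := GM (n - N).
have key i j : G i j (m - i) (n - j) != 0 -> [/\ L <= i, i <= m - L, N <= j & j <= n - N].
  move=> nz; have [? ?] := GN _ _ _ _ nz.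
  by have [||? ?] := GL _ _ _ _ _ _ nz; [lia|lia|split; lia].
apply: (@fs_int_pair _ _ _ L (m - L)) => [i j /key []|i] //.
by apply: (@fs_int _ _ N (n - N)) => j /key [].
Qed.

Lemma conv2_fs21 G m n : cone21 G ->
  fs (fun ij : int * int => G ij.1 ij.2 (m - ij.1) (n - ij.2)).
Proof.
move=> [[N GN] GM]; have [L GL] := GM (m - N).
have key i j : G i j (m - i) (n - j) != 0 -> [/\ N <= i, i <= m - N, L <= j & j <= n - L].
  move=> nz; have [? ?] := GN _ _ _ _ nz.
  by have [||? ?] := GL _ _ _ _ _ _ nz; [lia|lia|split; lia].
apply: (@fs_int_pair _ _ _ N (m - N)) => [i j /key []|i] //.
by apply: (@fs_int _ _ L (n - L)) => j /key [].
Qed.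

Lemma conv2_bounded N G :
  (forall i j m n, G i j m n != 0 -> [/\ N <= i, N <= j, N <= m & N <= n]) ->
  bounded2 (N + N) (conv2 G).
Proof. by move=> GN m n /fsum_neq0 [[i j]] /= /GN []; lia. Qed.

End Cones.

(** * Multiplication of vector-valued series by scalar series *)

Section Multipliers.
Variable K : fieldType.

Lemma series2P (f : series2 K) : exists N : int, bounded2 N (fun m n => f m n).
Proof.
have [M fM] := laurentP (f : laurent (laurent K)).
case: f fM => f /= /asboolP [N fN] fM; exists (Order.min N M) => m n nz.
split; rewrite leNgt; apply: contraNN nz => lt.
  by rewrite fM //; apply: lt_le_trans lt _; rewrite ge_min lexx orbT.
by rewrite fN //; apply: lt_le_trans lt _; rewrite ge_min lexx.
Qed.

Lemma laurent_ge (R : comNzRingType) (f : laurent R) : exists N : int, forall n, f n != 0 -> N <= n.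
Proof.
have [N fN] := laurentP f; exists N => n nz; rewrite leNgt.
by apply: contraNN nz => /fN ->.
Qed.

Lemma laurent2_l21 (f : laurent (laurent K)) : in_l21 (fun m n => f m n).
Proof.
apply: in_l21P => [|m]; last exact: laurent_ge.
have [N fN] := laurent_ge f; exists N => m n nz; apply: fN.
by apply: contraNneq nz => ->.
Qed.

Variable W : lmodType K.
Implicit Types (A : int -> int -> W) (G : int -> int -> int -> int -> W).

Lemma in_irange4 (a b i j k l : int) : let r := irange a b in
  [/\ a <= i, a <= j, a <= k & a <= l] -> [/\ i <= b, j <= b, k <= b & l <= b] ->
  ((i, j), (k, l)) \in [seq (x, y) | x <- [seq (i, j) | i <- r, j <- r],
                     y <- [seq (i, j) | i <- r, j <- r]].
Proof.
move=> r [? ? ? ?] [? ? ? ?].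
by rewrite /r; do !apply: allpairs_f; exact: in_irange.
Qed.

(** At a fixed total exponent the three x2-exponents are bounded below, hence above; the cone then
    bounds the x1-exponents of [G] below, and with them all x1-exponents are confined. The first
    step needs a lower bound on the x2-exponents of [f] that is independent of x1, which an element
    of K((x1,x2)) has and a general one of K((x2))((x1)) has not. *)
Lemma summable2_cone12 (f : series2 K) G : cone12 G -> summable2 f G.
Proof.
move=> [[N GN] GM] m n; have [L fL] := series2P f.
have [N' GN'] := GM (n - L - N).
pose Z := `|m| + `|n| + 3%:Z * (`|N| + `|L| + `|N'|).
eexists => -[[i' j'] [i j]] /= fn Gn.
have {}fn := fL _ _ fn; have [g1 g2] := GN _ _ _ _ Gn.
have [||g3 g4] := GN' _ _ _ _ _ _ Gn; [lia|lia|].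
by apply: (@in_irange4 (- Z) Z); split; lia.
Qed.

Lemma summable2_cone21 (f : laurent (laurent K)) G : cone21 G -> summable2 f G.
Proof.
move=> [[N GN] GM] m n; have [[L fL] fM] := laurent2_l21 f.
have [N' GN'] := GM (m - L - N); have [L' fL'] := fM (m - N - N).
pose Z := `|m| + `|n| + 3%:Z * (`|N| + `|L| + `|N'| + `|L'|).
eexists => -[[i' j'] [i j]] /= fn Gn.
have f1 := fL _ _ fn; have [g1 g2] := GN _ _ _ _ Gn.
have f2 : L' <= j' by apply: fL' fn; lia.
have [||g3 g4] := GN' _ _ _ _ _ _ Gn; [lia|lia|].
by apply: (@in_irange4 (- Z) Z); split; lia.
Qed.

Lemma cone12_smul (f : series2 K) A : in_l12 A ->
  cone12 (fun i j m n => f i j *: A m n).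
Proof.
move=> [[N AN] AM]; have [L fL] := series2P f; split.
  exists (Order.min N L) => i j m n; rewrite scaler_eq0 negb_or => /andP[/fL ? /AN ?].
  by lia.
move=> M; have [N' AN'] := AM M; exists (Order.min N' L) => i j m n jM nM.
by rewrite /= scaler_eq0 negb_or => /andP[/fL ? /(AN' _ _ nM) ?]; lia.
Qed.

Lemma cone21_smul (f : laurent (laurent K)) A : in_l21 A ->
  cone21 (fun i j m n => f i j *: A m n).
Proof.
move=> [[N AN] AM]; have [[L fL] fM] := laurent2_l21 f; split.
  exists (Order.min N L) => i j m n; rewrite scaler_eq0 negb_or => /andP[/fL ? /AN ?].
  by lia.
move=> M; have [N' AN'] := AM M; have [L' fL'] := fM M.
exists (Order.min N' L') => i j m n jM nM.
by rewrite /= scaler_eq0 negb_or => /andP[/(fL' _ _ jM) ? /(AN' _ _ nM) ?]; lia.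
Qed.

Lemma smul_l12 (f : series2 K) A : in_l12 A -> in_l12 (smul f A).
Proof. by move=> lA; rewrite smulE; apply: conv2_l12; exact: cone12_smul. Qed.

Lemma smul_l21 (f : laurent (laurent K)) A : in_l21 A -> in_l21 (smul f A).
Proof. by move=> lA; rewrite smulE; apply: conv2_l21; exact: cone21_smul. Qed.

Lemma smul_bounded (f : series2 K) N A : bounded2 N A ->
  exists M, forall A', bounded2 N A' -> bounded2 M (smul f A').
Proof.
move=> bA; have [L fL] := series2P f; exists (Order.min N L + Order.min N L).
move=> A' bA'; rewrite smulE; apply: conv2_bounded => i j m n.
rewrite scaler_eq0 negb_or => /andP[/fL ? /bA' ?]; split; lia.
Qed.

Lemma fs_lcoef2M (f g : laurent (laurent K)) i j :
  fs (fun x : int * int => f x.1 x.2 * g (i - x.1) (j - x.2)).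
Proof.
have [[N fN] fM] := laurent2_l21 f; have [[L gL] gM] := laurent2_l21 g.
apply: (@fs_int_pair _ _ _ N (i - L)) => [k l|k].
  by rewrite /= mulf_eq0 negb_or => /andP[/fN ? /gL]; lia.
have [k1 k2] := (laurent_ge (f k), laurent_ge (g (i - k))).
case: k1 => a fa; case: k2 => b gb; apply: (@fs_int _ _ a (j - b)) => l /=.
by rewrite mulf_eq0 negb_or => /andP[/fa ? /gb]; lia.
Qed.

Lemma lcoef2M (f g : laurent (laurent K)) i j : (f * g) i j =
  \sum_(x \in [set: int * int]) f x.1 x.2 * g (i - x.1) (j - x.2).
Proof.
have [[N fN] [L gL]] := (laurent_ge f, laurent_ge g).
rewrite lcoefM (fsum_morph (g := fun h : laurent K => h j)) //; last first.
  by apply: (@fs_int _ _ N (i - L)) => k; rewrite mulf_eq0 negb_or => /andP[/fN ? /gL]; lia.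
by rewrite (fsum_pair (fs_lcoef2M f g i j)); apply: eq_fsum.
Qed.

Lemma smul_assoc (f g : laurent (laurent K)) A :
  summable2 f (fun i j m n => g i j *: A m n) ->
  (forall i j, fs (fun x : int * int => f x.1 x.2 * g (i - x.1) (j - x.2))) ->
  smul (f * g) A = smul f (smul g A).
Proof.
move=> sf fsfg; rewrite [smul g A]smulE smul_conv2_out // smulE; congr conv2.
apply/funext => i; apply/funext => j; apply/funext => m; apply/funext => n.
rewrite lcoef2M (fsum_morph (g := fun a => a *: A m n)) //.
- by apply: eq_fsum => x; rewrite scalerA.
- by move=> a b; rewrite scalerDl.
Qed.

(** W((x1))((x2)) is a module over K((x1,x2)), and W((x2))((x1)) is one over the field
    K((x2))((x1)). A multiplier that is not a unit of K((x1,x2)) can thus be divided out only on the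
    second side, that of the iterates. *)
Lemma smulA12 (f g : series2 K) A : in_l12 A ->
  smul (f * g) A = smul f (smul g A).
Proof.
move=> lA; apply: smul_assoc; last by move=> i j; exact: fs_lcoef2M.
by apply: summable2_cone12; exact: cone12_smul.
Qed.

Lemma smulA21 (f g : laurent (laurent K)) A : in_l21 A ->
  smul (f * g) A = smul f (smul g A).
Proof.
move=> lA; apply: smul_assoc; last by move=> i j; exact: fs_lcoef2M.
by apply: summable2_cone21; exact: cone21_smul.
Qed.

Definition summable1 (f : laurent (laurent K)) A := forall m n,
  fs (fun ij : int * int => f ij.1 ij.2 *: A (m - ij.1) (n - ij.2)).

Lemma summable1_l12 (f : series2 K) A : in_l12 A -> summable1 f A.
Proof. by move=> lA m n; exact: (conv2_fs12 m n (cone12_smul f lA)). Qed.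

Lemma summable1_l21 (f : laurent (laurent K)) A : in_l21 A -> summable1 f A.
Proof. by move=> lA m n; exact: (conv2_fs21 m n (cone21_smul f lA)). Qed.

Lemma smul1 A : smul 1 A = A.
Proof.
apply/funext => m; apply/funext => n; rewrite /smul (@fsum1 _ _ (0, 0)).
  by rewrite !lcoef1 /= !subr0 scale1r.
case=> i j ij; rewrite lcoef1 /= /delta0; case: eqP => [i0|]; last by rewrite scale0r.
rewrite lcoef1 /= /delta0; case: eqP => [j0|_]; last by rewrite scale0r.
by rewrite i0 j0 eqxx in ij.
Qed.

Lemma smulDr f A B : summable1 f A -> summable1 f B ->
  smul f (fun m n => A m n + B m n) = (fun m n => smul f A m n + smul f B m n).
Proof.
move=> sA sB; apply/funext => m; apply/funext => n; rewrite /smul -fsumD //.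
by apply: eq_fsum => x; rewrite scalerDr.
Qed.

Lemma smul_sum (T : Type) f (r : seq T) (A : T -> int -> int -> W) :
  (forall t, summable1 f (A t)) ->
  smul f (fun m n => \sum_(t <- r) A t m n) = (fun m n => \sum_(t <- r) smul f (A t) m n).
Proof.
move=> sA; apply/funext => m; apply/funext => n; rewrite /smul -fsum_big //.
  by apply: eq_fsum => x; rewrite scaler_sumr.
by move=> t; exact: sA.
Qed.

Lemma smulDl f g A : summable1 f A -> summable1 g A ->
  smul (f + g) A = (fun m n => smul f A m n + smul g A m n).
Proof.
move=> sA sB; apply/funext => m; apply/funext => n; rewrite /smul -fsumD //.
by apply: eq_fsum => x; rewrite !lcoefD scalerDl.
Qed.

Lemma smulZl (a : K) f A : summable1 f A ->
  smul (lconst (lconst a) * f) A = (fun m n => a *: smul f A m n).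
Proof.
move=> sA; apply/funext => m; apply/funext => n.
rewrite /smul (lin_fsum (@linear_scaler _ W a)) //.
apply: eq_fsum => x; rewrite scalerA; congr (_ *: _).
by rewrite /= cauchy_delta /= cauchy_delta.
Qed.

End Multipliers.

Lemma smul_lin (K : fieldType) (U W : lmodType K) (g : U -> W)
    (f : laurent (laurent K)) (A : int -> int -> U) m n :
  linear g -> summable1 f A ->
  g (smul f A m n) = smul f (fun i j => g (A i j)) m n.
Proof.
by move=> lg sA; rewrite /smul (lin_fsum lg) //; apply: eq_fsum => x; exact: lin_scale.
Qed.

Lemma fsum_exch3 (X Y Z : choiceType) (W : zmodType) (H : X -> Y -> Z -> W) :
  fs (fun t : X * Y * Z => H t.1.1 t.1.2 t.2) ->
  \sum_(x \in [set: X]) \sum_(y \in [set: Y]) \sum_(z \in [set: Z]) H x y z =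
  \sum_(z \in [set: Z]) \sum_(y \in [set: Y]) \sum_(x \in [set: X]) H x y z.
Proof.
move=> [s Hs].
have fxy : fs (fun xy : X * Y => \sum_(z \in [set: Z]) H xy.1 xy.2 z).
  have [|t tP] := @fs_fst _ _ _ (fun t : X * Y * Z => H t.1.1 t.1.2 t.2); first by exists s.
  by exists t => -[x y]; exact: tP.
rewrite -(fsum_pair fxy) /= (fsum_exch (F := fun (xy : X * Y) z => H xy.1 xy.2 z)).
  apply: eq_fsum => z; rewrite (@fsum_exch _ _ _ (fun y x => H x y z)).
    rewrite (fsum_pair (F := fun xy : X * Y => H xy.1 xy.2 z)) //.
    exists (map fst s) => -[x y] nz.
    by apply/mapP; exists (x, y, z) => //; exact: (Hs (x, y, z)).
  exists (map (fun t => (t.1.2, t.1.1)) s) => -[y x] nz.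
  by apply/mapP; exists (x, y, z) => //; exact: (Hs (x, y, z)).
by exists s => -[[x y] z]; exact: (Hs (x, y, z)).
Qed.

Lemma in_irange6 (a b i j k l m n : int) : let r := irange a b in
  let r2 := [seq (i, j) | i <- r, j <- r] in
  [/\ a <= i, a <= j, a <= k & a <= l] -> a <= m /\ a <= n ->
  [/\ i <= b, j <= b, k <= b & l <= b] -> m <= b /\ n <= b ->
  ((i, j), (k, l), (m, n)) \in
    [seq (xy, z) | xy <- [seq (x, y) | x <- r2, y <- r2], z <- r2].
Proof.
move=> r r2 [? ? ? ?] [? ?] [? ? ? ?] [? ?].
by rewrite /r2 /r; do !apply: allpairs_f; exact: in_irange.
Qed.

(** * Substitution *)

Section Substitution.
Variable K : fieldType.
Implicit Types b : int -> laurent (laurent K).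

(* With b m = a(x,z)^m this is A(a(x,z),x). *)
Definition gsubst (W : lmodType K) b (A : int -> int -> W) : int -> int -> W :=
  fun k l => \sum_(mn \in [set: int * int]) b mn.1 k (l - mn.2) *: A mn.1 mn.2.

(** What the powers of phi satisfy: the exponents of z are bounded below, and the coefficient of z^k
    in the m-th power has order at least m - N in x, with N depending only on a bound for k.
    Substituting into a series with exponents bounded below then gives finite sums. *)
Definition regular b :=
  (exists N : int, forall m k l, b m k l != 0 -> N <= k) /\
  (forall M : int, exists N : int, forall m k l, k <= M -> b m k l != 0 -> m - N <= l).

Lemma fs_gsubst (W : lmodType K) b (A : int -> int -> W) N k l :
  regular b -> bounded2 N A ->
  fs (fun mn : int * int => b mn.1 k (l - mn.2) *: A mn.1 mn.2).
Proof.
move=> [_ /(_ k) [M bM]] bA.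
apply: (@fs_int_pair _ _ _ N (M + l - N)) => [i j|i].
  by rewrite /= scaler_eq0 negb_or => /andP[/(bM _ _ _ (lexx _)) ? /bA []]; lia.
apply: (@fs_int _ _ N (M + l - i)) => j.
by rewrite /= scaler_eq0 negb_or => /andP[/(bM _ _ _ (lexx _)) ? /bA []]; lia.
Qed.

Lemma gsubst_l21 (W : lmodType K) b N : regular b ->
  (exists2 L : int, forall (A : int -> int -> W) m n, bounded2 N A ->
    gsubst b A m n != 0 -> L <= m &
    forall M : int, exists L : int, forall (A : int -> int -> W) m n, bounded2 N A ->
    m <= M -> gsubst b A m n != 0 -> L <= n).
Proof.
move=> [[L bL] bM]; exists L => [A m n bA /fsum_neq0[x]|M].
  by rewrite scaler_eq0 negb_or => /andP[/bL].
have [L' bL'] := bM M; exists (N + N - L') => A m n bA mM /fsum_neq0[x].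
by rewrite scaler_eq0 negb_or => /andP[/(bL' _ _ _ mM) ? /bA []]; lia.
Qed.

Lemma gsubst_in_l21 (W : lmodType K) b N (A : int -> int -> W) :
  regular b -> bounded2 N A -> in_l21 (gsubst b A).
Proof.
move=> rb bA; have [L L1 L2] := gsubst_l21 W N rb; split.
  by exists L => m n; exact: L1.
by move=> M; have [L' L'P] := L2 M; exists L' => m n; exact: L'P.
Qed.

(** Substitution is multiplicative because [b] turns sums of exponents into products. The second
    factor is allowed to depend linearly on the coefficients of the first, which covers scalars
    acting on a series, tensor products, and a product of fields applied to the coefficients of
    another one. In the last case the common bound [N] for all [Psi (B i j)] is the decisive
    hypothesis. *)
Lemma subst_conv2 (X W : lmodType K) b (B : int -> int -> X)
    (Psi : X -> int -> int -> W) (N : int) :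
  regular b -> (forall m n, b (m + n) = b m * b n) ->
  bounded2 N B -> (forall m n, linear (fun x => Psi x m n)) ->
  (forall i j, bounded2 N (Psi (B i j))) ->
  gsubst b (conv2 (fun i j => Psi (B i j))) =
  conv2 (fun k l => gsubst b (Psi (gsubst b B k l))).
Proof.
move=> rb bD bB lPsi bPsi; apply/funext => k; apply/funext => l.
have BPsi i j m n : Psi (B i j) m n != 0 -> [/\ N <= i, N <= j, N <= m & N <= n].
  move=> nz; have [? ?] := bPsi _ _ _ _ nz.
  by have /bB [] := lin_neq0 (lPsi m n) nz; split.
(* Here z is the exponent pair of [B], y that of [Psi], and x the one that results from substituting
   in [B]. Summing in the order x, y, z gives the right side; in the reverse order the sum over x
   multiplies the two powers. *)
pose H (x y z : int * int) := (b y.1 (k - x.1) (l - x.2 - y.2) * b z.1 x.1 (x.2 - z.2)) *: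
  Psi (B z.1 z.2) y.1 y.2.
(* Both powers have z-exponents at least [L], and these add up to k, so each is at most k - [L]. *)
have [[L bL] bM] := rb; have [M bMP] := bM (k - L).
pose Z := `|k| + `|l| + 4%:Z * (`|N| + `|L| + `|M|).
have fH : fs (fun t : int * int * (int * int) * (int * int) => H t.1.1 t.1.2 t.2).
  eexists => x; case: x => -[[k2 l2] [m n]] [i j]; rewrite /H /= scaler_eq0 mulf_eq0 !negb_or.
  move=> /andP[/andP[b1 b2] /BPsi [? ? ? ?]].
  have := bL _ _ _ b1; have := bL _ _ _ b2 => ? ?.
  have := bMP _ _ _ _ b1 => /(_ ltac:(lia)) ?.
  have := bMP _ _ _ _ b2 => /(_ ltac:(lia)) ?.
  by apply: (@in_irange6 (- Z) Z); split; lia.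
have -> : conv2 (fun k0 l0 => gsubst b (Psi (gsubst b B k0 l0))) k l =
    \sum_(x \in [set: int * int]) \sum_(y \in [set: int * int])
      \sum_(z \in [set: int * int]) H x y z.
  apply: eq_fsum => x; apply: eq_fsum => y.
  have fB := @fs_gsubst X b B N x.1 x.2 rb bB.
  rewrite (lin_fsum (lPsi y.1 y.2) fB) (lin_fsum (@linear_scaler _ W _)).
    by apply: eq_fsum => z; rewrite (lin_scale (lPsi _ _)) scalerA.
  exact: (@lin_fs _ _ _ (fun x => Psi x y.1 y.2) (lPsi y.1 y.2) _ _ fB).
rewrite (fsum_exch3 fH).
have -> : gsubst b (conv2 (fun i j : int => Psi (B i j))) k l =
    \sum_(y \in [set: int * int]) \sum_(z \in [set: int * int])
      b y.1 k (l - y.2) *: Psi (B z.1 z.2) (y.1 - z.1) (y.2 - z.2).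
  apply: eq_fsum => y; rewrite (lin_fsum (@linear_scaler _ W _)) //.
  apply: (@fs_int_pair _ _ _ N (y.1 - N)) => [i j /BPsi [] /=|i]; first by lia.
  by apply: (@fs_int _ _ N (y.2 - N)) => j /BPsi [] /=; lia.
transitivity (\sum_(z \in [set: int * int]) \sum_(y \in [set: int * int])
    b (y.1 + z.1) k (l - y.2 - z.2) *: Psi (B z.1 z.2) y.1 y.2).
  rewrite -[RHS](@fsum_exch_shift _ _ _ _ (fun z y => (y.1 - z.1, y.2 - z.2))
    (fun z y => (y.1 + z.1, y.2 + z.2))) //.
  - apply: eq_fsum => y; apply: eq_fsum => z /=.
    by rewrite subrK; congr (lcoef _ _ *: _); lia.
  - by move=> z [m n]; rewrite /= !subrK.
  - by move=> z [m n]; rewrite /= !addrK.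
  have [M1 bM1] := bM k; pose Z1 := `|k| + `|l| + 4%:Z * (`|N| + `|L| + `|M1|).
  eexists => -[[i j] [m n]] /=; rewrite scaler_eq0 negb_or => /andP[b1 /BPsi [? ? ? ?]].
  have := bM1 _ _ _ (lexx _) b1 => ?.
  by apply: (@in_irange4 (- Z1) Z1); split; lia.
apply: eq_fsum => z; apply: eq_fsum => y.
rewrite /H bD lcoef2M (fsum_morph (g := fun a => a *: Psi (B z.1 z.2) y.1 y.2)) /=.
- rewrite (@fsum_reindex _ _ _ (fun x => (k - x.1, l - x.2 - y.2))
    (fun x => (k - x.1, l - x.2 - y.2))); last 2 first.
  + by case=> u v /=; congr (_, _); lia.
  + by case=> u v /=; congr (_, _); lia.
  by apply: eq_fsum => x /=; congr (_ * lcoef (lcoef _ _) _ *: _); lia.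
- by move=> u v; rewrite scalerDl.
- exact: fs_lcoef2M.
Qed.

Lemma smul_gsubst (W : lmodType K) b (F : laurent (laurent K)) (A : int -> int -> W) N :
  regular b -> bounded2 N A ->
  smul F (gsubst b A) = gsubst (fun m => F * b m) A.
Proof.
move=> [[L bL] bM] bA; apply/funext => k; apply/funext => l.
have rb : regular b by split => //; exists L.
have [[L1 FL] FM] := laurent2_l21 F.
have [M bMP] := bM (k - L1); have [M1 FMP] := FM (k - L).
transitivity (\sum_(x \in [set: int * int]) \sum_(y \in [set: int * int])
    (F x.1 x.2 * b y.1 (k - x.1) (l - x.2 - y.2)) *: A y.1 y.2).
  apply: eq_fsum => x; rewrite (lin_fsum (@linear_scaler _ W _) (fs_gsubst _ _ rb bA)).
  by apply: eq_fsum => y; rewrite scalerA.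
rewrite fsum_exch; last first.
  pose Z := `|k| + `|l| + 4%:Z * (`|N| + `|L| + `|M| + `|L1| + `|M1|).
  eexists => -[[i j] [m n]] /=; rewrite scaler_eq0 mulf_eq0 !negb_or.
  move=> /andP[/andP[Fij b1] /bA [? ?]].
  have := bL _ _ _ b1; have := FL _ _ Fij => ? ?.
  have := bMP _ _ _ _ b1 => /(_ ltac:(lia)) ?.
  have := FMP _ _ _ Fij => /(_ ltac:(lia)) ?.
  by apply: (@in_irange4 (- Z) Z); split; lia.
apply: eq_fsum => y.
rewrite lcoef2M (fsum_morph (g := fun a => a *: A y.1 y.2)).
- by apply: eq_fsum => x; rewrite addrAC.
- by move=> u v; rewrite scalerDl.
- exact: fs_lcoef2M.
Qed.

Lemma gsubst_lin (U W : lmodType K) (g : U -> W) b (A : int -> int -> U) N k l :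
  linear g -> regular b -> bounded2 N A ->
  g (gsubst b A k l) = gsubst b (fun m n => g (A m n)) k l.
Proof.
move=> lg rb bA; rewrite /gsubst (lin_fsum lg); last exact: fs_gsubst rb bA.
by apply: eq_fsum => x; exact: lin_scale.
Qed.

Lemma gsubstD (W : lmodType K) b (A B : int -> int -> W) N :
  regular b -> bounded2 N A -> bounded2 N B ->
  gsubst b (fun m n => A m n + B m n) = (fun k l => gsubst b A k l + gsubst b B k l).
Proof.
move=> rb bA bB; apply/funext => k; apply/funext => l; rewrite /gsubst -fsumD.
- by apply: eq_fsum => x; rewrite scalerDr.
- exact: fs_gsubst rb bA.
- exact: fs_gsubst rb bB.
Qed.

End Substitution.

(** * The substitution f(a(x,z), x) as a ring homomorphism *)

Section Evaluation.
Variables (K : fieldType) (a : laurent (laurent K)).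
Hypothesis ra : regular (exprz a).
Hypothesis a0 : a != 0.

Lemma expa_add m n : a ^ (m + n) = a ^ m * a ^ n.
Proof. by rewrite expfzDr. Qed.

Lemma subst1E (W : lmodType K) (A : int -> int -> W) : subst1 a A = gsubst (exprz a) A.
Proof. by []. Qed.

(** [s2eval] is built from [mklaurent], which returns 0 on a family that is not bounded below.
    Regularity supplies the bounds in z and, for each power of z, in x, so that this default never
    occurs. *)
Lemma s2evalE (f : series2 K) k l :
  s2eval a f k l = gsubst (exprz a) (fun m n => f m n : K^o) k l.
Proof.
have [N bN] := series2P f.
have bN' : bounded2 N (fun m n => f m n : K^o) by [].
have [[L fL] fM] := gsubst_in_l21 ra bN'.
have row k' : bounded_at ((fun M => projT1 (cid (fM M))) k')
    (subst1 a (fun m n => f m n : K^o) k' : int -> K).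
  move=> j; case: cid => /= M MP jM; apply/eqP; apply: contraTT jM => nz.
  by rewrite -leNgt; apply: MP (lexx _) nz.
rewrite /s2eval (@mklaurentE _ L).
  by rewrite (mklaurentE _ (row k)).
move=> i iL; apply: laurent_ext => j; rewrite (mklaurentE _ (row i)) lcoef0.
apply/eqP; apply: contraTT iL => nz; rewrite -leNgt; exact: fL nz.
Qed.

(** The case of [subst_conv2] in which the first factor is scalar: a coefficient of [g] acts on [A]
    by scaling. *)
Lemma subst1_smul (W : lmodType K) (g : series2 K) (A : int -> int -> W) N :
  bounded2 N A -> subst1 a (smul g A) = smul (s2eval a g) (subst1 a A).
Proof.
move=> bA; have [M bM] := series2P g; pose L := Order.min M N.
rewrite subst1E (@subst_conv2 K K^o W _ (fun m n => g m n : K^o)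
  (fun c m n => (c : K) *: A m n) L) //.
- apply/funext => k; apply/funext => l; apply: eq_fsum => x.
  rewrite s2evalE; set c := gsubst _ _ _ _ : K^o.
  rewrite subst1E (gsubst_lin (g := fun w => (c : K) *: w) _ _ _ ra bA) //.
  exact: linear_scaler.
- exact: expa_add.
- by apply: bounded2W bM; rewrite ge_min lexx.
- by move=> m n; exact: linear_scalel.
- move=> i j m n; rewrite scaler_eq0 negb_or => /andP[_ /bA [? ?]].
  by split; rewrite /L; lia.
Qed.

Lemma s2eval_zmod : zmod_morphism (s2eval a).
Proof.
move=> f g; apply: laurent_ext => k; apply: laurent_ext => l.
rewrite -[RHS]/(s2eval a f k l - s2eval a g k l) !s2evalE.
have [N bN] := series2P f; have [M bM] := series2P g.
pose F := fun mn : int * int => (a ^ mn.1) k (l - mn.2) *: (f mn.1 mn.2 : K^o).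
pose G := fun mn : int * int => (a ^ mn.1) k (l - mn.2) *: (g mn.1 mn.2 : K^o).
have fF : fs F by exact: (fs_gsubst (A := fun m n => f m n : K^o)) ra bN.
have fG : fs G by exact: (fs_gsubst (A := fun m n => g m n : K^o)) ra bM.
have fNG : fs (fun x => - G x) by apply: (fs_morph (g := @GRing.opp K^o)) fG; rewrite oppr0.
rewrite -[RHS]/(\sum_(x \in [set: int * int]) F x - \sum_(x \in [set: int * int]) G x).
rewrite (fsum_morph (g := @GRing.opp K^o)) //; last exact: opprD.
by rewrite -fsumD //; apply: eq_fsum => x; rewrite /F /G -scalerBr.
Qed.

Lemma s2coef1 m n : (1 : series2 K) m n = if (m == 0) && (n == 0) then 1 else 0.
Proof.
rewrite -[LHS]/((delta0 (1 : laurent K) m : laurent K) n) /delta0.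
by case: (m == 0).
Qed.

Lemma s2eval1 : s2eval a 1 = 1.
Proof.
apply: laurent_ext => k; apply: laurent_ext => l.
rewrite s2evalE /gsubst (@fsum1 _ _ (0, 0)).
  by rewrite /= subr0 [delta0 1 0]/delta0 eqxx [LHS]mulr1.
case=> m n nz; rewrite s2coef1 ifN ?scaler0 //.
Qed.

Lemma s2evalM f g : s2eval a (f * g) = s2eval a f * s2eval a g.
Proof.
have [N bN] := series2P g; apply: laurent_ext => k; apply: laurent_ext => l.
have -> : s2eval a (f * g) k l = subst1 a (smul f (fun m n => g m n : K^o)) k l.
  rewrite s2evalE; apply: eq_fsum => x.
  apply: (congr1 (fun t : K^o => (a ^ x.1) k (l - x.2) *: t)).
  by rewrite -[LHS]/(((f : laurent (laurent K)) * g) x.1 x.2) lcoef2M.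
rewrite (@subst1_smul K^o f _ N) // lcoef2M; apply: eq_fsum => x.
by rewrite subst1E -s2evalE.
Qed.

End Evaluation.

(** * The series phi *)

Section LaurentDerivation.
Variable R : comNzRingType.
Implicit Types f g : laurent R.

Definition derivation (S : comNzRingType) (d : S -> S) :=
  {morph d : x y / x + y} /\ forall x y, d (x * y) = d x * y + x * d y.

Lemma derivation0 (S : comNzRingType) (d : S -> S) : derivation d -> d 0 = 0.
Proof. by move=> [dD _]; apply: (@addrI _ (d 0)); rewrite -dD !addr0. Qed.

Lemma lderivE f n : lderiv f n = f (n + 1) *~ (n + 1).
Proof.
have [N bN] := laurentP f; rewrite /lderiv (@mklaurentE _ (N - 1)) // => m mN.
by rewrite bN ?mul0rz //; lia.
Qed.

Lemma lcoefM_fs f g n : fs (fun i => f i * g (n - i)).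
Proof.
have [[N fN] [L gL]] := (laurentP f, laurentP g).
apply: (@fs_int _ _ N (n - L)) => i nz; split; rewrite leNgt; apply: contraNN nz => lt.
  by rewrite fN ?mul0r.
by rewrite gL ?mulr0 //; lia.
Qed.

Lemma lderiv_derivation : derivation (@lderiv R).
Proof.
split=> [f g|f g]; apply: laurent_ext => n.
  by rewrite lcoefD !lderivE lcoefD mulrzDl.
rewrite lcoefD !lcoefM lderivE lcoefM.
rewrite [X in _ = X + _](@fsum_reindex _ _ _ (fun i : int => i - 1) (fun i => i + 1)).
- rewrite -fsumD; last 2 first.
  + apply: (@fs_reindex _ _ _ (fun i : int => i - 1) (fun i => i + 1)
      (fun i => lderiv f i * g (n - i))); last exact: lcoefM_fs.
    by move=> i; rewrite subrK.
  + exact: lcoefM_fs.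
  rewrite (fsum_morph (g := fun x : R => x *~ (n + 1))); last exact: lcoefM_fs.
    apply: eq_fsum => i; rewrite !lderivE.
    have -> : n - (i - 1) = n + 1 - i by lia.
    have -> : n - i + 1 = n + 1 - i by lia.
    by rewrite subrK mulrzAl mulrzAr -mulrzDr; congr (_ *~ _); lia.
  by move=> x y; rewrite mulrzDl.
- by move=> i; rewrite subrK.
- by move=> i; rewrite addrK.
Qed.

Definition lmapd (d : R -> R) f : laurent R := mklaurent (fun n => d (f n)).

Lemma lmapdE d f n : derivation d -> lmapd d f n = d (f n).
Proof.
move=> dd; have [N bN] := laurentP f; rewrite /lmapd (@mklaurentE _ N) // => m mN.
by rewrite bN // derivation0.
Qed.

Lemma lmapd_derivation d : derivation d -> derivation (lmapd d).
Proof.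
move=> dd; split=> [f g|f g]; apply: laurent_ext => n.
  by rewrite lcoefD !lmapdE // lcoefD dd.1.
rewrite lcoefD !lcoefM lmapdE // lcoefM -fsumD; try exact: lcoefM_fs.
rewrite (fsum_morph dd.1); last exact: lcoefM_fs.
by apply: eq_fsum => i; rewrite !lmapdE // dd.2.
Qed.

Definition mono (m : int) : laurent R := mklaurent (fun n => (n == m)%:R).

Lemma monoE m n : mono m n = (n == m)%:R.
Proof.
rewrite /mono (@mklaurentE _ m) // => k km; case: eqP => // ekm.
by rewrite ekm ltxx in km.
Qed.

Lemma mono_mulE m f n : (mono m * f) n = f (n - m).
Proof.
rewrite lcoefM (@fsum1 _ _ m) ?monoE ?eqxx ?mul1r // => i /negPf im.
by rewrite monoE im mul0r.
Qed.

Lemma mono_add m n : mono (m + n) = mono m * mono n.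
Proof.
by apply: laurent_ext => k; rewrite mono_mulE !monoE subr_eq [n + m]addrC.
Qed.

Lemma mono0 : mono 0 = 1.
Proof. by apply: laurent_ext => n; rewrite monoE lcoef1 /delta0; case: eqP. Qed.

Lemma mono1 : mono 1 = lX R. Proof. by []. Qed.

Lemma mono_bounded m : bounded_at m (mono m).
Proof. by move=> n nm; rewrite monoE; case: eqP => // e; rewrite e ltxx in nm. Qed.

Lemma lcoefMz f (j : int) n : (f *~ j) n = (f n) *~ j.
Proof.
have fn i : (f *+ i) n = (f n) *+ i by elim: i => // i IH; rewrite !mulrS lcoefD IH.
by case: j => j; rewrite ?NegzE ?mulrNz ?lcoefN -!pmulrn fn.
Qed.

Lemma lderiv_mono m : lderiv (mono m) = (m%:~R : laurent R) * mono (m - 1).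
Proof.
apply: laurent_ext => n; rewrite lderivE monoE mulrzl.
rewrite -[RHS]/((mono (m - 1) *~ m) n).
rewrite lcoefMz.
rewrite monoE; have -> : (n == m - 1) = (n + 1 == m) by apply/eqP/eqP; lia.
by case: eqP => [->|_]; rewrite ?mul0rz.
Qed.

End LaurentDerivation.

Section PhiTheory.
Variables (K : fieldType) (p : laurent K).
Hypothesis char0 : forall n : nat, n.+1%:R != 0 :> K.

Definition Dp (f : laurent K) := p * lderiv f.

Lemma Dp_derivation : derivation Dp.
Proof.
have [lD lM] := lderiv_derivation K; split=> x y; rewrite /Dp.
  by rewrite lD mulrDr.
by rewrite lM mulrDr mulrA mulrCA.
Qed.

Lemma DpZ (a : K) f : Dp (a *: f) = a *: Dp f.
Proof.
rewrite -[a *: f]/(lconst a * f) -[a *: Dp f]/(lconst a * Dp f) Dp_derivation.2.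
suff -> : Dp (lconst a) = 0 by rewrite mul0r add0r.
rewrite /Dp; have -> : lderiv (lconst a) = 0; last by rewrite mulr0.
apply: laurent_ext => n; rewrite lderivE lcoefC /delta0 lcoef0.
by case: eqP => [->|_]; rewrite ?mulr0z ?mul0rz.
Qed.

(* e^{z p(x) d/dx} f(x) *)
Definition Ephi (f : laurent K) : laurent (laurent K) :=
  mklaurent (fun n => if n is Posz k then (k`!%:R : K)^-1 *: iter k Dp f else 0).

Lemma phiE : phi p = Ephi (lX K). Proof. by []. Qed.

Lemma Ephi_bounded f : bounded_at 0
  (fun n => if n is Posz k then (k`!%:R : K)^-1 *: iter k Dp f else 0).
Proof. by case. Qed.

Lemma EphiE f (k : nat) : Ephi f k = (k`!%:R : K)^-1 *: iter k Dp f.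
Proof. by rewrite /Ephi (mklaurentE _ (Ephi_bounded f)). Qed.

Lemma Ephi_neg f (n : int) : n < 0 -> Ephi f n = 0.
Proof. by move=> n0; rewrite /Ephi (mklaurentE _ (Ephi_bounded f)) Ephi_bounded. Qed.

Lemma Ephi0 f : Ephi f 0 = f.
Proof. by rewrite (EphiE f 0) /= fact0 invr1 scale1r. Qed.

Lemma Ephi_ode f : lderiv (Ephi f) = lmapd Dp (Ephi f).
Proof.
apply: laurent_ext => n; rewrite lderivE lmapdE; last exact: Dp_derivation.
case: n => [k|[|k]].
- rewrite -[(k%:Z + 1)]/((k + 1)%N%:Z) addn1 !EphiE iterS DpZ -pmulrn.
  rewrite scalerMnl; congr (_ *: _).
  by rewrite factS natrM invfM -mulr_natr mulrAC mulVf ?mul1r.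
- by rewrite mulr0z Ephi_neg // derivation0 //; exact: Dp_derivation.
- have n1 : Negz k.+1 + 1 < 0 by lia.
  rewrite !Ephi_neg //.
  by rewrite mul0rz derivation0 //; exact: Dp_derivation.
Qed.

(** The equation determines the coefficient of z^(n+1) from that of z^n after division by n + 1,
    which is where characteristic 0 enters. *)
Lemma ode_uniq (F G : laurent (laurent K)) :
  bounded_at 0 F -> bounded_at 0 G -> F 0 = G 0 ->
  lderiv F = lmapd Dp F -> lderiv G = lmapd Dp G -> F = G.
Proof.
move=> bF bG FG0 dF dG; apply: laurent_ext => -[n|n]; last by rewrite bF ?bG.
elim: n => // n IH.
have := congr1 (fun H : laurent (laurent K) => H n) dF.
have := congr1 (fun H : laurent (laurent K) => H n) dG.
rewrite /= !lderivE !lmapdE; try exact: Dp_derivation.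
rewrite IH => <-; rewrite -[(n%:Z + 1)]/((n + 1)%N%:Z) addn1 -!pmulrn.
rewrite -!scaler_nat => e; have := congr1 (fun f => (n.+1%:R : K)^-1 *: f) e.
by rewrite !scalerA mulVf ?scale1r.
Qed.

Lemma EphiD f g : Ephi (f + g) = Ephi f + Ephi g.
Proof.
have Dd := lmapd_derivation Dp_derivation; have ld := lderiv_derivation (laurent K).
apply: ode_uniq => [n n0|n n0|||].
- by rewrite Ephi_neg.
- by rewrite lcoefD !Ephi_neg ?addr0.
- by rewrite lcoefD !Ephi0.
- exact: Ephi_ode.
- by rewrite ld.1 Dd.1 !Ephi_ode.
Qed.

(* Both sides solve dF/dz = p(x) dF/dx with the same value at z = 0. *)
Lemma EphiM f g : Ephi (f * g) = Ephi f * Ephi g.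
Proof.
have Dd := lmapd_derivation Dp_derivation; have ld := lderiv_derivation (laurent K).
have bE h : bounded_at 0 (Ephi h) by move=> n n0; rewrite Ephi_neg.
apply: ode_uniq => [||||].
- exact: bE.
- by rewrite -[0]addr0; apply: cauchy_bounded; exact: bE.
- by rewrite Ephi0 -[X in _ = lcoef _ X](addr0 0) /= cauchy_lead // !Ephi0.
- exact: Ephi_ode.
- by rewrite ld.2 Dd.2 !Ephi_ode.
Qed.

Lemma Ephi1 : Ephi 1 = 1.
Proof.
have Dd := lmapd_derivation Dp_derivation; have ld := lderiv_derivation (laurent K).
have d1 (S : comNzRingType) (d : S -> S) : derivation d -> d 1 = 0.
  by move=> [_ dM]; have := dM 1 1; rewrite !mulr1 mul1r => e; apply: (@addrI _ (d 1)); rewrite addr0 -e.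
apply: ode_uniq => [n n0|n n0|||].
- by rewrite Ephi_neg.
- by rewrite lcoef1 /delta0; case: eqP => // e; rewrite e in n0.
- by rewrite Ephi0.
- exact: Ephi_ode.
- by rewrite (d1 _ _ ld) (d1 _ _ Dd).
Qed.

(** The exponential of a derivation is an algebra homomorphism, so it carries powers of x to powers
    of phi. Negative exponents follow, since x^m and x^(-m) go to mutually inverse elements. *)
Lemma phi_exp m : phi p ^ m = Ephi (mono K m).
Proof.
have phin (n : nat) : phi p ^+ n = Ephi (mono K n).
  elim: n => [|n IH]; first by rewrite expr0 mono0 Ephi1.
  by rewrite exprS IH phiE -mono1 -EphiM -mono_add.
case: m => n; first exact: phin.
have := EphiM (mono K n.+1) (mono K (Negz n)).
rewrite -mono_add NegzE subrr mono0 Ephi1 -phin => e.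
have u : phi p ^+ n.+1 \is a GRing.unit.
  by rewrite unitfE; apply: contra_eq_neq e => ->; rewrite mul0r oner_neq0.
by rewrite -[RHS](mulKr u) -e mulr1.
Qed.

Lemma phi_neq0 : phi p != 0.
Proof.
(* If phi were 0, its power of exponent -1 would be 0 as well, because the inverse of 0 is 0; but
   the exponential applied to x^(-1) has coefficient 1 at z^0 x^(-1). *)
by have := phi_exp (- 1); apply: contra_eq_neq => ->;
  rewrite exprN1 invr0 eq_sym; apply/eqP => /(congr1 (fun F : laurent (laurent K) => F 0 (-1)));
  rewrite Ephi0 monoE eqxx => /eqP; rewrite oner_eq0.
Qed.

Lemma Dp_bounded : exists2 c : int, 0 <= c &
  forall (f : laurent K) m, bounded_at m f -> bounded_at (m - c) (Dp f).
Proof.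
(* p has order at least [v] and d/dx lowers the order by at most one, so 1 - [v] bounds the loss;
   the maximum keeps [c] nonnegative. *)
have [v pv] := laurentP p; pose c := Order.max 0 (1 - v); exists c; first by rewrite le_max lexx.
move=> f m fm; apply: (@bounded_atW _ (v + (m - 1))); first by rewrite /c; lia.
apply: cauchy_bounded => // n nm; rewrite lderivE fm ?mul0rz //; lia.
Qed.

Lemma iterDp_bounded : exists2 c : int, 0 <= c &
  forall (f : laurent K) m (k : nat), bounded_at m f -> bounded_at (m - c * k%:Z) (iter k Dp f).
Proof.
have [c c0 cP] := Dp_bounded; exists c => // f m k fm.
elim: k => [|k IH]; first by rewrite mulr0 subr0.
by have := cP _ _ IH; have -> : m - c * k%:Z - c = m - c * k.+1%:Z by lia.
Qed.

Lemma Ephi_coef_bounded (k : int) : exists c : int,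
  forall (f : laurent K) m, bounded_at m f -> bounded_at (m - c) (Ephi f k).
Proof.
have [c c0 cP] := iterDp_bounded; case: k => k; last first.
  by exists 0 => f m fm n _; rewrite Ephi_neg.
exists (c * k%:Z) => f m fm n nm; rewrite EphiE lcoefZ (cP f m k fm n nm).
exact: mulr0.
Qed.

Lemma regular_range (b : int -> laurent (laurent K)) :
  (exists N : int, forall m k l, b m k l != 0 -> N <= k) ->
  (forall k, exists N : int, forall m l, b m k l != 0 -> m - N <= l) -> regular b.
Proof.
move=> [N bN] bk; split=> [|M]; first by exists N.
have [||L LP] := @unif_range (fun k L => forall m l, b m k l != 0 -> m + L <= l) N M.
- by move=> k; have [L LP] := bk k; exists (- L).
- by move=> i L L' LL' LP m l /LP; lia.
- exists (- L) => m k l kM nz; rewrite opprK; exact: (LP _ (bN _ _ _ nz) kM _ _ nz).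
Qed.

(** Up to a scalar the coefficient of z^k in phi^m is the k-th iterate of p d/dx on x^m, and k
    applications lower the order by an amount that depends on k but not on m. *)
Lemma regular_phi : regular (exprz (phi p)).
Proof.
apply: regular_range.
  exists 0 => m k l; rewrite phi_exp leNgt; apply: contraNN => k0.
  by rewrite Ephi_neg.
move=> k; have [c cP] := Ephi_coef_bounded k; exists c => m l.
rewrite phi_exp leNgt; apply: contraNN => lm.
by rewrite (cP _ _ (@mono_bounded _ m)).
Qed.

End PhiTheory.

(** A constant p makes phi a translation. The values 1 and -1 bring the expansions of (x + z)^m and
    (x - z)^m, hence ordinary weak associativity and the shift x1 - x2, under the theory of phi. *)
Lemma phi_const (K : fieldType) (c : K) : (forall n : nat, n.+1%:R != 0 :> K) ->
  phi (lconst c) = lconst (lX K) + lconst (lconst c) * lX (laurent K).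
Proof.
move=> char0; apply: laurent_ext => -[n|n]; last first.
  rewrite phiE Ephi_neg // lcoefD lcoefC /delta0 add0r.
  by rewrite /= cauchy_delta /= -mono1 monoE mulr0.
have -> : (lconst (lX K) + lconst (lconst c) * lX (laurent K)) n =
    lconst (lX K) n + lconst c * lX (laurent K) n by rewrite lcoefD /= cauchy_delta.
rewrite phiE EphiE // lcoefC /delta0 -!mono1 monoE.
case: n => [|[|n]].
- by rewrite -[0`!]/1%N invr1 scale1r mulr0 addr0.
- rewrite -[1`!]/1%N invr1 scale1r /= /Dp add0r lderiv_mono subrr mono0 mulr1.
  by rewrite mulr1z.
- rewrite mulr0 addr0.
  suff -> : iter n.+2 (Dp (lconst c)) (mono K 1) = 0 by rewrite scaler0.
  have D0 : Dp (lconst c) 0 = 0 by rewrite derivation0 //; exact: Dp_derivation.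
  elim: n => [|n IH]; last by rewrite iterS IH.
  rewrite !iterS /= {2}/Dp lderiv_mono subrr mono0 !mulr1.
  rewrite /Dp; suff -> : lderiv (lconst c) = 0 by rewrite mulr0.
  apply: laurent_ext => k; rewrite lderivE lcoefC /delta0.
  by case: eqP => [->|_]; rewrite ?mulr0z ?mul0rz.
Qed.

Lemma phi1 (K : fieldType) : (forall n : nat, n.+1%:R != 0 :> K) -> phi 1 = x_plus_z K.
Proof.
move=> char0; have : phi (lconst 1) = x_plus_z K by rewrite phi_const // !rmorph1 mul1r.
by [].
Qed.

Lemma phiN1 (K : fieldType) : (forall n : nat, n.+1%:R != 0 :> K) ->
  phi (lconst (- 1)) = x_minus_z K.
Proof. by move=> char0; rewrite phi_const // !rmorphN !rmorph1 mulNr mul1r. Qed.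

(** For constant p, each application of p d/dx trades exactly one power of x for one power of z. *)
Lemma phi_const_homog (K : fieldType) (c : K) m k l :
  (forall n : nat, n.+1%:R != 0 :> K) ->
  (phi (lconst c) ^ m) k l != 0 -> k + l = m.
Proof.
move=> char0; rewrite phi_exp //; case: k => k; last by rewrite Ephi_neg // eqxx.
rewrite EphiE // lcoefZ mulf_eq0 negb_or => /andP[_].
elim: k l => [|k IH] l; first by rewrite /= monoE add0r; case: (eqVneq l m) => // _; rewrite eqxx.
rewrite iterS {1}/Dp /= cauchy_delta /= lderivE mulf_eq0 negb_or => /andP[_ nz].
have /IH : iter k (Dp (lconst c)) (mono K m) (l + 1) != 0.
  by apply: contraNneq nz => ->; rewrite mul0rz.
by lia.
Qed.

Section Series2Coefficients.
Variable K : fieldType.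

Lemma s2in1E (f : laurent K) m n : s2in1 f m n = if n == 0 then f m else 0.
Proof.
have [N fN] := laurentP f; apply: (@mks2E _ (Order.min 0 N)) => i j.
by case: eqP => // -> ?; rewrite fN //; lia.
Qed.

Lemma s2in2E (f : laurent K) m n : s2in2 f m n = if m == 0 then f n else 0.
Proof.
have [N fN] := laurentP f; apply: (@mks2E _ (Order.min 0 N)) => i j.
by case: eqP => // -> ?; rewrite fN //; lia.
Qed.

Lemma s2d1E (f : series2 K) m n : s2d1 f m n = f (m + 1) n *~ (m + 1).
Proof.
have [N fN] := series2P f; apply: (@mks2E _ (N - 1)) => i j ij.
apply: contrapT => /eqP nz.
have /fN : f (i + 1) j != 0 by apply: contraNneq nz => ->; rewrite mul0rz.
by lia.
Qed.

Lemma s2d2E (f : series2 K) m n : s2d2 f m n = f m (n + 1) *~ (n + 1).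
Proof.
have [N fN] := series2P f; apply: (@mks2E _ (N - 1)) => i j ij.
apply: contrapT => /eqP nz.
have /fN : f i (j + 1) != 0 by apply: contraNneq nz => ->; rewrite mul0rz.
by lia.
Qed.

Lemma s2coefMz (f : series2 K) (j : int) m n : (f *~ j) m n = f m n *~ j.
Proof.
have fi i : (f *+ i) m n = f m n *+ i.
  by elim: i => // i IH; rewrite !mulrS -IH.
case: j => i; first exact: fi.
by rewrite NegzE !mulrNz -!pmulrn -fi.
Qed.

End Series2Coefficients.

(** * Chain rules and injectivity for the substitution x1 = phi(x,z) *)

Section Evaluation2.
Variables (K : fieldType) (p : laurent K).
Hypothesis char0 : forall n : nat, n.+1%:R != 0 :> K.

Local Notation T := (s2eval (phi p)).
Local Notation E := (Ephi p).

Let rphi : regular (exprz (phi p)) := regular_phi p char0.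
Let phi0 : phi p != 0 := phi_neq0 p char0.

(** The scalar case of [gsubst]. The family [b] is left free so that derivatives and multiples of
    the powers of phi can take the place of the powers. *)
Definition ksubst (b : int -> laurent (laurent K)) (f : series2 K) (k l : int) : K :=
  \sum_(mn \in [set: int * int]) b mn.1 k (l - mn.2) * f mn.1 mn.2.

Lemma TE f k l : T f k l = ksubst (exprz (phi p)) f k l.
Proof. exact: s2evalE. Qed.

Lemma fs_ksubst b (f : series2 K) k l : regular b ->
  fs (fun mn : int * int => b mn.1 k (l - mn.2) * f mn.1 mn.2).
Proof.
move=> rb; have [N bN] := series2P f.
exact: (@fs_gsubst K K^o b (fun m n => f m n) N k l rb bN).
Qed.

Lemma mul_ksubst b (F G : laurent (laurent K)) (f : series2 K) k l : regular b ->
  (forall k l, G k l = ksubst b f k l) -> (F * G) k l = ksubst (fun m => F * b m) f k l.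
Proof.
move=> rb GE; have [N bN] := series2P f.
have := congr1 (fun A => A k l) (@smul_gsubst K K^o b F (fun m n => f m n) N rb bN).
move=> e; rewrite lcoef2M -[RHS]/(gsubst (fun m => F * b m) (fun m n => f m n : K^o) k l).
by rewrite -e; apply: eq_fsum => x; rewrite GE.
Qed.

Lemma TM f g : T (f * g) = T f * T g. Proof. exact: s2evalM. Qed.
Lemma TB f g : T (f - g) = T f - T g. Proof. exact: s2eval_zmod. Qed.
Lemma T0 : T 0 = 0. Proof. by rewrite -(subrr 0) TB subrr. Qed.
Lemma TN f : T (- f) = - T f. Proof. by rewrite -sub0r TB T0 sub0r. Qed.
Lemma TD f g : T (f + g) = T f + T g. Proof. by rewrite -{1}(opprK g) TB TN opprK. Qed.

Lemma EphiZ a f k : E (a *: f) k = a *: E f k.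
Proof.
have iterZ j : iter j (Dp p) (a *: f) = a *: iter j (Dp p) f.
  by elim: j => // j IH; rewrite !iterS IH DpZ.
case: k => k; last by rewrite !Ephi_neg ?scaler0.
by rewrite !EphiE iterZ !scalerA mulrC.
Qed.

(** Linearity extends to infinite sums of monomials, because the coefficient of z^k in the image of
    x^m has order at least m - c, so that only finitely many m reach x^l. *)
Lemma Ephi_sum k l (f : laurent K) :
  E f k l = \sum_(m \in [set: int]) f m * E (mono K m) k l.
Proof.
have [c cP] := Ephi_coef_bounded p k; have [N fN] := laurentP f.
(* Beyond [M] both the monomials and the remaining tail of [f] have images of order greater than
   l. *)
pose M := l + c + 1; pose s := undup (irange N M).
have Es (r : seq int) : E (\sum_(m <- r) f m *: mono K m) k l =
    \sum_(m <- r) f m * E (mono K m) k l.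
  elim: r => [|m r IH]; rewrite ?big_nil ?big_cons.
    suff -> : E 0 = 0 by [].
    by apply: (@addrI _ (E 0)); rewrite -EphiD // !addr0.
  by rewrite EphiD // !lcoefD IH EphiZ lcoefZ.
have {}Es := Es s.
rewrite (@fsumE _ _ _ s) ?undup_uniq; first last.
- move=> m; rewrite mem_undup => ms; case: (ltP m N) => [/fN ->|Nm]; first by rewrite mul0r.
  rewrite (cP _ _ (@mono_bounded _ m)) ?mulr0 // ltNge; apply: contraNN ms => ?.
  by apply: in_irange; rewrite /M; lia.
- by [].
rewrite -Es -[in LHS](subrK (\sum_(m <- s) f m *: mono K m) f) EphiD // !lcoefD.
rewrite (cP _ (M + 1)) ?add0r //; last by rewrite /M; lia.
move=> n nM; rewrite lcoefD lcoefN.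
have -> (r : seq int) : (\sum_(m <- r) f m *: mono K m) n = \sum_(m <- r) f m * (n == m)%:R.
  by elim: r => [|m r IH]; rewrite ?big_nil ?big_cons // lcoefD lcoefZ IH monoE.
case: (ltP n N) => [nN|Nn].
  rewrite fN // big1_seq ?subr0 // => m _; case: eqP => [<-|]; last by rewrite mulr0.
  by rewrite fN ?mul0r.
rewrite (bigD1_seq n) ?undup_uniq //=; last by rewrite mem_undup; apply: in_irange; lia.
rewrite eqxx mulr1 big1 ?addr0 ?subrr // => m mn.
by rewrite eq_sym (negPf mn) mulr0.
Qed.

Lemma T_in1 (f : laurent K) : T (s2in1 f) = E f.
Proof.
apply: laurent_ext => k; apply: laurent_ext => l; rewrite TE Ephi_sum /ksubst.
rewrite fsum_pair; last exact: (@fs_ksubst (exprz (phi p))).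
apply: eq_fsum => m; rewrite (@fsum1 _ _ 0) => [|n /negPf n0]; rewrite /= s2in1E.
  by rewrite eqxx subr0 phi_exp // mulrC.
by rewrite n0 mulr0.
Qed.

Lemma T_in2 (f : laurent K) : T (s2in2 f) = lconst f.
Proof.
apply: laurent_ext => k; apply: laurent_ext => l; rewrite TE /ksubst.
have coef1 k' l' : (1 : laurent (laurent K)) k' l' = if (k' == 0) && (l' == 0) then 1 else 0.
  by rewrite lcoef1 /delta0; case: (k' == 0).
rewrite (@fsum1 _ _ (0, l)) => [|[m n] nz].
  rewrite -[LHS]/((phi p ^ 0) k (l - l) * s2in2 f 0 l) expr0z subrr coef1 s2in2E lcoefC /delta0 eqxx andbT.
  by case: eqP; rewrite ?mul1r ?mul0r.
rewrite /= s2in2E; case: eqP => [m0|_]; last by rewrite mulr0.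
rewrite m0 expr0z coef1 subr_eq0 [l == n]eq_sym.
by move: nz; rewrite m0 xpair_eqE eqxx /= => /negPf ->; rewrite andbF mul0r.
Qed.

Lemma Ephi_Dp f : E (Dp p f) = lmapd (Dp p) (E f).
Proof.
apply: laurent_ext => k; rewrite lmapdE; last exact: Dp_derivation.
case: k => k; first by rewrite !EphiE -iterSr DpZ.
by rewrite !Ephi_neg // derivation0 //; exact: Dp_derivation.
Qed.

Lemma lderiv_phi_exp m : lderiv (phi p ^ m) = (E p * phi p ^ (m - 1)) *~ m.
Proof.
rewrite !phi_exp // Ephi_ode // -Ephi_Dp /Dp lderiv_mono EphiM // EphiM //.
have Enat (n : nat) : E n%:R = n%:R.
  elim: n => [|n IH]; last by rewrite -addn1 !natrD EphiD // IH Ephi1.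
  by apply: (@addrI _ (E 0)); rewrite -EphiD // !addr0.
have Eint (n : int) : E n%:~R = n%:~R.
  case: n => n; first by rewrite -!pmulrn.
  rewrite NegzE !mulrNz -!pmulrn; apply: (@addrI _ (E n.+1%:R)).
  by rewrite -EphiD // subrr Enat subrr; exact: (Enat 0%N).
by rewrite Eint mulrCA mulrzl.
Qed.

Lemma ksubst_lderiv (b : int -> laurent (laurent K)) f k l : regular b ->
  ksubst (fun m => lderiv (b m)) f k l = ksubst b f (k + 1) l *~ (k + 1).
Proof.
move=> rb; rewrite /ksubst (fsum_morph (g := fun x : K => x *~ (k + 1))); last first.
- exact: fs_ksubst.
- by move=> x y; rewrite mulrzDl.
by apply: eq_fsum => x; rewrite lderivE lcoefMz mulrzAl.
Qed.

(** The chain rule for the equation d phi/dz = p(phi). *)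
Lemma lderiv_T f : lderiv (T f) = T (s2in1 p * s2d1 f).
Proof.
apply: laurent_ext => k; apply: laurent_ext => l.
rewrite lderivE lcoefMz TE -ksubst_lderiv //.
rewrite TM T_in1 (@mul_ksubst (exprz (phi p)) _ _ (s2d1 f)) //; last exact: TE.
rewrite /ksubst [RHS](@fsum_reindex _ _ _ (fun x : int * int => (x.1 - 1, x.2))
  (fun x => (x.1 + 1, x.2))); last 2 first.
- by case=> m n /=; rewrite subrK.
- by case=> m n /=; rewrite addrK.
apply: eq_fsum => -[m n] /=; rewrite lderiv_phi_exp !lcoefMz s2d1E subrK.
by rewrite mulrzAl mulrzAr.
Qed.

(** On powers of phi the operator p(x) d/dx agrees with d/dz, which accounts for the first term; the
    second comes from the explicit variable x. *)
Lemma lmapd_T f :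
  lmapd (Dp p) (T f) = T (s2in1 p * s2d1 f + s2in2 p * s2d2 f).
Proof.
have ld := lderiv_derivation K; have Dd := Dp_derivation p.
have DpE F : lmapd (Dp p) F = lconst p * lmapd (@lderiv K) F.
  by apply: laurent_ext => k; rewrite lcoefZ !lmapdE.
have rl : regular (fun m => lmapd (@lderiv K) (phi p ^ m)).
  have [[N bN] bM] := rphi; split.
    exists N => m k l; rewrite lmapdE // => nz; apply: (bN m k (l + 1)).
    by apply: contraNneq nz => nz; rewrite lderivE nz mul0rz.
  move=> M; have [L bL] := bM M; exists (L + 1) => m k l kM; rewrite lmapdE // => nz.
  suff : m - L <= l + 1 by lia.
  by apply: bL kM _; apply: contraNneq nz => nz; rewrite lderivE nz mul0rz.
(* Once the derivative in the explicit variable is removed, what remains is the substitution with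
   d/dx(phi^m) in place of phi^m. *)
have key F : F = lmapd (@lderiv K) (T f) - T (s2d2 f) ->
    forall k l, F k l = ksubst (fun m => lmapd (@lderiv K) (phi p ^ m)) f k l.
  move=> -> k l; rewrite -[LHS]/(lmapd (@lderiv K) (T f) k l - T (s2d2 f) k l).
  apply/eqP; rewrite subr_eq; apply/eqP.
  rewrite lmapdE // lderivE !TE /ksubst (fsum_morph (g := fun x : K => x *~ (l + 1))); first last.
  - exact: (@fs_ksubst (exprz (phi p))).
  - by move=> x y; rewrite mulrzDl.
  rewrite [X in _ = _ + X](@fsum_reindex _ _ _ (fun x : int * int => (x.1, x.2 - 1))
    (fun x => (x.1, x.2 + 1))); last 2 first.
  - by case=> m n /=; rewrite subrK.
  - by case=> m n /=; rewrite addrK.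
  rewrite -fsumD.
  - apply: eq_fsum => -[m n] /=; rewrite s2d2E subrK lmapdE // lderivE.
    have -> : l - (n - 1) = l + 1 - n by lia.
    have -> : l - n + 1 = l + 1 - n by lia.
    by rewrite mulrzAl mulrzAr -mulrzDr; congr (_ *~ _); lia.
  - exact: (@fs_ksubst (fun m => lmapd (@lderiv K) (phi p ^ m))).
  - apply: (@fs_reindex _ _ _ (fun x : int * int => (x.1, x.2 - 1)) (fun x => (x.1, x.2 + 1))
      (fun x => (phi p ^ x.1) k (l - x.2) * s2d2 f x.1 x.2)); last exact: (@fs_ksubst (exprz (phi p))).
    by case=> m n /=; rewrite subrK.
rewrite DpE -[lmapd _ (T f)](subrK (T (s2d2 f))) mulrDr TD [X in _ = _ + X]TM T_in2.
congr (_ + _); rewrite -lderiv_T; apply: laurent_ext => k; apply: laurent_ext => l.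
rewrite (@mul_ksubst _ _ _ _ _ _ rl (key _ erefl)) lderivE lcoefMz TE -ksubst_lderiv //.
by apply: eq_fsum => x; rewrite -DpE !phi_exp // Ephi_ode.
Qed.

Hypothesis p0 : p != 0.

Lemma E_neq0 f : f != 0 -> E f != 0.
Proof. by apply: contra_neq => Ef; rewrite -(Ephi0 p f) Ef. Qed.

Lemma intr_neq0 (j : int) : j != 0 -> j%:~R != 0 :> K.
Proof. by case: j => [[|j]|j] //= _; rewrite ?NegzE ?mulrNz ?oppr_eq0 -pmulrn char0. Qed.

(* The kernel of T is stable under x1 d/dx1, hence contains the components of *)
(* its elements that are homogeneous in x1.                                   *)
Lemma T_euler (f : series2 K) (c : int) : T f = 0 -> exists2 g, T g = 0 &
  forall m n, g m n = f m n *~ (m - c).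
Proof.
move=> Tf; have : T (s2in1 p * s2d1 f) = 0.
  rewrite -lderiv_T Tf; apply: laurent_ext => k; apply: laurent_ext => l.
  by rewrite lderivE lcoefMz lcoef0 mul0rz.
rewrite TM T_in1 => /eqP; rewrite mulf_eq0 (negPf (E_neq0 p0)) /= => /eqP Td.
exists (s2in1 (mono K 1) * s2d1 f - f *~ c).
  have Tz j : T (f *~ j) = 0.
    have Tn i : T (f *+ i) = 0.
      by elim: i => [|i IH]; rewrite ?mulr0n ?T0 // mulrS TD Tf IH addr0.
    by case: j => j; rewrite ?NegzE ?mulrNz -?pmulrn ?TN Tn ?oppr0.
  by rewrite TB TM Td mulr0 Tz subr0.
move=> m n.
rewrite -[LHS]/((s2in1 (mono K 1) * s2d1 f : series2 K) m n - (f *~ c) m n).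
have -> : (s2in1 (mono K 1) * s2d1 f : series2 K) m n = f m n *~ m.
  rewrite -[LHS]/(((s2in1 (mono K 1) : laurent (laurent K)) * (s2d1 f : laurent (laurent K))) m n).
  rewrite lcoef2M (@fsum1 _ _ (1, 0)) => [|[i j] nz].
    by rewrite /= s2in1E eqxx monoE eqxx mul1r subr0 s2d1E subrK.
  rewrite /= s2in1E monoE; move: nz; rewrite xpair_eqE andbC.
  by case: eqP => _ /=; rewrite ?mul0r // => /negPf ->; rewrite mul0r.
rewrite mulrzDr mulrNz; congr (_ - _).
by rewrite s2coefMz.
Qed.

(** At z = 0 phi reduces to x, so the coefficient of z^0 x^(m+n) sees only the sum of the f i j with
    i + j = m + n. By [T_euler] the kernel is stable under multiplying f i j by i - c. Doing so for
    every other candidate exponent c leaves the single term f m n, times an integer that is nonzero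
    in characteristic 0. *)
Lemma T_inj f : T f = 0 -> f = 0.
Proof.
move=> Tf; have [N fN] := series2P f.
suff f0 m n : f m n = 0.
  by apply: val_inj; apply: laurent_ext => m; apply: laurent_ext => n; exact: f0.
have elim_range (s : seq int) : exists2 g, T g = 0 &
    forall m n, g m n = f m n * \prod_(c <- s) (m - c)%:~R.
  elim: s => [|c s [g Tg gE]]; first by exists f => // i j; rewrite big_nil mulr1.
  have [h Th hE] := T_euler c Tg; exists h => // i j.
  by rewrite hE gE big_cons mulrCA -mulrzr mulrC mulrA -mulrA.
(* If i + j = m + n and both i and j are at least [N], then i lies between [N] and m + n - [N]. *)
have [g Tg gE] := elim_range [seq c <- irange N (m + n - N) | c != m].
have : T g 0 (m + n) = 0 by rewrite Tg.
rewrite TE /ksubst (@fsum1 _ _ (m, n)) => [|[i j] ij].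
  rewrite /= phi_exp // Ephi0 monoE addrK eqxx mul1r gE => /eqP.
  rewrite mulf_eq0 => /orP[/eqP //|]; rewrite prodf_seq_eq0 => /hasP[c].
  rewrite mem_filter => /andP[cm _] /= /negPn[].
  by rewrite intr_neq0 // subr_eq0 eq_sym.
rewrite /= phi_exp // Ephi0 monoE; case: eqP => [ijmn|_]; last by rewrite mul0r.
have [->|nz] := eqVneq (g i j) 0; first by rewrite mulr0.
have [|Ni Nj] := fN i j; first by apply: contraNneq nz => f0; rewrite gE f0 mul0r.
case/eqP: nz; rewrite gE; apply/eqP; rewrite mulf_eq0 prodf_seq_eq0; apply/orP; right.
apply/hasP; exists i; last by rewrite /= subrr.
rewrite mem_filter; apply/andP; split; last by apply: in_irange; lia.
by apply: contraNneq ij => im; apply/eqP; congr (_, _); lia.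
Qed.

End Evaluation2.

Lemma fraction_numden (R : idomainType) (x : {fraction R}) :
  x = FracField.tofrac \n_(repr x) / FracField.tofrac \d_(repr x).
Proof.
have d0 : \d_(repr x) != 0 by exact: denom_ratioP.
unlock FracField.tofrac.
rewrite -[X in _ * X]FracField.pi_inv -[RHS]FracField.pi_mul.
rewrite /FracField.mulf /FracField.invf /= !numden_Ratio ?oner_neq0 //.
by rewrite mulr1 mul1r Ratio_numden reprK.
Qed.

(** * Extension of ring embeddings to the fraction field *)

Section FractionExtension.
Variables (K : fieldType) (L : fieldType) (e : series2 K -> L).
Hypothesis eB : forall f g, e (f - g) = e f - e g.
Hypothesis eM : forall f g, e (f * g) = e f * e g.
Hypothesis e1 : e 1 = 1.
Hypothesis einj : forall f, e f = 0 -> f = 0.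

Lemma s2frac_inj : injective (@s2frac K).
Proof. by move=> f g /eqP; rewrite /s2frac tofrac_eq => /eqP. Qed.

Lemma s2fracM : {morph @s2frac K : f g / f * g}. Proof. exact: rmorphM. Qed.
Lemma s2fracN : {morph @s2frac K : f / - f}. Proof. exact: rmorphN. Qed.

Lemma fden_neq0 (F : frac2 K) : fden F != 0.
Proof. exact: denom_ratioP. Qed.

Lemma s2frac_neq0 (f : series2 K) : f != 0 -> s2frac f != 0.
Proof. by apply: contra_neq => f0; apply: s2frac_inj; rewrite f0 rmorph0. Qed.

Lemma fden_mul (F : frac2 K) : s2frac (fden F) * F = s2frac (fnum F).
Proof.
have FE : F = s2frac (fnum F) / s2frac (fden F) by exact: fraction_numden.
by rewrite [X in _ * X]FE mulrC divfK // s2frac_neq0 // fden_neq0.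
Qed.

Lemma e_neq0 f : f != 0 -> e f != 0.
Proof. by apply: contra_neq => /einj. Qed.

(** [fextend] is defined through a chosen representative of [F]; this allows computing it from any
    relation q F = g. *)
Lemma fextendP q g F : s2frac q * F = s2frac g -> e g = e q * fextend e F.
Proof.
move=> qF; have d0 := e_neq0 (fden_neq0 F).
have : q * fnum F = g * fden F.
  apply: s2frac_inj; rewrite !rmorphM /= -(fden_mul F) mulrCA qF mulrC //.
move/(congr1 e); rewrite !eM /fextend => qn.
by rewrite mulrA qn mulfK.
Qed.

Lemma fextendE q g F : q != 0 -> s2frac q * F = s2frac g -> fextend e F = e g / e q.
Proof. by move=> q0 /fextendP ->; rewrite mulrC mulKf // e_neq0. Qed.

Lemma fextend_frac g : fextend e (s2frac g) = e g.
Proof. by rewrite (@fextendE 1 g) ?oner_neq0 ?rmorph1 ?mul1r // e1 divr1. Qed.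

Lemma e0 : e 0 = 0. Proof. by rewrite -(subrr 0) eB subrr. Qed.
Lemma eD f g : e (f + g) = e f + e g.
Proof. by rewrite -{1}(opprK g) eB -[- g]sub0r eB e0 sub0r opprK. Qed.

Lemma fextendD F G : fextend e (F + G) = fextend e F + fextend e G.
Proof.
have [dF dG] := (fden_neq0 F, fden_neq0 G).
rewrite (@fextendE (fden F * fden G) (fnum F * fden G + fnum G * fden F)) ?mulf_neq0 //.
  by rewrite eD !eM /fextend addf_div ?e_neq0.
rewrite mulrDr !rmorphD !rmorphM /= -(fden_mul F) -(fden_mul G).
by congr (_ + _); [rewrite mulrAC | rewrite -mulrA mulrC].
Qed.

Lemma fextendMl q F : fextend e (s2frac q * F) = e q * fextend e F.
Proof.
rewrite (@fextendE (fden F) (q * fnum F)) ?fden_neq0 //.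
  by rewrite eM /fextend mulrA.
by rewrite rmorphM /= -(fden_mul F) mulrCA.
Qed.

End FractionExtension.

Section PhiEval.
Variables (K : fieldType) (p : laurent K).
Hypothesis char0 : forall n : nat, n.+1%:R != 0 :> K.
Hypothesis p0 : p != 0.

Local Notation T := (s2eval (phi p)).

Lemma Tinj f : T f = 0 -> f = 0. Proof. exact: T_inj. Qed.
Lemma T1 : T 1 = 1. Proof. by apply: s2eval1; exact: regular_phi. Qed.

Lemma phi_evalD F G : phi_eval p (F + G) = phi_eval p F + phi_eval p G.
Proof. by apply: fextendD; [exact: TB | exact: TM | exact: Tinj]. Qed.

Lemma phi_evalMl q F : phi_eval p (s2frac q * F) = T q * phi_eval p F.
Proof. by apply: fextendMl; [exact: TM | exact: Tinj]. Qed.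

Lemma phi_eval_frac g : phi_eval p (s2frac g) = T g.
Proof. by apply: fextend_frac; [exact: TM | exact: T1 | exact: Tinj]. Qed.

Lemma T_const (a : K) : T (s2const a) = lconst (lconst a).
Proof.
have -> : s2const a = s2in2 (lconst a); last exact: T_in2.
apply: val_inj; apply: laurent_ext => m.
apply: laurent_ext => n; rewrite -[RHS]/(s2in2 (lconst a) m n) s2in2E.
by rewrite lcoefC /= /delta0; case: (m == 0).
Qed.

Lemma phi_evalZ (a : K) F : phi_eval p (a *: F) = lconst (lconst a) * phi_eval p F.
Proof. by rewrite -[a *: F]/(s2frac (s2const a) * F) phi_evalMl T_const. Qed.

(* F(phi(x,z),x) is killed by p(x) d/dx. *)
Lemma Cphi2_const F : Cphi2 p F -> forall k l, l != 0 -> phi_eval p F k l = 0.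
Proof.
have Dd := Dp_derivation p; have Ld := lmapd_derivation Dd.
rewrite /Cphi2 /fderiv; set n := fnum F; set d := fden F => e.
have d0 : d != 0 by exact: fden_neq0.
have d20 : s2frac (d ^+ 2) != 0 by apply: s2frac_neq0; rewrite expf_neq0.
have {}e : s2in1 p * (s2d1 n * d - n * s2d1 d) = - (s2in2 p * (s2d2 n * d - n * s2d2 d)).
  apply: s2frac_inj; apply: (mulIf (invr_neq0 d20)).
  move: e {d20}; move: (s2d1 n * d - _) (s2d2 n * d - _) (d ^+ 2) => X Y D.
  by rewrite s2fracN !s2fracM mulNr -!mulrA.
(* [del] is p(x1) d/dx1 + p(x2) d/dx2, the derivation that kills the elements of [Cphi2]; for the
   fraction n/d this says del(n) d = n del(d). *)
have [del delE] : exists del, forall f, del f = s2in1 p * s2d1 f + s2in2 p * s2d2 f by eexists.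
have {e} dn : del n * d = n * del d.
  apply/eqP; rewrite -subr_eq0; apply/eqP.
  transitivity (s2in1 p * (s2d1 n * d - n * s2d1 d) + s2in2 p * (s2d2 n * d - n * s2d2 d)).
    rewrite !delE !mulrBr mulrDl mulrDr opprD addrACA !mulrA.
    by rewrite [s2in1 p * n]mulrC [s2in2 p * n]mulrC.
  by rewrite e addNr.
have Tdel f : lmapd (Dp p) (T f) = T (del f) by rewrite lmapd_T // delE.
have {}dn : lmapd (Dp p) (T n) * T d = T n * lmapd (Dp p) (T d).
  by rewrite (Tdel n) (Tdel d) -(TM p char0 (del n)) -(TM p char0 n) dn.
have Td0 : T d != 0 by apply: contra_neq d0 => /Tinj.
have nE : T n = phi_eval p F * T d by rewrite /phi_eval /fextend divfK.
(* By the Leibniz rule for T n = F (T d), the term in which T d is differentiated already accounts,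
   by [dn], for the whole derivative of T n; hence D(F) vanishes after multiplication by powers of T
   d. *)
have DF0 : lmapd (Dp p) (phi_eval p F) = 0.
  apply: (mulIf Td0); apply: (mulIf Td0); rewrite !mul0r.
  have alg (A x t B : laurent (laurent K)) : (A * t + x * B) * t = x * t * B -> A * t * t = 0.
    by move=> e; apply: (addIr (x * t * B)); rewrite add0r -[RHS]e mulrDl [x * B * t]mulrAC.
  apply: (alg _ (phi_eval p F) _ (lmapd (Dp p) (T d))); rewrite -nE.
  by have <- := Ld.2 (phi_eval p F) (T d); rewrite -nE; exact: dn.
move=> k l l0; have := congr1 (fun H : laurent (laurent K) => H k) DF0.
rewrite lmapdE // => /eqP; rewrite /Dp mulf_eq0 (negPf p0) /= => /eqP.
move=> /(congr1 (fun g : laurent K => g (l - 1))); rewrite lderivE subrK lcoef0 => /eqP.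
by rewrite -mulrzr mulf_eq0 (negPf (intr_neq0 char0 l0)) orbF => /eqP.
Qed.

Lemma pi_phiE F n : pi_phi p F n = phi_eval p F n 0.
Proof.
have [N bN] := laurentP (phi_eval p F).
by rewrite /pi_phi (@mklaurentE _ N) // => k kN; rewrite bN.
Qed.

Lemma pi_phi_linear : linear (pi_phi p : frac2 K -> laurent K).
Proof.
move=> a F G; apply: laurent_ext => n; rewrite pi_phiE phi_evalD phi_evalZ.
have E1 (x y : laurent K) : (a *: x + y) n = a * x n + y n by rewrite lcoefD lcoefZ.
have E2 (x y : laurent (laurent K)) : (lconst (lconst a) * x + y) n 0 = a * x n 0 + y n 0.
  rewrite -[LHS]/((lconst (lconst a) * x) n 0 + y n 0) /= cauchy_delta /=.
  by rewrite cauchy_delta.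
transitivity (a * phi_eval p F n 0 + phi_eval p G n 0); first exact: E2.
rewrite [RHS]E1.
exact: (f_equal2 (fun u v => a * u + v) (esym (pi_phiE F n)) (esym (pi_phiE G n))).
Qed.

Lemma phi_eval_Cphi2 F k l : Cphi2 p F -> phi_eval p F k l = if l == 0 then pi_phi p F k else 0.
Proof.
move=> CF; case: (eqVneq l 0) => [->|l0]; first exact/esym/pi_phiE.
exact: Cphi2_const.
Qed.

End PhiEval.

Section Iota.
Variable K : fieldType.

Lemma iota21D (F G : frac2 K) : iota21 (F + G) = iota21 F + iota21 G.
Proof. by apply: fextendD => // f f0; exact: val_inj. Qed.

Lemma iota21Ml q (F : frac2 K) : iota21 (s2frac q * F) = (q : laurent (laurent K)) * iota21 F.
Proof. by apply: fextendMl => // f f0; exact: val_inj. Qed.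

Lemma iota21_frac (g : series2 K) : iota21 (s2frac g) = g.
Proof. by apply: fextend_frac => // f f0; exact: val_inj. Qed.

Lemma iota21Z (a : K) F : iota21 (a *: F) = lconst (lconst a) * iota21 F.
Proof. by rewrite -[a *: F]/(s2frac (s2const a) * F) iota21Ml. Qed.

End Iota.

(** * Tensor products *)

Section TensorTools.
Variables (K : fieldType).
Implicit Types (U V W X Y : lmodType K).

Lemma tens_bilin V W : bilin (@tens K V W).
Proof.
split=> [w a x y|v a x y]; first by rewrite tensDl tensZl.
by rewrite tensDr tensZr.
Qed.

Lemma bilin_comp2 V W V' W' X (B : V -> W -> X) (f : V' -> V) (g : W' -> W) :
  bilin B -> linear f -> linear g -> bilin (fun v w => B (f v) (g w)).
Proof.
move=> [Bl Br] lf lg; split=> [w|v].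
  exact: (linear_comp (f := B^~ (g w))).
exact: (linear_comp (f := B (f v))).
Qed.

Lemma bilin_big V W X (I : Type) (r : seq I) (B : I -> V -> W -> X) :
  (forall i, bilin (B i)) -> bilin (fun v w => \sum_(i <- r) B i v w).
Proof. by move=> bB; split=> [w|v]; apply: linear_big => i; case: (bB i). Qed.

Lemma bilin_fsum V W X (I : choiceType) (B : I -> V -> W -> X) :
  (forall i, bilin (B i)) -> (forall v w, fs (fun i => B i v w)) ->
  bilin (fun v w => \sum_(i \in [set: I]) B i v w).
Proof. by move=> bB fB; split=> [w|v]; apply: linear_fsum => // i; case: (bB i). Qed.

Lemma tensE V W (t : tensor V W) : t = \sum_(q <- repr t) q.1 *t q.2.
Proof. by rewrite -[LHS]tens_ofK tens_sum. Qed.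

Lemma tens_neq0 V W (v : V) (w : W) : v *t w != 0 -> v != 0 /\ w != 0.
Proof.
by move=> nz; split; [exact: lin_neq0 ((tens_bilin V W).1 w) _ nz
  | exact: lin_neq0 ((tens_bilin V W).2 v) _ nz].
Qed.

Lemma tens_conv_fs V W (f : int -> V) (g : int -> W) n :
  (exists N, forall i, f i != 0 -> N <= i) -> (exists N, forall i, g i != 0 -> N <= i) ->
  fs (fun i => f i *t g (n - i)).
Proof.
move=> [N fN] [M gM]; apply: (@fs_int _ _ N (n - M)) => i /tens_neq0 [/fN ? /gM ?].
by split; lia.
Qed.

Lemma tens_conv_ge V W (f : int -> V) (g : int -> W) N M n :
  (forall i, f i != 0 -> N <= i) -> (forall i, g i != 0 -> M <= i) ->
  tens_conv f g n != 0 -> N + M <= n.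
Proof. by move=> fN gM /fsum_neq0 [i /tens_neq0 [/fN ? /gM ?]]; lia. Qed.

Lemma lin_tlift V W X Y (B : V -> W -> X) (g : X -> Y) t :
  linear g -> g (tlift B t) = tlift (fun v w => g (B v w)) t.
Proof. by move=> lg; rewrite /tlift lin_sum. Qed.

Lemma eq_tlift V W X (B B' : V -> W -> X) t :
  (forall v w, B v w = B' v w) -> tlift B t = tlift B' t.
Proof. by move=> BB'; apply: eq_bigr => q _. Qed.

Lemma eq_linear_tens V W X (f g : tensor V W -> X) :
  linear f -> linear g -> (forall v w, f (v *t w) = g (v *t w)) -> forall t, f t = g t.
Proof.
move=> lf lg fg t; rewrite (tensE t) !lin_sum //; apply: eq_bigr => q _; exact: fg.
Qed.

Lemma tens_map_linear V W V' W' (f : V -> V') (g : W -> W') :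
  linear f -> linear g -> linear (tens_map f g).
Proof. by move=> lf lg; apply: tlift_linear; apply: bilin_comp2 => //; exact: tens_bilin. Qed.

Lemma tens_map_tens V W V' W' (f : V -> V') (g : W -> W') v w :
  linear f -> linear g -> tens_map f g (v *t w) = f v *t g w.
Proof. by move=> lf lg; apply: tlift_tens; apply: bilin_comp2 => //; exact: tens_bilin. Qed.

Lemma linear_id V : linear (@id V). Proof. by []. Qed.

Lemma tlift_tens_map V W V' W' X (f : V -> V') (g : W -> W') (B : V' -> W' -> X) t :
  linear f -> linear g -> bilin B ->
  tlift B (tens_map f g t) = tlift (fun v w => B (f v) (g w)) t.
Proof.
move=> lf lg bB; apply: (eq_linear_tens (f := fun t => tlift B (tens_map f g t))).
- by apply: linear_comp; [exact: tlift_linear | exact: tens_map_linear].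
- by apply: tlift_linear; exact: bilin_comp2.
by move=> v w; rewrite tens_map_tens // !tlift_tens //; exact: bilin_comp2.
Qed.

Definition trilin U V W X (C : U -> V -> W -> X) :=
  [/\ forall v w, linear (fun u => C u v w), forall u w, linear (fun v => C u v w) &
      forall u v, linear (C u v)].

Lemma trilin_bilin1 U V W X (C : U -> V -> W -> X) :
  trilin C -> forall u, bilin (C u).
Proof. by case=> C1 C2 C3 u; split=> [w|v]; [exact: C2 | exact: C3]. Qed.

Lemma trilin_bilin3 U V W X (C : U -> V -> W -> X) :
  trilin C -> forall w, bilin (fun u v => C u v w).
Proof. by case=> C1 C2 C3 w; split=> [v|u]; [exact: C1 | exact: C2]. Qed.

Lemma tlift_bilinl U V W X (C : U -> V -> W -> X) t :
  (forall v w, linear (fun u => C u v w)) -> linear (fun u => tlift (C u) t).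
Proof. by move=> lC; apply: linear_big => q; exact: lC. Qed.

Lemma tens_assoc_tlift U V W X (C : U -> V -> W -> X) t : trilin C ->
  tlift (fun u s => tlift (C u) s) (tens_assoc t) =
  tlift (fun s w => tlift (fun u v => C u v w) s) t.
Proof.
move=> tC; have bC1 := trilin_bilin1 tC; have bC3 := trilin_bilin3 tC.
have [C1 C2 C3] := tC.
have bL : bilin (fun u (s : tensor V W) => tlift (C u) s).
  by split=> [s|u]; [exact: tlift_bilinl | exact: tlift_linear].
have bR : bilin (fun (s : tensor U V) w => tlift (fun u v => C u v w) s).
  split=> [w|s]; first exact: tlift_linear.
  by apply: linear_big => q; exact: C3.
have bA (c : W) : bilin (fun (a : U) (b : V) => a *t (b *t c)).
  split=> [v a x y|u a x y]; first by rewrite tensDl tensZl.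
  by rewrite tensDl tensZl tensDr tensZr.
have bA' : bilin (fun (ab : tensor U V) (c : W) => tlift (fun a b => a *t (b *t c)) ab).
  split=> [c|s]; first exact: tlift_linear.
  apply: linear_big => q a x y.
  by rewrite tensDr tensZr tensDr tensZr.
apply: (eq_linear_tens (f := fun t => tlift _ (tens_assoc t))).
- by apply: linear_comp; exact: tlift_linear.
- exact: tlift_linear.
move=> s w; rewrite /tens_assoc !tlift_tens //.
apply: (eq_linear_tens (f := fun s => tlift _ (tlift _ s))).
- by apply: linear_comp; exact: tlift_linear.
- exact: tlift_linear.
by move=> u v; rewrite !tlift_tens.
Qed.

(** This makes coassociativity, an identity between tensors with fixed bracketing, applicable to
    Sweedler sums written as nested [tlift]. *)
Lemma coassoc_tlift X (H : lmodType K) (Delta : H -> tensor H H) (eps : H -> K)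
    (C : H -> H -> H -> X) h : is_coalgebra Delta eps -> trilin C ->
  tlift (fun h1 h2 => tlift (fun a b => C a b h2) (Delta h1)) (Delta h) =
  tlift (fun h1 h2 => tlift (C h1) (Delta h2)) (Delta h).
Proof.
move=> co tC; have lD := coalg_Delta_linear co; have [C1 C2 C3] := tC.
have bC1 := trilin_bilin1 tC; have bC3 := trilin_bilin3 tC.
transitivity (tlift (fun s w => tlift (fun u v => C u v w) s) (tens_map Delta id (Delta h))).
  rewrite tlift_tens_map //; split=> [w|s]; first exact: tlift_linear.
  by apply: linear_big => q; exact: C3.
rewrite -tens_assoc_tlift // (coalg_coassoc co) tlift_tens_map //.
split=> [s|u]; first exact: tlift_bilinl.
exact: tlift_linear.
Qed.

End TensorTools.

(** * Weak associativity with a multiplier *)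

Section VertexMapTools.
Variables (K : fieldType).

Lemma in_laurent2P (W : lmodType K) (A : int -> int -> W) :
  in_laurent2 A <-> exists N, bounded2 N A.
Proof.
split=> -[N AN]; exists N => m n.
  by move=> nz; split; rewrite leNgt; apply: contraNN nz => lt; rewrite AN //; [left|right].
by move=> mn; apply: contrapT => /eqP /AN; lia.
Qed.

Lemma in_laurentP (W : lmodType K) (f : int -> W) : in_laurent f ->
  exists N, forall n, f n != 0 -> N <= n.
Proof.
by case=> N fN; exists N => n nz; rewrite leNgt; apply: contraNN nz => /fN ->.
Qed.

Lemma in_laurentI (W : lmodType K) (f : int -> W) N :
  (forall n, f n != 0 -> N <= n) -> in_laurent f.
Proof. by move=> fN; exists N => n nN; apply: contrapT => /eqP /fN; rewrite leNgt nN. Qed.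

Section OneMap.
Variables (V W : lmodType K) (Y : V -> W -> int -> W).
Hypothesis vY : is_vertex_map Y.

Lemma vmap_linl w n : linear (fun v => Y v w n). Proof. exact: (vY.1 n).1 w. Qed.
Lemma vmap_linr v n : linear (fun w => Y v w n). Proof. exact: (vY.1 n).2 v. Qed.
Lemma vmap0l w n : Y 0 w n = 0. Proof. exact: lin_0 (vmap_linl w n). Qed.
Lemma vmap0r v n : Y v 0 n = 0. Proof. exact: lin_0 (vmap_linr v n). Qed.
Lemma vmap_ge v w : exists N, forall n, Y v w n != 0 -> N <= n.
Proof. by apply: in_laurentP; exact: vY.2. Qed.
Lemma vmap_neq0r v w n : Y v w n != 0 -> w != 0.
Proof. by apply: contra_neq => ->; rewrite vmap0r. Qed.
Lemma vmap_neq0l v w n : Y v w n != 0 -> v != 0.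
Proof. by apply: contra_neq => ->; rewrite vmap0l. Qed.

End OneMap.

Lemma Ycomp_l12 (A B W : lmodType K) (Y1 : A -> W -> int -> W) (Y2 : B -> W -> int -> W)
  u v w : is_vertex_map Y1 -> is_vertex_map Y2 -> in_l12 (Ycomp Y1 Y2 u v w).
Proof.
move=> v1 v2; apply: in_l12P => [|n]; last exact: (vmap_ge v1).
by have [N YN] := vmap_ge v2 v w; exists N => m n /(vmap_neq0r v1) /YN.
Qed.

Lemma Ycomp_l21 (A B W : lmodType K) (Y1 : A -> W -> int -> W) (Y2 : B -> W -> int -> W)
  u v w : is_vertex_map Y1 -> is_vertex_map Y2 -> in_l21 (fun i j => Y1 u (Y2 v w i) j).
Proof.
move=> v1 v2; apply: in_l21P => [|m]; last exact: (vmap_ge v1).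
by have [N YN] := vmap_ge v2 v w; exists N => m n /(vmap_neq0r v1) /YN.
Qed.

Lemma Yiter_l21 (A W : lmodType K) (YA : A -> A -> int -> A) (YW : A -> W -> int -> W)
  u v w : is_vertex_map YA -> is_vertex_map YW -> in_l21 (fun i j => YW (YA u v i) w j).
Proof.
move=> v1 v2; apply: in_l21P => [|n]; last exact: (vmap_ge v2).
by have [N YN] := vmap_ge v1 u v; exists N => m n /(vmap_neq0l v2) /YN.
Qed.

(* Weak associativity with multiplier q: A stands for a product of two fields *)
(* and R for the corresponding iterate, which [A(x1,x2)|_(x1 = a(x2,z))]      *)
(* equals after multiplication by q(a(x2,z),x2).                              *)
Definition wassoc (W : lmodType K) (a : laurent (laurent K)) (A : int -> int -> W)
    (q : series2 K) (R : int -> int -> W) : Prop :=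
  [/\ in_l12 A, in_l21 R, exists N, bounded2 N (smul q A) &
      subst1 a (smul q A) = smul (s2eval a q) R].

Section Wassoc.
Variables (W : lmodType K).
Implicit Types (A B R : int -> int -> W) (q : series2 K).

Lemma l12D A B : in_l12 A -> in_l12 B -> in_l12 (fun m n => A m n + B m n).
Proof.
have nz (x y : W) : x + y != 0 -> x != 0 \/ y != 0.
  by have [->|] := eqVneq x 0; [rewrite add0r; right | left].
move=> [[N AN] AM] [[L BL] BM]; split.
  by exists (Order.min N L) => m n /nz [/AN|/BL]; lia.
move=> M; have [[N' AN'] [L' BL']] := (AM M, BM M).
by exists (Order.min N' L') => m n nM /nz [/(AN' _ _ nM)|/(BL' _ _ nM)]; lia.
Qed.

Lemma l21D A B : in_l21 A -> in_l21 B -> in_l21 (fun m n => A m n + B m n).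
Proof.
have nz (x y : W) : x + y != 0 -> x != 0 \/ y != 0.
  by have [->|] := eqVneq x 0; [rewrite add0r; right | left].
move=> [[N AN] AM] [[L BL] BM]; split.
  by exists (Order.min N L) => m n /nz [/AN|/BL]; lia.
move=> M; have [[N' AN'] [L' BL']] := (AM M, BM M).
by exists (Order.min N' L') => m n nM /nz [/(AN' _ _ nM)|/(BL' _ _ nM)]; lia.
Qed.

Lemma bounded2D N A B : bounded2 N A -> bounded2 N B ->
  bounded2 N (fun m n => A m n + B m n).
Proof.
move=> AN BN m n; have [->|/AN //] := eqVneq (A m n) 0.
by rewrite add0r => /BN.
Qed.

Variable a : laurent (laurent K).
Hypotheses (ra : regular (exprz a)) (a0 : a != 0).

Lemma wassoc_mul A q R c : wassoc a A q R -> wassoc a A (c * q) R.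
Proof.
case=> lA lR [N bN] e; rewrite /wassoc smulA12 //; split=> //.
  by have [M MP] := smul_bounded c bN; exists M; exact: MP.
by rewrite (subst1_smul ra a0 c bN) e s2evalM // smulA21.
Qed.

Lemma wassoc_add A B q R S : wassoc a A q R -> wassoc a B q S ->
  wassoc a (fun m n => A m n + B m n) q (fun m n => R m n + S m n).
Proof.
move=> [lA lR [N bA] eA] [lB lS [M bB] eB].
have [sA sB] := (summable1_l12 q lA, summable1_l12 q lB).
have bA' : bounded2 (Order.min N M) (smul q A).
  by apply: bounded2W bA; rewrite ge_min lexx.
have bB' : bounded2 (Order.min N M) (smul q B).
  by apply: bounded2W bB; rewrite ge_min lexx orbT.
split; [exact: l12D | exact: l21D | |]; rewrite smulDr //.
  by exists (Order.min N M); exact: bounded2D.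
rewrite subst1E (gsubstD ra bA' bB') -!subst1E eA eB smulDr //;
  by apply: summable1_l21.
Qed.

Lemma wassocD A B q r R S : wassoc a A q R -> wassoc a B r S ->
  wassoc a (fun m n => A m n + B m n) (q * r) (fun m n => R m n + S m n).
Proof.
move=> /(wassoc_mul r); rewrite mulrC => wA /(wassoc_mul q) wB.
exact: wassoc_add.
Qed.

Lemma wassoc_ext A A' q R R' : A =2 A' -> R =2 R' -> wassoc a A q R -> wassoc a A' q R'.
Proof.
move=> AA' RR'; have -> : A' = A by do 2!apply/funext => ?; rewrite AA'.
by have -> : R' = R by do 2!apply/funext => ?; rewrite RR'.
Qed.

Lemma smul_zero (f : laurent (laurent K)) : smul f (fun _ _ => 0 : W) = (fun _ _ => 0 : W).
Proof. by do 2!apply/funext => ?; apply: fsum0 => x; rewrite scaler0. Qed.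

Lemma wassoc0 : wassoc a (fun _ _ => 0 : W) 1 (fun _ _ => 0).
Proof.
split; rewrite ?smul_zero.
- by split=> [|M]; exists 0 => m n; rewrite eqxx.
- by split=> [|M]; exists 0 => m n; rewrite eqxx.
- by exists 0 => m n; rewrite eqxx.
- by do 2!apply/funext => ?; apply: fsum0 => x; rewrite scaler0.
Qed.

Lemma wassoc_big (I : Type) (s : seq I) (A R : I -> int -> int -> W) (q : I -> series2 K) :
  (forall i, wassoc a (A i) (q i) (R i)) ->
  wassoc a (fun m n => \sum_(i <- s) A i m n) (\prod_(i <- s) q i)
    (fun m n => \sum_(i <- s) R i m n).
Proof.
move=> wA; elim: s => [|i s IH].
  rewrite big_nil; apply: (wassoc_ext _ _ wassoc0) => m n; by rewrite big_nil.
rewrite big_cons; apply: (wassoc_ext _ _ (wassocD (wA i) IH)) => m n; by rewrite big_cons.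
Qed.

Lemma wassoc_sum (I : Type) (s : seq I) (A R : I -> int -> int -> W) q :
  (forall i, wassoc a (A i) q (R i)) ->
  wassoc a (fun m n => \sum_(i <- s) A i m n) q (fun m n => \sum_(i <- s) R i m n).
Proof.
move=> wA; elim: s => [|i s IH].
  rewrite -[q]mulr1; apply: (wassoc_ext _ _ (wassoc_mul q wassoc0)) => m n;
    by rewrite big_nil.
apply: (wassoc_ext _ _ (wassoc_add (wA i) IH)) => m n; by rewrite big_cons.
Qed.

Lemma wassoc_smul A q R (g : series2 K) : wassoc a A q R ->
  wassoc a (smul g A) q (smul (s2eval a g) R).
Proof.
case=> lA lR [N bN] e; have lgA := smul_l12 g lA.
have comm : smul q (smul g A) = smul g (smul q A) by rewrite -!smulA12 // mulrC.
split; rewrite ?comm //.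
- exact: smul_l21.
- by have [M MP] := smul_bounded g bN; exists M; exact: MP.
- by rewrite (subst1_smul ra a0 g bN) e -!smulA21 // mulrC.
Qed.

(** The factor [f] used to commute two fields is not divided out of the product, where it need not
    be invertible; it becomes part of the multiplier. *)
Lemma wassoc_unsmul A q R (f : series2 K) : in_l12 A -> in_l21 R ->
  wassoc a (smul f A) q (smul (s2eval a f) R) -> wassoc a A (f * q) R.
Proof.
move=> lA lR [lfA lfR [N bN] e].
have qf : smul (f * q) A = smul q (smul f A) by rewrite mulrC smulA12.
split; rewrite ?qf //; first by exists N.
by rewrite e -smulA21 // -s2evalM // [q * f]mulrC.
Qed.

End Wassoc.

Lemma wassoc_lin (U W : lmodType K) (a : laurent (laurent K)) (g : U -> W)
    (A R : int -> int -> U) (q : series2 K) :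
  regular (exprz a) -> linear g ->
  wassoc a A q R -> wassoc a (fun m n => g (A m n)) q (fun m n => g (R m n)).
Proof.
move=> ra lg [lA lR [N bN] e].
have sqA : smul q (fun m n => g (A m n)) = (fun m n => g (smul q A m n)).
  by do 2!apply/funext => ?; rewrite (smul_lin _ _ lg) //; exact: summable1_l12.
split.
- have [[M AM] AL] := lA; split=> [|L]; first by exists M => m n /(lin_neq0 lg) /AM.
  by have [L' AL'] := AL L; exists L' => m n nL /(lin_neq0 lg) /(AL' _ _ nL).
- have [[M RM] RL] := lR; split=> [|L]; first by exists M => m n /(lin_neq0 lg) /RM.
  by have [L' RL'] := RL L; exists L' => m n nL /(lin_neq0 lg) /(RL' _ _ nL).
- by exists N; rewrite sqA => m n /(lin_neq0 lg) /bN.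
rewrite sqA; do 2!apply/funext => ?.
rewrite subst1E -(gsubst_lin _ _ lg ra bN) -subst1E e.
by rewrite (smul_lin _ _ lg) //; exact: summable1_l21.
Qed.

Definition tconv2 (U W : lmodType K) (A : int -> int -> U) (B : int -> int -> W) :=
  conv2 (fun i j m n => A i j *t B m n).

Section TensorProduct.
Variables (U W : lmodType K).
Implicit Types (A : int -> int -> U) (B : int -> int -> W).

Lemma cone12_tens A B : in_l12 A -> in_l12 B -> cone12 (fun i j m n => A i j *t B m n).
Proof.
move=> [[N AN] AM] [[L BL] BM]; split.
  by exists (Order.min N L) => i j m n /tens_neq0 [/AN ? /BL ?]; lia.
move=> M; have [[N' AN'] [L' BL']] := (AM M, BM M); exists (Order.min N' L').
by move=> i j m n jM nM /tens_neq0 [/(AN' _ _ jM) ? /(BL' _ _ nM) ?]; lia.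
Qed.

Lemma cone21_tens A B : in_l21 A -> in_l21 B -> cone21 (fun i j m n => A i j *t B m n).
Proof.
move=> [[N AN] AM] [[L BL] BM]; split.
  by exists (Order.min N L) => i j m n /tens_neq0 [/AN ? /BL ?]; lia.
move=> M; have [[N' AN'] [L' BL']] := (AM M, BM M); exists (Order.min N' L').
by move=> i j m n jM nM /tens_neq0 [/(AN' _ _ jM) ? /(BL' _ _ nM) ?]; lia.
Qed.

Lemma smul_tconv2 (f g : laurent (laurent K)) A B :
  summable2 g (fun i j m n => A i j *t B m n) ->
  summable2 f (fun i j m n => A i j *t smul g B m n) -> summable1 f A -> summable1 g B ->
  smul f (smul g (tconv2 A B)) = tconv2 (smul f A) (smul g B).
Proof.
move=> sg sf sA sB; rewrite /tconv2 smul_conv2_in //.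
have -> : (fun i j => smul g (fun m n => A i j *t B m n)) = (fun i j m n => A i j *t smul g B m n).
  do 4!apply/funext => ?.
  by rewrite (@smul_lin _ _ _ (fun w => _ *t w) _ _ _ _ ((tens_bilin U W).2 _)).
rewrite smul_conv2_out //; congr conv2; do 4!apply/funext => ?.
by rewrite (@smul_lin _ _ _ (fun u => u *t _) _ _ _ _ ((tens_bilin U W).1 _)).
Qed.

Variable a : laurent (laurent K).
Hypotheses (ra : regular (exprz a)) (a0 : a != 0).

(** Each multiplier acts on its own tensor factor, and substitution is multiplicative. This serves
    the action of H on V (x) H, which is a sum of such products over the coproduct. *)
Lemma wassoc_tens A B q r R S : wassoc a A q R -> wassoc a B r S ->
  wassoc a (tconv2 A B) (q * r) (tconv2 R S).
Proof.
move=> [lA lR [N bA] eA] [lB lS [M bB] eB].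
have lr (u : U) : linear (fun w : W => u *t w) by exact: ((tens_bilin U W).2 u).
have smulE' : smul (q * r) (tconv2 A B) = tconv2 (smul q A) (smul r B).
  have cAB := cone12_tens lA lB; have cArB := cone12_tens lA (smul_l12 r lB).
  rewrite smulA12; last exact: conv2_l12.
  by apply: smul_tconv2; [exact: summable2_cone12 | exact: summable2_cone12
    | exact: summable1_l12 | exact: summable1_l12].
have smulE2 : smul (s2eval a q * s2eval a r) (tconv2 R S) =
    tconv2 (smul (s2eval a q) R) (smul (s2eval a r) S).
  have cRS := cone21_tens lR lS; have cRrS := cone21_tens lR (smul_l21 (s2eval a r) lS).
  rewrite smulA21; last exact: conv2_l21.
  by apply: smul_tconv2; [exact: summable2_cone21 | exact: summable2_cone21
    | exact: summable1_l21 | exact: summable1_l21].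
pose L := Order.min N M.
have bA' : bounded2 L (smul q A) by apply: bounded2W bA; rewrite ge_min lexx.
have bB' : bounded2 L (smul r B) by apply: bounded2W bB; rewrite ge_min lexx orbT.
split.
- by apply: conv2_l12; exact: cone12_tens.
- by apply: conv2_l21; exact: cone21_tens.
- rewrite smulE'; exists (L + L); apply: conv2_bounded => i j m n /tens_neq0.
  by move=> [/bA' [? ?] /bB' [? ?]]; split.
rewrite smulE' s2evalM // smulE2 -eA -eB subst1E /tconv2.
rewrite (@subst_conv2 _ _ _ _ (smul q A) (fun u m n => u *t smul r B m n) L) //.
- congr conv2; do 4!apply/funext => ?.
  by rewrite subst1E (gsubst_lin _ _ (lr _) ra bB').
- exact: expa_add.
- by move=> m n; exact: (tens_bilin U W).1.
- by move=> i j m n /tens_neq0 [_ /bB'].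
Qed.

End TensorProduct.

End VertexMapTools.
Lemma unif_range2 (P : int -> int -> int -> Prop) (a b : int) :
  (forall i j, exists N, P i j N) -> (forall i j N N', N' <= N -> P i j N -> P i j N') ->
  exists N, forall i j, a <= i -> i <= b -> a <= j -> j <= b -> P i j N.
Proof.
move=> exP monP.
have [||N NP] := @unif_range (fun i N => forall j, a <= j -> j <= b -> P i j N) a b.
- by move=> i; apply: unif_range => // j N N'; exact: monP.
- by move=> i N N' NN' PN j aj jb; apply: monP NN' _; exact: PN.
- by exists N => i j ai ib aj jb; exact: NP.
Qed.

Lemma big_ge (W : zmodType) (I P : Type) (s : seq I) (F : I -> P -> W) (g : P -> int) :
  (forall i, exists N, forall x, F i x != 0 -> N <= g x) ->
  exists N, forall x, \sum_(i <- s) F i x != 0 -> N <= g x.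
Proof.
move=> FN; elim: s => [|i s [N IH]]; first by exists 0 => x; rewrite big_nil eqxx.
have [M FM] := FN i; exists (Order.min M N) => x; rewrite big_cons ge_min.
have [->|/FM -> //] := eqVneq (F i x) 0.
by rewrite add0r => /IH ->; rewrite orbT.
Qed.

Section DiagonalProduct.
Variables (K : fieldType) (A B W : lmodType K).
Variables (Y1 : A -> W -> int -> W) (Y2 : B -> W -> int -> W) (u : A) (v : B) (w : W).
Hypotheses (vY1 : is_vertex_map Y1) (vY2 : is_vertex_map Y2).
Hypothesis unifY : exists N : int, forall i n, Y1 u (Y2 v w i) n != 0 -> N <= n.

(** Two fields at the same variable can be multiplied only if the lower bound for the outer field is
    uniform over the infinitely many coefficients of the inner one; this is [unifY]. *)
Lemma diag_fs n : fs (fun i => Y1 u (Y2 v w i) (n - i)).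
Proof.
have [[N YN] [M YM]] := (unifY, vmap_ge vY2 v w).
apply: (@fs_int _ _ M (n - N)) => i nz; split; first exact: YM (vmap_neq0r vY1 nz).
by have := YN _ _ nz; lia.
Qed.

Lemma diag_ge : exists N, forall n, Ydiag Y1 Y2 u v w n != 0 -> N <= n.
Proof.
have [[N YN] [M YM]] := (unifY, vmap_ge vY2 v w).
exists (N + M) => n /fsum_neq0[i nz]; have := YM _ (vmap_neq0r vY1 nz).
by have := YN _ _ nz; lia.
Qed.

End DiagonalProduct.

(** * The fields of the smash product *)

Section Smash.
Variables (K : fieldType).
Variables (H V W : lmodType K) (YH : H -> H -> int -> H) (Delta : H -> tensor H H).
Variables (YV : V -> V -> int -> V) (YHV : H -> V -> int -> V).
Variables (YWH : H -> W -> int -> W) (YWV : V -> W -> int -> W).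
Hypotheses (vYH : is_vertex_map YH) (vYV : is_vertex_map YV).
Hypotheses (vYHV : is_vertex_map YHV) (vYWH : is_vertex_map YWH).
Hypotheses (vYWV : is_vertex_map YWV) (lDelta : linear Delta).
Hypothesis hU : forall h v u, exists N : int, forall i n, YV u (YHV h v i) n != 0 -> N <= n.

(* A subspace of W on which the truncation bounds of YWV are uniform. *)
Definition tame (T : W -> Prop) : Prop :=
  [/\ forall c x y, T x -> T y -> T (c *: x + y),
      forall v, exists N, forall t n, T t -> YWV v t n != 0 -> N <= n,
      forall u v n, exists N, forall t m, T t -> YWV u (YWV v t n) m != 0 -> N <= m &
      forall u v (f : series2 K),
        (forall w, exists N, bounded2 N (smul f (Ycomp YWV YWV u v w))) ->
        exists N, forall t, T t -> bounded2 N (smul f (Ycomp YWV YWV u v t))].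

Hypothesis tameH : forall h w, exists2 T, tame T & forall i, T (YWH h w i).
Hypothesis tameHH : forall h h' w, exists2 T, tame T &
  forall i j, T (YWH h (YWH h' w j) i).

Local Notation Yd := (Ydiag YWV YWH).
Local Notation Ysh := (YWsharp YWH YWV).

Lemma tame_unif v h w : exists N, forall i n, YWV v (YWH h w i) n != 0 -> N <= n.
Proof.
have [T [_ T1 _ _] TY] := tameH h w; have [N YN] := T1 v.
by exists N => i n; exact: YN (TY i).
Qed.

Lemma Ydiag_fs v h w n : fs (fun i => YWV v (YWH h w i) (n - i)).
Proof. exact: (diag_fs vYWV vYWH (tame_unif v h w) n). Qed.

Lemma Ydiag_bilin w n : bilin (fun v h => Yd v h w n).
Proof.
apply: (@bilin_fsum _ _ _ _ _ (fun i v h => YWV v (YWH h w i) (n - i))).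
  move=> i; split=> [h|v]; first exact: vmap_linl.
  by apply: (linear_comp (f := fun x => YWV v x (n - i))); [exact: vmap_linr | exact: vmap_linl].
by move=> v h; exact: Ydiag_fs.
Qed.

Lemma Ydiag_linear v h n : linear (fun w => Yd v h w n).
Proof.
apply: linear_fsum => [i|w]; last exact: Ydiag_fs.
by apply: (linear_comp (f := fun x => YWV v x (n - i))); exact: vmap_linr.
Qed.

Lemma Ydiag_ge v h w : exists N, forall n, Yd v h w n != 0 -> N <= n.
Proof. exact: (diag_ge vYWV vYWH (tame_unif v h w)). Qed.

Lemma YWsharp_tens v h w n : Ysh (v *t h) w n = Yd v h w n.
Proof. by rewrite /YWsharp tlift_tens //; exact: Ydiag_bilin. Qed.

Lemma YWsharp_vertex_map : is_vertex_map Ysh.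
Proof.
split=> [n|x w]; first split=> [w|x].
- exact: tlift_linear (Ydiag_bilin w n).
- by apply: linear_big => q; exact: Ydiag_linear.
- have [N YN] := big_ge (repr x) (g := id) (fun q => Ydiag_ge q.1 q.2 w).
  exact: in_laurentI YN.
Qed.

(* The coefficient of z^k in \sum Y_V^H(h1,z)v (x) h2. *)
Definition Tker h v (k : int) : tensor V H := tlift (fun h1 h2 => YHV h1 v k *t h2) (Delta h).

(** The part of the smash product that remains once h has acted on v: for t = v' (x) h2 it is the
    coefficient of z^k in Y(u,z)v' (x) Y(h2,z)h'. Applied to the coefficients of [Tker] it recovers
    the smash product, by [Ysmash_Theta], and its linearity in t lets presentations of [Tker] be
    inserted. *)
Definition Theta u h' (t : tensor V H) (k : int) : tensor V H :=
  tlift (fun v' h2 => tens_conv (YV u v') (YH h2 h') k) t.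

Lemma Theta_fs u h' v' h2 k : fs (fun i => YV u v' i *t YH h2 h' (k - i)).
Proof. by apply: tens_conv_fs; exact: vmap_ge. Qed.

Lemma Theta_bilin u h' k : bilin (fun v' h2 => tens_conv (YV u v') (YH h2 h') k).
Proof.
apply: bilin_fsum => [i|v' h2]; last exact: Theta_fs.
apply: (bilin_comp2 (f := fun v' => YV u v' i) (g := fun h2 => YH h2 h' (k - i))).
- exact: tens_bilin.
- exact: vmap_linr.
- exact: vmap_linl.
Qed.

Lemma Theta_tens u h' v' h2 k :
  Theta u h' (v' *t h2) k = tens_conv (YV u v') (YH h2 h') k.
Proof. by rewrite /Theta tlift_tens //; exact: Theta_bilin. Qed.

Lemma Theta_linear u h' k : linear (fun t => Theta u h' t k).
Proof. exact: tlift_linear (Theta_bilin u h' k). Qed.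

Lemma YdiagHV_fs u h v n : fs (fun i => YV u (YHV h v i) (n - i)).
Proof. exact: (diag_fs vYV vYHV (hU h v u) n). Qed.

Lemma YdiagHV_ge u h v : exists N, forall n, Ydiag YV YHV u h v n != 0 -> N <= n.
Proof. exact: (diag_ge vYV vYHV (hU h v u)). Qed.

Lemma smash_tens_fs u h v h2 h' n :
  fs (fun i => Ydiag YV YHV u h v i *t YH h2 h' (n - i)).
Proof. by apply: tens_conv_fs; [exact: YdiagHV_ge | exact: vmap_ge]. Qed.

Lemma smash_fs u h1 v h2 h' n :
  fs (fun x : int * int => YV u (YHV h1 v x.1) (x.2 - x.1) *t YH h2 h' (n - x.2)).
Proof.
have [[N YN] [M YM]] := (hU h1 v u, vmap_ge vYHV h1 v); have [L YL] := vmap_ge vYH h2 h'.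
have key k j : YV u (YHV h1 v k) (j - k) *t YH h2 h' (n - j) != 0 ->
    [/\ M <= k, N + k <= j & j <= n - L].
  move=> /tens_neq0 [nz /YL ?]; have := YN _ _ nz.
  by have := YM _ (vmap_neq0r vYV nz); split; lia.
apply: (@fs_int_pair _ _ _ M (n - L - N)) => [k j /key [] /=|k]; first by lia.
by apply: (@fs_int _ _ (N + k) (n - L)) => j /key [].
Qed.

Lemma smash_exch u h1 v h2 h' n : tens_conv (Ydiag YV YHV u h1 v) (YH h2 h') n =
  \sum_(k \in [set: int]) \sum_(j \in [set: int]) YV u (YHV h1 v k) (j - k) *t YH h2 h' (n - j).
Proof.
rewrite (fsum_exch (smash_fs u h1 v h2 h' n)); apply: eq_fsum => j.
by rewrite (lin_fsum ((tens_bilin V H).1 _)) //; exact: YdiagHV_fs.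
Qed.

Lemma smash_bilin1 u h1 h2 n :
  bilin (fun v h' => tens_conv (Ydiag YV YHV u h1 v) (YH h2 h') n).
Proof.
apply: bilin_fsum => [i|v h']; last exact: smash_tens_fs.
apply: (bilin_comp2 (f := fun v => Ydiag YV YHV u h1 v i) (g := fun h' => YH h2 h' (n - i))).
- exact: tens_bilin.
- apply: linear_fsum => [j|v]; last exact: YdiagHV_fs.
  by apply: (linear_comp (f := fun x => YV u x (i - j))); exact: vmap_linr.
- exact: vmap_linr.
Qed.

Lemma smash_trilin v h' n :
  trilin (fun u h1 h2 => tens_conv (Ydiag YV YHV u h1 v) (YH h2 h') n).
Proof.
split=> [h1 h2|u h2|u h1].
- apply: linear_fsum => [i|u]; last exact: smash_tens_fs.
  apply: (linear_comp (f := fun x => x *t _)); first exact: (tens_bilin _ _).1.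
  apply: linear_fsum => [j|u]; last exact: YdiagHV_fs.
  exact: vmap_linl.
- apply: linear_fsum => [i|h1]; last exact: smash_tens_fs.
  apply: (linear_comp (f := fun x => x *t _)); first exact: (tens_bilin _ _).1.
  apply: linear_fsum => [j|h1]; last exact: YdiagHV_fs.
  by apply: (linear_comp (f := fun x => YV u x (i - j))); [exact: vmap_linr | exact: vmap_linl].
- apply: linear_fsum => [i|h2]; last exact: smash_tens_fs.
  by apply: (linear_comp (f := fun x => _ *t x)); [exact: (tens_bilin _ _).2 | exact: vmap_linl].
Qed.

Lemma smash_bilin2 v h' n : bilin (fun u h => tlift (fun h1 h2 =>
    tens_conv (Ydiag YV YHV u h1 v) (YH h2 h') n) (Delta h)).
Proof.
have tC := smash_trilin v h' n; have [C1 C2 C3] := tC; split=> [h|u].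
  by apply: linear_big => q; exact: C1.
apply: (linear_comp (f := fun t => tlift _ t)) => //.
exact: tlift_linear (trilin_bilin1 tC u).
Qed.

Lemma Ysmash_bilin n : bilin (fun x y => Ysmash YH Delta YV YHV x y n).
Proof.
split=> [y|x]; last first.
  apply: linear_big => q; apply: tlift_linear; apply: bilin_big => r.
  exact: smash_bilin1.
apply: tlift_linear; apply: bilin_big => q; exact: smash_bilin2.
Qed.

Lemma Ysmash_vertex_map : is_vertex_map (Ysmash YH Delta YV YHV).
Proof.
split=> [n|x y]; first exact: Ysmash_bilin.
have [|N NP] := @big_ge _ _ int (repr x) (fun p n => tlift (fun v h' =>
    tlift (fun h1 h2 => tens_conv (Ydiag YV YHV p.1 h1 v) (YH h2 h') n) (Delta p.2)) y) id.
  move=> [u h]; apply: (@big_ge _ _ int (repr y) (fun q n =>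
    tlift (fun h1 h2 => tens_conv (Ydiag YV YHV u h1 q.1) (YH h2 q.2) n) (Delta h)) id).
  move=> [v h']; apply: (@big_ge _ _ int (repr (Delta h)) (fun p n =>
    tens_conv (Ydiag YV YHV u p.1 v) (YH p.2 h') n) id) => -[h1 h2].
  have [[N YN] [M YM]] := (YdiagHV_ge u h1 v, vmap_ge vYH h2 h').
  by exists (N + M) => n; exact: tens_conv_ge.
exact: in_laurentI NP.
Qed.

Lemma Ysmash_tens u h v h' n : Ysmash YH Delta YV YHV (u *t h) (v *t h') n =
  tlift (fun h1 h2 => tens_conv (Ydiag YV YHV u h1 v) (YH h2 h') n) (Delta h).
Proof.
rewrite /Ysmash tlift_tens; last by apply: bilin_big => q; exact: smash_bilin2.
by rewrite tlift_tens //; apply: bilin_big => q; exact: smash_bilin1.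
Qed.

Lemma Theta_Tker u h' h v k n : Theta u h' (Tker h v k) n =
  tlift (fun h1 h2 => tens_conv (YV u (YHV h1 v k)) (YH h2 h') n) (Delta h).
Proof.
rewrite /Tker (lin_tlift _ _ (Theta_linear u h' n)).
by apply: eq_tlift => h1 h2; rewrite Theta_tens.
Qed.

Lemma Theta_Tker_ge u h' h v : exists N, forall k n, Theta u h' (Tker h v k) n != 0 -> N <= n.
Proof.
have [|N NP] := @big_ge _ _ (int * int) (repr (Delta h))
  (fun q kn => tens_conv (YV u (YHV q.1 v kn.1)) (YH q.2 h') kn.2) snd.
  move=> q; have [N YN] := hU q.1 v u; have [M YM] := vmap_ge vYH q.2 h'.
  by exists (N + M) => -[k n]; apply: tens_conv_ge => // i; exact: YN.
by exists N => k n; rewrite Theta_Tker; exact: (NP (k, n)).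
Qed.

Lemma Tker_ge h v : exists N, forall k, Tker h v k != 0 -> N <= k.
Proof.
apply: (@big_ge _ _ int (repr (Delta h)) (fun q k => YHV q.1 v k *t q.2) id) => q.
by have [N YN] := vmap_ge vYHV q.1 v; exists N => k /tens_neq0 [/YN].
Qed.

Lemma Theta_Tker_fs u h' h v n : fs (fun k => Theta u h' (Tker h v k) (n - k)).
Proof.
have [N NP] := Theta_Tker_ge u h' h v; have [M MP] := Tker_ge h v.
apply: (@fs_int _ _ M (n - N)) => k nz; split.
  by apply: MP; exact: (lin_neq0 (Theta_linear u h' (n - k))) nz.
by have := NP _ _ nz; lia.
Qed.

Lemma Ysmash_Theta u h v h' n : Ysmash YH Delta YV YHV (u *t h) (v *t h') n =
  \sum_(k \in [set: int]) Theta u h' (Tker h v k) (n - k).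
Proof.
rewrite Ysmash_tens; under [RHS]eq_fsum => k do rewrite Theta_Tker.
have e k h1 h2 : tens_conv (YV u (YHV h1 v k)) (YH h2 h') (n - k) =
    \sum_(j \in [set: int]) YV u (YHV h1 v k) (j - k) *t YH h2 h' (n - j).
  rewrite [RHS](@fsum_reindex _ _ _ (fun i : int => i + k) (fun i => i - k)).
  - by apply: eq_fsum => i; rewrite addrK -addrA -opprD [k + i]addrC.
  - by move=> i; rewrite addrK.
  - by move=> i; rewrite subrK.
under [RHS]eq_fsum => k do under eq_tlift => h1 h2 do rewrite e.
rewrite /tlift [RHS]fsum_big => [|q]; last exact: fs_fst (smash_fs u q.1 v q.2 h' n).
by apply: eq_bigr => q _; rewrite smash_exch.
Qed.

Variable a : laurent (laurent K).

(* f Y_W^H(h,x1) Y_W^V(v,x2) = \sum_r g_r Y_W^V(u_r,x2) Y_W^H(h_r,x1), where r *)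
(* is encoded as (u_r, h_r, g_r).                                            *)
Definition series_pres h v (f : series2 K) (s : seq (V * H * series2 K)) : Prop :=
  (forall w, smul f (Ycomp YWH YWV h v w) =
     (fun m n => \sum_(r <- s) smul r.2 (fun i j => YWV r.1.1 (YWH r.1.2 w i) j) m n)) /\
  (forall k l, \sum_(r <- s) s2eval a r.2 k l *: (r.1.1 *t r.1.2) =
     smul (s2eval a f) (fun i => delta0 (Tker h v i)) k l).

(* The product of fields before (G0) and after (G1) moving the field of h past *)
(* the field of v.                                                            *)
Definition G0 u h v h' w : int -> int -> int -> int -> W :=
  fun i j m n => YWV u (YWH h (YWV v (YWH h' w j) n) i) m.

Definition G1 u h v h' w : int -> int -> int -> int -> W :=
  fun i j m n => YWV u (YWV v (YWH h (YWH h' w j) i) n) m.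

Lemma G0_cone u h v h' w : cone12 (G0 u h v h' w).
Proof.
have [J JP] := vmap_ge vYWH h' w; have [T [_ T1 _ _] TY] := tameH h' w.
have [N NP] := T1 v.
have jn i j m n : G0 u h v h' w i j m n != 0 -> J <= j /\ N <= n.
  move=> /(vmap_neq0r vYWV) /(vmap_neq0r vYWH) nz; split.
    exact: JP (vmap_neq0r vYWV nz).
  exact: NP (TY j) nz.
split=> [|M].
  by exists (Order.min J N) => i j m n /jn []; lia.
have [||L LP] := @unif_range2 (fun j n L => forall i m, G0 u h v h' w i j m n != 0 ->
  L <= i /\ L <= m) (Order.min J N) M.
- move=> j n; have [I IP] := vmap_ge vYWH h (YWV v (YWH h' w j) n).
  have [T' [_ T1' _ _] TY'] := tameH h (YWV v (YWH h' w j) n).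
  have [N' NP'] := T1' u; exists (Order.min I N') => i m nz.
  have := IP _ (vmap_neq0r vYWV nz); have := NP' _ _ (TY' i) nz.
  by lia.
- by move=> i j L L' LL' LP i' m /LP; lia.
- exists L => i j m n jM nM nz; have [Jj Nn] := jn _ _ _ _ nz.
  by apply: LP nz; lia.
Qed.

Lemma Ycomp_sharp u h v h' w :
  Ycomp Ysh Ysh (u *t h) (v *t h') w = conv2 (G0 u h v h' w).
Proof.
apply/funext => m; apply/funext => n.
rewrite /Ycomp !YWsharp_tens.
transitivity (\sum_(i \in [set: int]) \sum_(j \in [set: int]) G0 u h v h' w i j (m - i) (n - j)).
  apply: eq_fsum => i; rewrite (lin_fsum (vmap_linr vYWH h i)); last exact: Ydiag_fs.
  rewrite (lin_fsum (vmap_linr vYWV u (m - i))) //.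
  by apply: (lin_fs (vmap_linr vYWH h i)); exact: Ydiag_fs.
rewrite /conv2 fsum_pair //.
exact: conv2_fs12 (G0_cone u h v h' w).
Qed.

(** Here the vector under the fields of V has two free exponents: the bound on n must hold for all i
    and j, and that on m, once n is given, for all i. These are the second and third clauses of
    [tame]. *)
Lemma G1_cone u h v h' w : cone12 (G1 u h v h' w).
Proof.
have [T [_ T1 T2 _] TY] := tameHH h h' w.
have [J JP] := vmap_ge vYWH h' w; have [N NP] := T1 v.
have jn i j m n : G1 u h v h' w i j m n != 0 -> J <= j /\ N <= n.
  move=> /(vmap_neq0r vYWV) nz; split; last exact: NP (TY i j) nz.
  exact: JP (vmap_neq0r vYWH (vmap_neq0r vYWV nz)).
split=> [|M].
  by exists (Order.min J N) => i j m n /jn []; lia.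
have [||L LP] := @unif_range2 (fun j n L => forall i m, G1 u h v h' w i j m n != 0 ->
  L <= i /\ L <= m) (Order.min J N) M.
- move=> j n; have [I IP] := vmap_ge vYWH h (YWH h' w j).
  have [N' NP'] := T2 u v n; exists (Order.min I N') => i m nz.
  have := IP _ (vmap_neq0r vYWV (vmap_neq0r vYWV nz)); have := NP' _ _ (TY i j) nz.
  by lia.
- by move=> i j L L' LL' LP i' m /LP; lia.
- exists L => i j m n jM nM nz; have [Jj Nn] := jn _ _ _ _ nz.
  by apply: LP nz; lia.
Qed.

Lemma conv2_big (I : Type) (s : seq I) (X : lmodType K)
    (G : I -> int -> int -> int -> int -> X) :
  (forall r m n, fs (fun ij : int * int => G r ij.1 ij.2 (m - ij.1) (n - ij.2))) ->
  conv2 (fun i j m n => \sum_(r <- s) G r i j m n) =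
  (fun m n => \sum_(r <- s) conv2 (G r) m n).
Proof.
move=> fG; do 2!apply/funext => ?.
by rewrite -fsum_big // => r; exact: fG.
Qed.

Lemma conv2_mid_fs (X : lmodType K) (f : laurent (laurent K))
    (G : int -> int -> int -> int -> X) m n : summable2 f G ->
  fs (fun ij : int * int =>
    smul f (fun i n => G i ij.2 (m - ij.1) n) ij.1 (n - ij.2)).
Proof.
move=> /(_ m n)[s sP].
exists [seq (x.2.1 + x.1.1, x.2.2) | x <- s] => -[i j] /fsum_neq0 [[i' j']] /=.
rewrite scaler_eq0 negb_or => /andP[f0 G0'].
apply/mapP; exists ((i', j'), (i - i', j)) => /=; last by rewrite subrK.
apply: sP => //=; apply: contraNneq G0' => <-.
by apply/eqP; congr (G _ _ _ _); lia.
Qed.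

(** In [G0] the multiplier involves only i and n, the exponents of the fields of h and v. The first
    half of [series_pres] is applied to each vector [YWH h' w j] and transported by the linear map
    [YWV u], after which the sums are reassembled. *)
Lemma smul_Ycomp_sharp u h v h' w f s : series_pres h v f s ->
  smul f (Ycomp Ysh Ysh (u *t h) (v *t h') w) =
  (fun m n => \sum_(r <- s) smul r.2 (conv2 (G1 u r.1.2 r.1.1 h' w)) m n).
Proof.
move=> [sf _]; have c1 r := summable2_cone12 r.2 (G1_cone u r.1.2 r.1.1 h' w).
rewrite Ycomp_sharp smul_conv2_mid; last exact/summable2_cone12/G0_cone.
transitivity (conv2 (fun i j m n => \sum_(r <- s)
    smul r.2 (fun i n => G1 u r.1.2 r.1.1 h' w i j m n) i n)).
  congr conv2; apply/funext => i; apply/funext => j; apply/funext => m; apply/funext => n.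
  have lu := vmap_linr vYWV u m.
  rewrite -(smul_lin _ _ lu (A := fun i n => YWH h (YWV v (YWH h' w j) n) i)); last first.
    by apply: summable1_l12; exact: (@Ycomp_l12 _ _ _ _ YWH YWV h v (YWH h' w j)).
  have -> := congr1 (fun A => A i n) (sf (YWH h' w j)).
  rewrite (lin_sum lu); apply: eq_bigr => r _.
  rewrite (smul_lin _ _ lu) //.
  apply: summable1_l21.
  exact: (@Ycomp_l21 _ _ _ _ YWV YWH r.1.1 r.1.2 (YWH h' w j) vYWV vYWH).
rewrite (@conv2_big _ s W (fun r i j m n => smul r.2 (fun i n => G1 u r.1.2 r.1.1 h' w i j m n) i n)).
  by do 2!apply/funext => ?; apply: eq_bigr => r _; rewrite smul_conv2_mid.
by move=> r m n; exact: conv2_mid_fs (c1 r).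
Qed.

Lemma cone12_smul_in (X : lmodType K) (f : series2 K) (G : int -> int -> int -> int -> X) :
  cone12 G -> cone12 (fun i j => smul f (G i j)).
Proof.
move=> [[N GN] GM]; have [L fL] := series2P f; split.
  exists (Order.min N (N + L)) => i j m n /fsum_neq0[x].
  by rewrite scaler_eq0 negb_or => /andP[/fL ? /GN]; lia.
move=> M; have [N' GN'] := GM (Order.max M (M - L)); exists (Order.min N' (N' + L)).
move=> i j m n jM nM /fsum_neq0[x]; rewrite scaler_eq0 negb_or => /andP[/fL ? nz].
by have [||? ?] := GN' _ _ _ _ _ _ nz; lia.
Qed.

Lemma cone21_smul_in (X : lmodType K) (f : laurent (laurent K))
    (G : int -> int -> int -> int -> X) :
  cone21 G -> cone21 (fun i j => smul f (G i j)).
Proof.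
move=> [[N GN] GM]; have [[L fL] fM] := laurent2_l21 f; split.
  exists (Order.min N (N + L)) => i j m n /fsum_neq0[x].
  by rewrite scaler_eq0 negb_or => /andP[/fL ? /GN]; lia.
move=> M; have [N' GN'] := GM (Order.max M (M - L)).
have [L' fL'] := fM (M - N); exists (Order.min N' (N' + L')).
move=> i j m n iM mM /fsum_neq0[x]; rewrite scaler_eq0 negb_or => /andP[f0 nz].
have f1 := fL _ _ f0; have [? ?] := GN _ _ _ _ nz.
have [||? ?] := GN' _ _ _ _ _ _ nz; [lia|lia|].
by have := fL' _ _ _ f0; lia.
Qed.

Lemma smul_linear (U X : lmodType K) (f : laurent (laurent K)) (A : U -> int -> int -> X) m n :
  (forall t, summable1 f (A t)) -> (forall i j, linear (fun t => A t i j)) ->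
  linear (fun t => smul f (A t) m n).
Proof.
move=> sA lA; apply: linear_fsum => [x|t]; last exact: sA.
by move=> c s t; rewrite lA scalerDr !scalerA mulrC.
Qed.

Lemma tame_fsum (I : choiceType) T (F : I -> W) (i0 : I) : tame T ->
  (forall i, T (F i)) -> fs F -> T (\sum_(i \in [set: I]) F i).
Proof.
move=> [Tlin _ _ _] TF /fs_finite[s us Fs]; rewrite (fsumE us Fs).
have TZ : T 0 by have := Tlin (- 1) _ _ (TF i0) (TF i0); rewrite scaleN1r addNr.
elim: (s) => [|i r IH]; rewrite ?big_nil ?big_cons //.
by have := Tlin 1 _ _ (TF i) IH; rewrite scale1r.
Qed.

Lemma tame_scale T c x : tame T -> T x -> T (c *: x).
Proof.
move=> [Tlin _ _ _] Tx; have TZ : T 0 by have := Tlin (- 1) _ _ Tx Tx; rewrite scaleN1r addNr.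
by have := Tlin c _ _ Tx TZ; rewrite addr0.
Qed.

Hypotheses (ra : regular (exprz a)) (a0 : a != 0).

(** In [G1] the two fields of H stand together on the right and those of V on the left, so [f3]
    clears the inner pair and [f2] the outer one. The cleared outer product is linear in the vector
    it is applied to, and tameness bounds it uniformly over the coefficients of the inner product.
    Hence one substitution can be performed inside the other, and the two iterates share the
    variable z, as in [Theta]. *)
Lemma G1_wassoc u v h h' w (f2 f3 : series2 K) :
  (forall w, wassoc a (Ycomp YWV YWV u v w) f2 (fun i j => YWV (YV u v i) w j)) ->
  (forall w, wassoc a (Ycomp YWH YWH h h' w) f3 (fun i j => YWH (YH h h' i) w j)) ->
  wassoc a (conv2 (G1 u h v h' w)) (f3 * f2)
    (fun k l => Ysh (Theta u h' (v *t h) k) w l).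
Proof.
move=> wV wH; have cG := G1_cone u h v h' w.
pose E := Ycomp YWH YWH h h' w; pose B := smul f3 E.
have lE : in_l12 E by exact: (@Ycomp_l12 _ _ _ _ YWH YWH h h' w).
have [T tT TE] := tameHH h h' w; have [Tlin T1 T2 T3] := tT.
have [_ _ [N1 bB] eB] := wH w; rewrite -/E -/B in bB eB.
have [N2 bPsi] : exists N, forall t, T t -> bounded2 N (smul f2 (Ycomp YWV YWV u v t)).
  by apply: T3 => w'; case: (wV w').
pose Psi t := smul f2 (Ycomp YWV YWV u v t).
have lY t : in_l12 (Ycomp YWV YWV u v t) by exact: (@Ycomp_l12 _ _ _ _ YWV YWV u v t).
have lPsi m n : linear (fun t => Psi t m n).
  apply: smul_linear => [t|i j]; first exact: summable1_l12.
  by apply: (linear_comp (f := fun x => YWV u x i)); exact: vmap_linr.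
have sE : summable1 f3 E by exact: summable1_l12.
(* A coefficient of [B] is a finite combination of coefficients of [E], all of them in [T], so the
   bound [N2] applies to every one. *)
have TB i j : T (B i j).
  apply: (@tame_fsum _ _ _ (0, 0) tT) => [x|]; last exact: sE.
  by apply: tame_scale tT _; exact: TE.
pose N := Order.min N1 N2.
have bB' : bounded2 N B by apply: bounded2W bB; rewrite ge_min lexx.
have bPsi' i j : bounded2 N (Psi (B i j)).
  by apply: bounded2W (bPsi _ (TB i j)); rewrite ge_min lexx orbT.
have smulG : smul (f3 * f2) (conv2 (G1 u h v h' w)) = conv2 (fun i j => Psi (B i j)).
  rewrite smulA12; last exact: conv2_l12.
  rewrite smul_conv2_in; last exact: summable2_cone12.
  rewrite smul_conv2_out; last exact/summable2_cone12/cone12_smul_in.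
  congr conv2; do 4!apply/funext => ?.
  by rewrite /Psi -(smul_lin _ _ (lPsi _ _) sE).
pose Z k l := YWH (YH h h' k) w l; pose Yz t := fun m n => YWV (YV u v m) t n.
have lZ : in_l21 Z by exact: (@Yiter_l21 _ _ _ YH YWH h h' w).
have lYz t : in_l21 (Yz t) by exact: (@Yiter_l21 _ _ _ YV YWV u v t).
have cZ : cone21 (fun k l => Yz (Z k l)).
  have [N3 YN3] := vmap_ge vYH h h'; have [N4 YN4] := vmap_ge vYV u v.
  have km k l m n : Yz (Z k l) m n != 0 -> N3 <= k /\ N4 <= m.
    move=> nz; have := YN4 _ (vmap_neq0l vYWV nz).
    by have := YN3 _ (vmap_neq0l vYWH (vmap_neq0r vYWV nz)).
  split=> [|M]; first by exists (Order.min N3 N4) => k l m n /km; lia.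
  have [||L LP] := @unif_range2 (fun k m L => forall l n, Yz (Z k l) m n != 0 ->
    L <= l /\ L <= n) (Order.min N3 N4) M.
  - move=> k m; have [N5 YN5] := vmap_ge vYWH (YH h h' k) w.
    have [T' [_ T1' _ _] TY'] := tameH (YH h h' k) w.
    have [N6 YN6] := T1' (YV u v m); exists (Order.min N5 N6) => l n nz.
    have := YN5 _ (vmap_neq0r vYWV nz); have := YN6 _ _ (TY' l) nz.
    by lia.
  - by move=> i j L L' LL' LP i' m /LP; lia.
  - exists L => k l m n jM nM nz; have [? ?] := km _ _ _ _ nz.
    by apply: LP nz; lia.
have RE k l : conv2 (fun k l => Yz (Z k l)) k l = Ysh (Theta u h' (v *t h) k) w l.
  rewrite Theta_tens /tens_conv (lin_fsum (vmap_linl YWsharp_vertex_map w l)); last exact: Theta_fs.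
  have fZ := conv2_fs21 k l cZ.
  rewrite /conv2 (fsum_pair fZ).
  (* The outer index is the z-exponent of the H-factor in [conv2] and of the V-factor in
     [tens_conv]; the two add up to k. *)
  rewrite (@fsum_reindex _ _ _ (fun i : int => k - i) (fun i => k - i)); last 2 first.
  - by move=> i; lia.
  - by move=> i; lia.
  apply: eq_fsum => i; rewrite YWsharp_tens; apply: eq_fsum => j.
  by rewrite /Yz /Z /= subKr.
have lR : in_l21 (fun k l => Ysh (Theta u h' (v *t h) k) w l).
  have := conv2_l21 cZ; congr in_l21; do 2!apply/funext => ?; exact: RE.
split=> //.
- exact: conv2_l12.
- by rewrite smulG; exists (N + N); apply: conv2_bounded => i j m n nz;
    have [? ?] := bPsi' _ _ _ _ nz; have [? ?] := bB' _ _ (lin_neq0 (lPsi m n) nz); split.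
rewrite smulG subst1E (@subst_conv2 _ _ _ _ B Psi N) //; last exact: expa_add.
have -> : (fun k l => Ysh (Theta u h' (v *t h) k) w l) = conv2 (fun k l => Yz (Z k l)).
  by do 2!apply/funext => ?; rewrite RE.
rewrite s2evalM // smulA21; last exact: conv2_l21.
rewrite [in RHS]smul_conv2_in; last exact: summable2_cone21.
rewrite smul_conv2_out; last exact/summable2_cone21/cone21_smul_in.
congr conv2; apply/funext => k; apply/funext => l; apply/funext => m; apply/funext => n.
have lYzl : linear (fun t => smul (s2eval a f2) (Yz t) m n).
  apply: smul_linear => [t|i j]; first exact: summable1_l21.
  exact: vmap_linr.
rewrite -(smul_lin _ _ lYzl); last exact: summable1_l21.
have [_ _ _] := wV (gsubst (exprz a) B k l); rewrite -/(Psi _) subst1E => ->.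
by move: eB; rewrite subst1E => ->.
Qed.

Lemma Phi_linear u h' w k l : linear (fun t => Ysh (Theta u h' t k) w l).
Proof.
apply: (linear_comp (f := fun x => Ysh x w l)); last exact: Theta_linear.
exact: (vmap_linl YWsharp_vertex_map).
Qed.

Lemma Tker_l21 h v : in_l21 (fun i => delta0 (Tker h v i)).
Proof. by apply: delta0_l21; exact: Tker_ge. Qed.

Lemma Phi_cone u h' h v w :
  cone21 (fun k l m n => Ysh (Theta u h' (delta0 (Tker h v k) l) m) w n).
Proof.
have [N NP] := Tker_ge h v; have [M MP] := Theta_Tker_ge u h' h v.
have l0 k l m n : Ysh (Theta u h' (delta0 (Tker h v k) l) m) w n != 0 ->
    l = 0 /\ Ysh (Theta u h' (Tker h v k) m) w n != 0.
  rewrite /delta0; case: (eqVneq l 0) => [-> //|_].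
  by rewrite (lin_0 (Phi_linear u h' w m n)) eqxx.
have km k l m n : Ysh (Theta u h' (delta0 (Tker h v k) l) m) w n != 0 -> N <= k /\ M <= m.
  move=> /l0 [_ nz]; split; first exact: NP (lin_neq0 (Phi_linear u h' w m n) nz).
  exact: MP (vmap_neq0l YWsharp_vertex_map nz).
split=> [|B]; first by exists (Order.min N M) => k l m n /km; lia.
have [||L LP] := @unif_range2 (fun k m L => forall n,
    Ysh (Theta u h' (Tker h v k) m) w n != 0 -> L <= n) (Order.min N M) B.
- by move=> k m; exact: (vmap_ge YWsharp_vertex_map).
- by move=> i j L L' LL' LP n /LP; lia.
- exists (Order.min L 0) => k l m n kB mB nz; have [? ?] := km _ _ _ _ nz.
  have [-> {}nz] := l0 _ _ _ _ nz.
  have := LP k m _ kB _ mB _ nz; lia.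
Qed.

(** The second half of [series_pres] is an identity between coefficients in V (x) H. The linear map
    from t to the field of [Theta u h' t] turns it into one between iterates. Since [Tker] does not
    involve x2, its series enters through [delta0]. *)
Lemma smul_sharp_pres u h v h' w f s : series_pres h v f s ->
  (fun k l => \sum_(r <- s)
     smul (s2eval a r.2) (fun k l => Ysh (Theta u h' (r.1.1 *t r.1.2) k) w l) k l) =
  smul (s2eval a f) (fun i j => Ysh (Ysmash YH Delta YV YHV (u *t h) (v *t h') i) w j).
Proof.
move=> [_ sc]; pose Phi t k l := Ysh (Theta u h' t k) w l.
have lPhi k l : linear (fun t => Phi t k l) by exact: Phi_linear.
have lvYsh := vmap_linl YWsharp_vertex_map.
have PhiT v' h2 : in_l21 (Phi (v' *t h2)).
  apply: in_l21P => [|k]; last exact: (vmap_ge YWsharp_vertex_map).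
  have [[N YN] [M YM]] := (vmap_ge vYV u v', vmap_ge vYH h2 h').
  exists (N + M) => k l /(vmap_neq0l YWsharp_vertex_map).
  by rewrite Theta_tens; exact: tens_conv_ge.
have -> : (fun i j => Ysh (Ysmash YH Delta YV YHV (u *t h) (v *t h') i) w j) =
    conv2 (fun k l => Phi (delta0 (Tker h v k) l)).
  apply/funext => k; apply/funext => l.
  rewrite Ysmash_Theta (lin_fsum (lvYsh w l)); last exact: Theta_Tker_fs.
  rewrite /conv2 fsum_pair.
    apply: eq_fsum => i; rewrite (@fsum1 _ _ 0) /= => [|j /negPf j0].
      by rewrite subr0 /Phi /delta0 eqxx.
    by rewrite /delta0 j0 (lin_0 (lPhi _ _)).
  exact: conv2_fs21 (Phi_cone u h' h v w).
rewrite smul_conv2_out; last exact/summable2_cone21/Phi_cone.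
apply/funext => k; apply/funext => l.
rewrite -(@fsum_big _ _ _ s (fun r x => s2eval a r.2 x.1 x.2 *:
    Phi (r.1.1 *t r.1.2) (k - x.1) (l - x.2))).
  apply: eq_fsum => x.
  rewrite -(smul_lin _ _ (lPhi (k - x.1) (l - x.2))); last first.
    by apply: summable1_l21; exact: Tker_l21.
  rewrite -sc (lin_sum (lPhi _ _)); apply: eq_bigr => r _.
  by rewrite (lin_scale (lPhi _ _)).
move=> r; exact: (summable1_l21 (s2eval a r.2) (PhiT r.1.1 r.1.2)).
Qed.

Variable S : series2 K -> Prop.
Hypotheses (S1 : S 1) (SM : forall f g, S f -> S g -> S (f * g)).
Hypothesis wassocV : forall u v, exists2 f, S f &
  forall w, wassoc a (Ycomp YWV YWV u v w) f (fun i j => YWV (YV u v i) w j).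
Hypothesis wassocH : forall h h', exists2 f, S f &
  forall w, wassoc a (Ycomp YWH YWH h h' w) f (fun i j => YWH (YH h h' i) w j).
Hypothesis presHV : forall h v, exists2 f, S f & exists s, series_pres h v f s.

Lemma S_prod (I : Type) (s : seq I) (F : I -> series2 K) :
  (forall i, S (F i)) -> S (\prod_(i <- s) F i).
Proof. by move=> SF; elim/big_ind: _. Qed.

(** [S] is the class of admissible multipliers: units times some q(x1/x2) for the module W, powers
    of x1 - x2 for V (x) H. Moving h past v yields finitely many terms, each with its own
    multiplier; the product of these, together with [f] itself, serves for the whole. *)
Lemma smash_wassoc_tens u h v h' : exists2 f, S f & forall w,
  wassoc a (Ycomp Ysh Ysh (u *t h) (v *t h') w) f
    (fun i j => Ysh (Ysmash YH Delta YV YHV (u *t h) (v *t h') i) w j).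
Proof.
have /boolp.choice [F2 F2P] : forall v', exists f, S f /\ forall w,
    wassoc a (Ycomp YWV YWV u v' w) f (fun i j => YWV (YV u v' i) w j).
  by move=> v'; have [f Sf fP] := wassocV u v'; exists f.
have /boolp.choice [F3 F3P] : forall h2, exists f, S f /\ forall w,
    wassoc a (Ycomp YWH YWH h2 h' w) f (fun i j => YWH (YH h2 h' i) w j).
  by move=> h2; have [f Sf fP] := wassocH h2 h'; exists f.
have [f Sf [s sP]] := presHV h v.
exists (f * \prod_(r <- s) (F3 r.1.2 * F2 r.1.1)).
  by apply: SM => //; apply: S_prod => r; apply: SM; [case: (F3P r.1.2) | case: (F2P r.1.1)].
move=> w; apply: wassoc_unsmul => //.
- by apply: (Ycomp_l12 (Y1 := Ysh) (Y2 := Ysh)); exact: YWsharp_vertex_map.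
- have vY := YWsharp_vertex_map; apply: in_l21P => [|k]; last exact: (vmap_ge vY).
  have [N NP] := Theta_Tker_ge u h' h v; have [M MP] := Tker_ge h v.
  exists (M + N) => k l /(vmap_neq0l vY); rewrite Ysmash_Theta => /fsum_neq0[i nz].
  have := NP _ _ nz; have := MP _ (lin_neq0 (Theta_linear u h' (k - i)) nz).
  by lia.
rewrite (smul_Ycomp_sharp u h' w sP) -(smul_sharp_pres u h' w sP).
apply: (@wassoc_big _ _ _ ra a0 _ s (fun r m n => smul r.2 (conv2 (G1 u r.1.2 r.1.1 h' w)) m n)
  (fun r k l => smul (s2eval a r.2) (fun k l => Ysh (Theta u h' (r.1.1 *t r.1.2) k) w l) k l)).
move=> r; apply: wassoc_smul => //; apply: G1_wassoc => w'.
  by case: (F2P r.1.1).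
by case: (F3P r.1.2).
Qed.

Lemma smash_wassoc x y : exists2 f, S f & forall w,
  wassoc a (Ycomp Ysh Ysh x y w) f
    (fun i j => Ysh (Ysmash YH Delta YV YHV x y i) w j).
Proof.
have /boolp.choice [F FP] : forall pq : (V * H) * (V * H), exists f, S f /\ forall w,
    wassoc a (Ycomp Ysh Ysh (pq.1.1 *t pq.1.2) (pq.2.1 *t pq.2.2) w) f
    (fun i j => Ysh (Ysmash YH Delta YV YHV (pq.1.1 *t pq.1.2) (pq.2.1 *t pq.2.2) i) w j).
  by case=> -[u h] [v h']; have [f Sf fP] := smash_wassoc_tens u h v h'; exists f.
exists (\prod_(p <- repr x) \prod_(q <- repr y) F (p, q)).
  by apply: S_prod => p; apply: S_prod => q; case: (FP (p, q)).
have [lYl lYr] := (vmap_linl YWsharp_vertex_map, vmap_linr YWsharp_vertex_map).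
move=> w.
pose A (p q : V * H) := Ycomp Ysh Ysh (p.1 *t p.2) (q.1 *t q.2) w.
pose R (p q : V * H) i j := Ysh (Ysmash YH Delta YV YHV (p.1 *t p.2) (q.1 *t q.2) i) w j.
apply: (@wassoc_ext _ _ _ (fun m n => \sum_(p <- repr x) \sum_(q <- repr y) A p q m n) _ _
  (fun m n => \sum_(p <- repr x) \sum_(q <- repr y) R p q m n)).
- move=> m n; rewrite [in RHS]/Ycomp [x in RHS]tensE (lin_sum (lYl _ m)).
  apply: eq_bigr => p _; rewrite [y in RHS]tensE (lin_sum (lYl w n)) (lin_sum (lYr _ m)).
  by [].
- move=> i j; have [bl br] := Ysmash_bilin i.
  rewrite [x in RHS]tensE (lin_sum (bl y)) (lin_sum (lYl w j)).
  apply: eq_bigr => p _; rewrite [y in RHS]tensE (lin_sum (br _)) (lin_sum (lYl w j)).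
  by [].
apply: (@wassoc_big _ _ _ ra a0 _ (repr x) (fun p m n => \sum_(q <- repr y) A p q m n)
  (fun p m n => \sum_(q <- repr y) R p q m n) (fun p => \prod_(q <- repr y) F (p, q))) => p.
by apply: (@wassoc_big _ _ _ ra a0 _ (repr y) (A p) (R p) (fun q => F (p, q))) => q; exact: (FP (p, q)).2 w.
Qed.

End Smash.

(** * Subspaces with uniform truncation bounds *)

Section TameSpan.
Variables (K : fieldType) (V W : lmodType K) (YWV : V -> W -> int -> W).
Hypothesis vYWV : is_vertex_map YWV.

Definition vendo (g : W -> W) : Prop :=
  linear g /\ forall v w n, g (YWV v w n) = YWV v (g w) n.

(* The submodule generated by s under the endomorphisms of the YWV-module W. *)
Definition endo_span (s : seq W) (t : W) : Prop := forall P : W -> Prop,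
  P 0 -> (forall x y, P x -> P y -> P (x + y)) ->
  (forall g w, w \in s -> vendo g -> P (g w)) -> P t.

Lemma endo_span0 s : endo_span s 0. Proof. by []. Qed.

Lemma endo_spanD s x y : endo_span s x -> endo_span s y -> endo_span s (x + y).
Proof. by move=> sx sy P P0 PD Pg; exact: (PD _ _ (sx P P0 PD Pg) (sy P P0 PD Pg)). Qed.

Lemma endo_span_gen s g w : w \in s -> vendo g -> endo_span s (g w).
Proof. by move=> ws vg P P0 PD Pg; exact: Pg. Qed.

Lemma vendo_scale c g : vendo g -> vendo (fun w => c *: g w).
Proof.
move=> [lg cg]; split=> [a x y|v w n]; first by rewrite lg scalerDr !scalerA mulrC.
by rewrite cg (lin_scale (vmap_linr vYWV v n)).
Qed.

Lemma endo_spanZ s c x : endo_span s x -> endo_span s (c *: x).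
Proof.
move=> sx; apply: (sx (fun t => endo_span s (c *: t))) => [|x' y' sx' sy'|g w ws vg].
  by rewrite scaler0.
  by rewrite scalerDr; exact: endo_spanD.
exact: (endo_span_gen ws (vendo_scale c vg)).
Qed.

Lemma seq_unif (T : eqType) (s : seq T) (P : T -> int -> Prop) :
  (forall x, exists N, P x N) -> (forall x N M, M <= N -> P x N -> P x M) ->
  exists N, forall x, x \in s -> P x N.
Proof.
move=> exP monP; elim: s => [|x s [N IH]]; first by exists 0.
have [M MP] := exP x; exists (Order.min M N) => y; rewrite inE => /predU1P[->|/IH].
  by apply: monP MP; rewrite ge_min lexx.
by apply: monP; rewrite ge_min lexx orbT.
Qed.

(** A bound valid at w holds at g w for every g that commutes with the fields of V, and a common
    bound survives addition; so the finitely many generators determine it. *)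
Lemma endo_span_tame s : tame YWV (endo_span s).
Proof.
have nzD (x y : W) : x + y != 0 -> x != 0 \/ y != 0.
  by have [->|] := eqVneq x 0; [rewrite add0r; right | left].
split.
- by move=> c x y sx sy; apply: endo_spanD => //; exact: endo_spanZ.
- move=> v; have [||N NP] := @seq_unif _ s (fun w N => forall n, YWV v w n != 0 -> N <= n).
  + exact: vmap_ge.
  + by move=> x N M MN NP n /NP; lia.
  + exists N => t n st; apply: (st (fun t => YWV v t n != 0 -> N <= n)).
      by rewrite (vmap0r vYWV) eqxx.
      by move=> x y Px Py; rewrite (lin_add (vmap_linr vYWV v n)) => /nzD [/Px|/Py].
    by move=> g w ws [lg cg]; rewrite -cg => nz; exact: NP _ ws _ (lin_neq0 lg nz).
- move=> u v n; have [||N NP] := @seq_unif _ s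
    (fun w N => forall m, YWV u (YWV v w n) m != 0 -> N <= m).
  + by move=> w; exact: vmap_ge.
  + by move=> x N M MN NP m /NP; lia.
  + exists N => t m st; apply: (st (fun t => YWV u (YWV v t n) m != 0 -> N <= m)).
      by rewrite !(vmap0r vYWV) eqxx.
      move=> x y Px Py; rewrite (lin_add (vmap_linr vYWV v n)).
      by rewrite (lin_add (vmap_linr vYWV u m)) => /nzD [/Px|/Py].
    by move=> g w ws [lg cg]; rewrite -!cg => nz; exact: NP _ ws _ (lin_neq0 lg nz).
- move=> u v f fb; have [||N NP] := @seq_unif _ s
    (fun w N => bounded2 N (smul f (Ycomp YWV YWV u v w))) => //.
    by move=> x N M MN; exact: bounded2W.
  have lY w : in_l12 (Ycomp YWV YWV u v w) by exact: (@Ycomp_l12 _ _ _ _ YWV YWV u v w).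
  have lin m n : linear (fun w => Ycomp YWV YWV u v w m n).
    by apply: (linear_comp (f := fun x => YWV u x m)); exact: vmap_linr.
  exists N => t st; apply: (st (fun t => bounded2 N (smul f (Ycomp YWV YWV u v t)))).
  + have -> : Ycomp YWV YWV u v 0 = (fun _ _ => 0).
      by do 2!apply/funext => ?; rewrite (lin_0 (lin _ _)).
    by rewrite smul_zero => m n; rewrite eqxx.
  + move=> x y Px Py.
    have -> : Ycomp YWV YWV u v (x + y) =
        (fun m n => Ycomp YWV YWV u v x m n + Ycomp YWV YWV u v y m n).
      by do 2!apply/funext => ?; rewrite (lin_add (lin _ _)).
    rewrite smulDr; try exact: summable1_l12.
    exact: bounded2D.
  + move=> g w ws [lg cg] m n.
    have -> : Ycomp YWV YWV u v (g w) = (fun m n => g (Ycomp YWV YWV u v w m n)).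
      by do 2!apply/funext => ?; rewrite /Ycomp !cg.
    rewrite -(smul_lin _ _ lg); last exact: summable1_l12.
    by move=> nz; exact: NP _ ws _ _ (lin_neq0 lg nz).
Qed.

End TameSpan.

Lemma smul_delta (K : fieldType) (X : lmodType K) (f : laurent (laurent K))
    (T : int -> X) k l :
  smul f (fun i => delta0 (T i)) k l = \sum_(i \in [set: int]) f i l *: T (k - i).
Proof.
rewrite /smul; have pE : forall ij : int * int,
    f ij.1 ij.2 *: delta0 (T (k - ij.1)) (l - ij.2) =
    if ij.2 == l then f ij.1 l *: T (k - ij.1) else 0.
  by case=> i j /=; rewrite /delta0 subr_eq0 eq_sym; case: eqP => [->|_]; rewrite ?scaler0.
under eq_fsum => ij do rewrite pE.
pose F i := f i l *: T (k - i).
rewrite -(fsbig_widen [set ij : int * int | ij.2 = l]%classic [set: int * int]) //; last first.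
  by move=> [i j] [_ /= jl]; case: eqP => // /jl.
rewrite (@reindex_fsbig _ _ _ _ _ (fun i : int => (i, l)) [set: int]%classic).
  by apply: eq_fsum => i; rewrite /= eqxx.
split=> [i _ //|i j _ _ [] //|[i j] /= jl]; exists i => //.
by rewrite -jl.
Qed.

Lemma closed_big (W : zmodType) (L : (int -> int -> W) -> Prop) (I : Type) (s : seq I)
    (F : I -> int -> int -> W) :
  L (fun _ _ => 0) -> (forall A B, L A -> L B -> L (fun m n => A m n + B m n)) ->
  (forall i, L (F i)) -> L (fun m n => \sum_(i <- s) F i m n).
Proof.
move=> L0 LD LF; elim: s => [|i s IH].
  by under eq_fun do under eq_fun do rewrite big_nil.
by under eq_fun do under eq_fun do rewrite big_cons; exact: LD.
Qed.

(** * Moving a field of H past a field of V after clearing poles *)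

Section LocalPresentation.
Variables (K : fieldType) (a : laurent (laurent K)).
Hypotheses (ra : regular (exprz a)) (a0 : a != 0).
Variables (H V W : lmodType K) (Delta : H -> tensor H H) (YHV : H -> V -> int -> V).
Variables (YWH : H -> W -> int -> W) (YWV : V -> W -> int -> W).
Hypotheses (vYHV : is_vertex_map YHV) (vYWH : is_vertex_map YWH) (vYWV : is_vertex_map YWV).
Variables (S : series2 K -> Prop).
Hypotheses (S1 : S 1) (SM : forall f g, S f -> S g -> S (f * g)).
Variables (h : H) (v : V) (C : H -> H -> W -> int -> int -> W).
Hypothesis CE : forall w m n, YWH h (YWV v w n) m = tlift (fun h1 h2 => C h1 h2 w m n) (Delta h).
Variable L : (int -> int -> W) -> Prop.
Hypotheses (L0 : L (fun _ _ => 0)).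
Hypothesis LD : forall A B, L A -> L B -> L (fun m n => A m n + B m n).
Hypothesis LA : forall (f g : series2 K) A, L A -> smul (f * g) A = smul f (smul g A).
Hypothesis Ls : forall (f : series2 K) A, L A -> summable1 f A.
Hypothesis LC : forall h1 h2 w, L (C h1 h2 w).
Hypothesis local : forall h1 h2, exists2 Q, S Q & exists s : seq (V * series2 K),
  (forall w, smul Q (C h1 h2 w) =
     (fun m n => \sum_(r <- s) smul r.2 (fun i j => YWV r.1 (YWH h2 w i) j) m n)) /\
  (forall k l, \sum_(r <- s) s2eval a r.2 k l *: r.1 =
     smul (s2eval a Q) (fun i => delta0 (YHV h1 v i)) k l).

(** [local] treats one term of the coproduct, and the product of the multipliers serves for their
    sum. [L] is the region of the commuted products: W((x2))((x1)) for the module W, because of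
    iota_{x2,x1}, and W((x1))((x2)) for V (x) H, where powers of x1 - x2 are expanded in nonnegative
    powers of x2. *)
Lemma pres_of_local : exists2 f, S f & exists s, series_pres Delta YHV YWH YWV a h v f s.
Proof.
pose A (r : V * H) w i j := YWV r.1 (YWH r.2 w i) j.
have lA r w : in_l21 (A r w) by exact: (@Ycomp_l21 _ _ _ _ YWV YWH).
pose TT (l : seq (H * H)) k : tensor V H := \sum_(p <- l) YHV p.1 v k *t p.2.
have lT l : in_l21 (fun i => delta0 (TT l i)).
  apply: delta0_l21; apply: (@big_ge _ _ int l (fun p k => YHV p.1 v k *t p.2) id) => p.
  by have [N NP] := vmap_ge vYHV p.1 v; exists N => k /tens_neq0 [/NP].
suff main (l : seq (H * H)) : exists2 f, S f & exists s : seq (V * H * series2 K),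
    (forall w, smul f (fun m n => \sum_(p <- l) C p.1 p.2 w m n) =
       (fun m n => \sum_(r <- s) smul r.2 (A r.1 w) m n)) /\
    (forall k j, \sum_(r <- s) s2eval a r.2 k j *: (r.1.1 *t r.1.2) =
       smul (s2eval a f) (fun i => delta0 (TT l i)) k j).
  have [f Sf [s [sC sT]]] := main (repr (Delta h)).
  exists f => //; exists s; split=> // w; rewrite -[RHS]sC; congr (smul _ _).
  by apply/funext => m; apply/funext => n; exact: CE.
elim: l => [|[h1 h2] l [f Sf [s [sC sT]]]].
  exists 1 => //; exists [::]; split=> [w|k j].
    by rewrite smul1; do 2!apply/funext => ?; rewrite !big_nil.
  rewrite big_nil smul_delta fsum0 // => i.
  by rewrite /TT big_nil scaler0.
have [Q SQ [s' [sC' sT']]] := local h1 h2.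
(* Under the common multiplier each of the two lists acquires the multiplier of the other. *)
exists (Q * f); first exact: SM.
exists ([seq (r.1, h2, f * r.2) | r <- s'] ++ [seq (r.1, Q * r.2) | r <- s]).
split=> [w|k j].
  pose CS m n := \sum_(p <- l) C p.1 p.2 w m n.
  have LCS : L CS by exact: (@closed_big _ L _ l (fun p => C p.1 p.2 w)).
  have -> : (fun m n => \sum_(p <- (h1, h2) :: l) C p.1 p.2 w m n) =
      (fun m n => C h1 h2 w m n + CS m n).
    by do 2!apply/funext => ?; rewrite big_cons.
  rewrite smulDr; [|exact: Ls|exact: Ls].
  rewrite (LA _ _ LCS) [Q * f]mulrC LA // sC' /CS sC.
  rewrite !smul_sum; first last.
  - by move=> r; apply: summable1_l21; apply: smul_l21; exact: (lA (r.1, h2)).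
  - by move=> r; apply: summable1_l21; apply: smul_l21; exact: lA.
  do 2!apply/funext => ?; rewrite big_cat !big_map /=; congr (_ + _); apply: eq_bigr => r _.
    by rewrite -smulA21 //; exact: (lA (r.1, h2)).
  by rewrite -smulA21 //; exact: lA.
have TfgZ (X : lmodType K) (f1 g1 : series2 K) (x : X) : (fun k j => s2eval a (f1 * g1) k j *: x) =
    smul (s2eval a f1) (fun k j => s2eval a g1 k j *: x).
  do 2!apply/funext => ?; rewrite s2evalM // lcoef2M.
  rewrite (fsum_morph (g := fun c => c *: x)); last exact: fs_lcoef2M.
    by apply: eq_fsum => y; rewrite scalerA.
  by move=> c d; rewrite scalerDl.
have lZ (X : lmodType K) (g1 : series2 K) (x : X) : in_l21 (fun k j => s2eval a g1 k j *: x).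
  have [[N gN] gM] := laurent2_l21 (s2eval a g1); split=> [|M].
    by exists N => m n; rewrite scaler_eq0 negb_or => /andP[/gN].
  by have [N' gN'] := gM M; exists N' => m n mM; rewrite scaler_eq0 negb_or => /andP[/(gN' _ _ mM)].
have lY : in_l21 (fun i => delta0 (YHV h1 v i)) by apply: delta0_l21; exact: vmap_ge.
have lh2 : linear (fun x : V => x *t h2) by exact: (tens_bilin V H).1.
have -> : (fun i => delta0 (TT ((h1, h2) :: l) i)) =
    (fun i j => delta0 (YHV h1 v i) j *t h2 + delta0 (TT l i) j).
  apply/funext => i'; apply/funext => j'; rewrite /delta0 /TT big_cons.
  by case: ifP => _ //; rewrite (lin_0 lh2) addr0.
have lYh2 : in_l21 (fun i j => delta0 (YHV h1 v i) j *t h2).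
  have [[N NP] NM] := lY; split=> [|M].
    by exists N => m n /(lin_neq0 lh2) /NP.
  by have [N' NP'] := NM M; exists N' => m n mM /(lin_neq0 lh2) /(NP' _ _ mM).
rewrite smulDr; [|exact: summable1_l21|exact: summable1_l21].
rewrite big_cat !big_map /=; congr (_ + _).
  rewrite [Q * f]mulrC s2evalM // smulA21 //.
  transitivity (\sum_(r <- s') smul (s2eval a f) (fun k j => s2eval a r.2 k j *: (r.1 *t h2)) k j).
    by apply: eq_bigr => r _; rewrite -TfgZ.
  have := congr1 (fun A => A k j) (@smul_sum _ _ _ (s2eval a f) s'
    (fun r k j => s2eval a r.2 k j *: (r.1 *t h2)) (fun r => summable1_l21 _ (lZ _ _ _))).
  move=> /= <-; congr (smul _ _ k j); apply/funext => k'; apply/funext => j'.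
  rewrite -(smul_lin _ _ lh2); last exact: summable1_l21.
  by rewrite -sT' (lin_sum lh2); apply: eq_bigr => r _; rewrite (lin_scale lh2).
rewrite s2evalM // smulA21 //.
transitivity (\sum_(r <- s) smul (s2eval a Q) (fun k j => s2eval a r.2 k j *: (r.1.1 *t r.1.2)) k j).
  by apply: eq_bigr => r _; rewrite -TfgZ.
have := congr1 (fun A => A k j) (@smul_sum _ _ _ (s2eval a Q) s
  (fun r k j => s2eval a r.2 k j *: (r.1.1 *t r.1.2)) (fun r => summable1_l21 _ (lZ _ _ _))).
move=> /= <-; congr (smul _ _ k j); apply/funext => k'; apply/funext => j'.
exact: sT.
Qed.

End LocalPresentation.

Section TensorSeries.
Variable K : fieldType.

Lemma tens_series_bilin (W : lmodType K) n :
  bilin (fun (w : W) (f : laurent K) => f n *: w).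
Proof.
split=> [f a x y|w a f g]; first by rewrite scalerDr !scalerA mulrC.
by rewrite lcoefD lcoefZ scalerDl scalerA.
Qed.

Lemma tens_series_of (W : lmodType K) (s : seq (W * laurent K)) n :
  tens_series (tens_of s) n = \sum_(q <- s) q.2 n *: q.1.
Proof. exact: (tlift_of _ (tens_series_bilin W n)). Qed.

Lemma in_tens_laurent_sum (W : lmodType K) P (f : int -> W) : in_tens_laurent P f ->
  exists2 s : seq (W * laurent K), forall q, q \in s -> P q.2 &
    forall n, f n = \sum_(q <- s) q.2 n *: q.1.
Proof.
by case=> t [s sP ->] ->; exists s => // n; rewrite tens_series_of.
Qed.

(** Membership in V (x) C((x)) confines all coefficients to the span of finitely many vectors, and
    the least of their bounds serves for all. *)
Lemma tens_laurent_unif (V U : lmodType K) (Y : U -> V -> int -> V) P (f : int -> V) u :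
  is_vertex_map Y -> in_tens_laurent P f ->
  exists N, forall i n, Y u (f i) n != 0 -> N <= n.
Proof.
move=> vY /in_tens_laurent_sum [s _ fE].
have [|N NP] := @big_ge _ _ (int * int) s (fun q x => q.2 x.1 *: Y u q.1 x.2) snd.
  move=> q; have [N YN] := vmap_ge vY u q.1; exists N => -[i n] /=.
  by rewrite scaler_eq0 negb_or => /andP[_ /YN].
exists N => i n; rewrite fE (lin_sum (vmap_linr vY u n)).
under eq_bigr => q _ do rewrite (lin_scale (vmap_linr vY u n)).
exact: (NP (i, n)).
Qed.

End TensorSeries.

Lemma sub_inv_factor (R : comNzRingType) (w w' c e : R) :
  w * w' = 1 -> c * e = 1 -> w - c = - c * w * (w' - e).
Proof.
move=> ww' ce; rewrite mulrBr -mulrA ww' mulr1 mulrAC mulNr ce mulN1r opprK.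
by rewrite addrC.
Qed.

Lemma divr_mul_divr (R : comUnitRingType) (x y : R) :
  x \is a GRing.unit -> y \is a GRing.unit -> y / x * (x / y) = 1.
Proof. by move=> ux uy; rewrite mulrA divrK // divrr. Qed.

(** * Multipliers q(x1/x2) up to units *)

Section Monomials.
Variable K : fieldType.
Hypothesis char0 : forall n : nat, n.+1%:R != 0 :> K.

Lemma s2_ext (f g : series2 K) : (forall m n, f m n = g m n) -> f = g.
Proof.
by move=> fg; apply: val_inj; apply: laurent_ext => m; apply: laurent_ext => n; exact: fg.
Qed.

Lemma s2coefM (f g : series2 K) m n : (f * g) m n =
  \sum_(x \in [set: int * int]) f x.1 x.2 * g (m - x.1) (n - x.2).
Proof. exact: (lcoef2M (f : laurent (laurent K)) g). Qed.

Lemma s2coefC (c : K) m n : s2const c m n = if (m == 0) && (n == 0) then c else 0.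
Proof. by rewrite /= /delta0; case: (m == 0). Qed.

Lemma s2coefCM (c : K) (f : series2 K) m n : (s2const c * f) m n = c * f m n.
Proof.
rewrite s2coefM (@fsum1 _ _ (0, 0)) => [|[i j] /negPf ij].
  by rewrite s2coefC !subr0.
by rewrite s2coefC ifN ?mul0r // -xpair_eqE ij.
Qed.

Lemma s2in1_mono m n : s2in1 (mono K m) * s2in1 (mono K n) = s2in1 (mono K (m + n)).
Proof.
apply: s2_ext => i j; rewrite s2coefM (@fsum1 _ _ (m, 0)) => [|[k l] kl].
  by rewrite !s2in1E !monoE !eqxx mul1r subr0 subr_eq [n + m]addrC.
rewrite s2in1E monoE /=; have [l0|_] := eqVneq l 0; last by rewrite mul0r.
by have [k0|_] := eqVneq k m; [rewrite k0 l0 eqxx in kl | rewrite mul0r].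
Qed.

Lemma s2in2_mono m n : s2in2 (mono K m) * s2in2 (mono K n) = s2in2 (mono K (m + n)).
Proof.
apply: s2_ext => i j; rewrite s2coefM (@fsum1 _ _ (0, m)) => [|[k l] kl].
  by rewrite !s2in2E !monoE !eqxx mul1r subr0 subr_eq [n + m]addrC.
rewrite s2in2E monoE /=; have [k0|_] := eqVneq k 0; last by rewrite mul0r.
by have [l0|_] := eqVneq l m; [rewrite k0 l0 eqxx in kl | rewrite mul0r].
Qed.

Lemma s2in1_1 : s2in1 (mono K 0) = 1.
Proof.
by apply: s2_ext => m n; rewrite s2in1E s2coef1 monoE; case: (m == 0); case: (n == 0).
Qed.

Lemma s2in2_1 : s2in2 (mono K 0) = 1.
Proof.
by apply: s2_ext => m n; rewrite s2in2E s2coef1 monoE; case: (m == 0); case: (n == 0).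
Qed.

Lemma s2X1_unit : s2X1 K \is a GRing.unit.
Proof.
by apply/unitrP; exists (s2in1 (mono K (- 1)));
  rewrite /s2X1 -mono1 !s2in1_mono addNr addrN s2in1_1.
Qed.

Lemma s2X2_unit : s2X2 K \is a GRing.unit.
Proof.
by apply/unitrP; exists (s2in2 (mono K (- 1)));
  rewrite /s2X2 -mono1 !s2in2_mono addNr addrN s2in2_1.
Qed.

Lemma s2const_unit (c : K) : c != 0 -> s2const c \is a GRing.unit.
Proof.
by move=> c0; apply/unitrP; exists (s2const c^-1); rewrite -!rmorphM mulVf // mulfV // rmorph1.
Qed.

Lemma s2poly_prod (I : Type) (s : seq I) (c : I -> K) (u : series2 K) :
  s2poly (\prod_(i <- s) ('X - (c i)%:P)) u = \prod_(i <- s) (u - s2const (c i)).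
Proof.
rewrite /s2poly rmorph_prod horner_prod; apply: eq_bigr => i _.
by rewrite /= map_polyXsubC hornerXsubC.
Qed.

Lemma s2X12_neq (c : K) : s2X1 K / s2X2 K - s2const c != 0.
Proof.
rewrite subr_eq0; apply/eqP => /(congr1 (fun f => f * s2X2 K)).
rewrite divrK ?s2X2_unit // => /(congr1 (fun f : series2 K => f 1 0)).
rewrite s2coefCM /s2X1 /s2X2 s2in1E s2in2E -mono1 monoE /= mulr0 => /eqP.
by rewrite oner_eq0.
Qed.

Variables (G : groupType) (c : G -> K).
Hypothesis c_char : is_linear_character c.

Lemma char_neq0 g : c g != 0.
Proof.
have [c1 cM] := c_char; have : c g * c g^-1%g = 1 by rewrite -cM mulgV.
by apply: contra_eq_neq => ->; rewrite mul0r eq_sym oner_neq0.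
Qed.

Lemma char_inv g : c g^-1%g = (c g)^-1.
Proof.
have [c1 cM] := c_char; apply: (mulfI (char_neq0 g)).
by rewrite -cM mulgV c1 mulfV // char_neq0.
Qed.

(** The unit [m] absorbs the factors that arise when q(x2/x1) is rewritten in terms of x1/x2. Being
    invertible in K((x1,x2)), it can be removed from a truncated product, as equivariance
    demands. *)
Definition char_multiplier (f : series2 K) : Prop := exists q m,
  [/\ linear_factor_monoid c q, m \is a GRing.unit & f = m * s2poly q (s2X1 K / s2X2 K)].

Lemma char_multiplier_q q : linear_factor_monoid c q ->
  char_multiplier (s2poly q (s2X1 K / s2X2 K)).
Proof. by move=> lq; exists q, 1; rewrite unitr1 mul1r. Qed.

Lemma char_multiplier1 : char_multiplier 1.
Proof.
have := @char_multiplier_q 1; rewrite /s2poly rmorph1 hornerC; apply.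
by exists [::]; rewrite big_nil.
Qed.

Lemma char_multiplierM f g : char_multiplier f -> char_multiplier g -> char_multiplier (f * g).
Proof.
move=> [q [m [[s ->] mu ->]]] [q' [m' [[s' ->] mu' ->]]].
exists (\prod_(g <- s ++ s') ('X - (c g)%:P)), (m * m'); split.
- by exists (s ++ s').
- by rewrite unitrM mu mu'.
- by rewrite !s2poly_prod big_cat mulrACA.
Qed.

Lemma char_multiplier_neq0 f : char_multiplier f -> f != 0.
Proof.
move=> [q [m [[s ->] mu ->]]]; rewrite s2poly_prod mulf_neq0 //.
  by apply: contraTneq mu => ->; rewrite unitr0.
by rewrite prodf_seq_neq0; apply/allP => g _; rewrite s2X12_neq implybT.
Qed.

(** By [sub_inv_factor], x2/x1 - c(g) is a unit times x1/x2 - c(g)^(-1), and c(g)^(-1) = c(g^(-1))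
    is again a value of the character. *)
Lemma char_multiplier_inv q : linear_factor_monoid c q ->
  char_multiplier (s2poly q (s2X2 K / s2X1 K)).
Proof.
move=> [s ->]; rewrite s2poly_prod; elim/big_ind: _ => [||g _].
- exact: char_multiplier1.
- exact: char_multiplierM.
exists (\prod_(g <- [:: g^-1%g]) ('X - (c g)%:P)), (- s2const (c g) * (s2X2 K / s2X1 K)).
have [u1 u2] := (s2X1_unit, s2X2_unit); have uc := s2const_unit (char_neq0 g).
split; first by exists [:: g^-1%g].
  by rewrite unitrM unitrN uc unitrM u2 unitrV u1.
rewrite s2poly_prod big_seq1 char_inv; apply: sub_inv_factor.
  exact: divr_mul_divr.
have cV : c g * (c g)^-1 = 1 by rewrite mulfV // char_neq0.
by have := congr1 (@s2const K) cV; rewrite (rmorphM (@s2const K)) rmorph1.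
Qed.

End Monomials.

(** * The module W *)

Section PhiCompatible.
Variables (K : fieldType) (p : laurent K).
Hypothesis char0 : forall n : nat, n.+1%:R != 0 :> K.
Hypothesis p0 : p != 0.

Let rphi : regular (exprz (phi p)) := regular_phi p char0.

(** [pi_phi_inv] is a choice with default 0. It satisfies its specification because some such tensor
    exists: choose a preimage under [pi_phi] of each of the finitely many scalar series of a tensor
    representing [f]. *)
Lemma pi_phi_invP (V : lmodType K) (f : int -> V) : in_tens_laurent (Cphi p) f ->
  tens_in (Cphi2 p) (pi_phi_inv p f) /\
  tens_series (tens_map id (pi_phi p) (pi_phi_inv p f)) = f.
Proof.
move=> [t [s sP ->] fE]; have lpi := pi_phi_linear char0 p0.
rewrite /pi_phi_inv; apply: (@xgetPex _ _ [set t | tens_in (Cphi2 p) t /\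
  tens_series (tens_map id (pi_phi p) t) = f]%classic).
have /boolp.choice [F FP] : forall q : V * laurent K, exists F : frac2 K,
    q \in s -> Cphi2 p F /\ pi_phi p F = q.2.
  move=> q; have [/sP [F CF <-]|nqs] := boolP (q \in s); first by exists F.
  by exists 0.
exists (tens_of [seq (q.1, F q) | q <- s]); split.
  by exists [seq (q.1, F q) | q <- s] => // r /mapP[q qs ->]; exact: (FP q qs).1.
rewrite fE; congr tens_series; rewrite !tens_sum (lin_sum (tens_map_linear (@linear_id _ V) lpi)).
rewrite big_map; apply: eq_big_seq => q qs; rewrite tens_map_tens // ?(FP q qs).2 //.
Qed.

Lemma iota_smul_bilin (V W : lmodType K) (A : V -> int -> int -> W) m n :
  (forall u, in_l21 (A u)) -> (forall i j, linear (fun u => A u i j)) ->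
  bilin (fun u (F : frac2 K) => smul (iota21 F) (A u) m n).
Proof.
move=> lA linA; split=> [F|u].
  by apply: smul_linear => [u|i j]; [exact: summable1_l21 | exact: linA].
move=> c F F'; rewrite iota21D iota21Z.
rewrite smulDl; try exact: summable1_l21.
by rewrite smulZl //; exact: summable1_l21.
Qed.

Lemma phi_eval_bilin (V : lmodType K) k l :
  bilin (fun (u : V) (F : frac2 K) => phi_eval p F k l *: u).
Proof.
split=> [F c x y|u c F F']; first by rewrite scalerDr !scalerA mulrC.
rewrite phi_evalD // phi_evalZ //.
have E2 (x y : laurent (laurent K)) : (lconst (lconst c) * x + y) k l = c * x k l + y k l.
  rewrite -[LHS]/((lconst (lconst c) * x) k l + y k l) /= cauchy_delta /=.
  by rewrite cauchy_delta.
by rewrite E2 scalerDl scalerA.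
Qed.

(* Clearing the poles of [pi_phi_inv p f] by Q turns it into an element of *)
(* V (x) K((x1,x2)).                                                        *)
Lemma pi_phi_inv_clear (V : lmodType K) (f : int -> V) (Q : series2 K) :
  in_laurent f -> in_tens_laurent (Cphi p) f ->
  tens_in (fun F => exists g, F = s2frac g)
    (tens_map id (fun F => s2frac Q * F) (pi_phi_inv p f)) ->
  exists s : seq (V * series2 K),
    (forall (W : lmodType K) (A : V -> int -> int -> W),
       (forall u, in_l21 (A u)) -> (forall i j, linear (fun u => A u i j)) ->
       smul Q (fun m n => tlift (fun u F => smul (iota21 F) (A u) m n) (pi_phi_inv p f)) =
       (fun m n => \sum_(r <- s) smul r.2 (A r.1) m n)) /\
    (forall k l, \sum_(r <- s) s2eval (phi p) r.2 k l *: r.1 =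
       smul (s2eval (phi p) Q) (fun i => delta0 (f i)) k l).
Proof.
move=> lf /pi_phi_invP [[s0 s0P tE] fE] [s' s'P QtE]; set t := pi_phi_inv p f in tE fE QtE *.
have lQ : linear (fun F : frac2 K => s2frac Q * F).
  move=> c F F'; rewrite mulrDr; congr (_ + _).
  by rewrite -[c *: F]/(s2frac (s2const c) * F) mulrCA.
(* [g] selects the element of K((x1,x2)) that a fraction comes from; on other fractions its value 0
   is immaterial. *)
have /boolp.choice [g gP] : forall F : frac2 K, exists g, (exists g', F = s2frac g') -> F = s2frac g.
  by move=> F; have [[g' ->]|nF] := pselect (exists g', F = s2frac g'); [exists g' | exists 0].
exists [seq (r.1, g r.2) | r <- s']; split=> [W A lA linA|k l].
  apply/funext => m; apply/funext => n; have bA := iota_smul_bilin m n lA linA.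
  rewrite smul_sum; last first.
    by move=> q; apply: summable1_l21; apply: smul_l21; exact: lA.
  rewrite big_map /=.
  transitivity (tlift (fun u F => smul (iota21 F) (A u) m n) (tens_map id (fun F => s2frac Q * F) t)).
    rewrite tlift_tens_map //; apply: eq_bigr => q _.
    by rewrite iota21Ml smulA21.
  rewrite QtE tlift_of //; apply: eq_big_seq => r rs.
  by rewrite {1}(gP _ (s'P r rs)) iota21_frac.
rewrite big_map /=.
transitivity (tlift (fun u F => phi_eval p F k l *: u) (tens_map id (fun F => s2frac Q * F) t)).
  rewrite QtE tlift_of; last exact: phi_eval_bilin.
  by apply: eq_big_seq => r rs; rewrite [in RHS](gP _ (s'P r rs)) phi_eval_frac.
rewrite tlift_tens_map //; last exact: phi_eval_bilin.
have fTE i : f i = \sum_(q <- s0) pi_phi p q.2 i *: q.1.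
  rewrite -fE tE tens_sum (lin_sum (tens_map_linear (@linear_id _ V) (pi_phi_linear char0 p0))).
  rewrite [LHS](lin_sum (tlift_linear (tens_series_bilin V i))); apply: eq_bigr => q _.
  rewrite tens_map_tens //; last exact: pi_phi_linear.
  by rewrite [LHS]tlift_tens //; exact: tens_series_bilin.
have bQ : bilin (fun (u : V) (F : frac2 K) => phi_eval p (s2frac Q * F) k l *: u).
  apply: (bilin_comp2 (B := fun u F => phi_eval p F k l *: u) (f := id)) => //.
  exact: phi_eval_bilin.
rewrite tE tlift_of //.
(* On [Cphi2] the expansion in (z, x) is constant in x, so [f] occupies only the exponent 0 of the
   second variable. *)
have -> : (fun i => delta0 (f i)) =
    (fun i j => \sum_(q <- s0) (if j == 0 then pi_phi p q.2 i else 0) *: q.1).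
  apply/funext => i; apply/funext => j; rewrite /delta0 fTE; case: ifP => // _.
  by rewrite big1 // => q _; rewrite scale0r.
rewrite smul_sum.
  apply: eq_big_seq => q qs.
  have -> : phi_eval p (s2frac Q * q.2) k l = (s2eval (phi p) Q * phi_eval p q.2) k l.
    by rewrite phi_evalMl.
  rewrite lcoef2M (fsum_morph (g := fun x => x *: q.1)); last exact: fs_lcoef2M.
    apply: eq_fsum => x; rewrite scalerA; congr ((_ * _) *: _).
    exact: (phi_eval_Cphi2 char0 p0 _ _ (s0P q qs)).
  by move=> x y; rewrite scalerDl.
move=> q; apply: summable1_l21; have [N NP] := laurent_ge (pi_phi p q.2).
split=> [|M].
  exists N => m n; rewrite scaler_eq0 negb_or => /andP[+ _].
  by case: ifP => _; [exact: NP | rewrite eqxx].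
exists 0 => m n _; rewrite scaler_eq0 negb_or => /andP[+ _].
by case: (eqVneq n 0) => [->|_] //; rewrite eqxx.
Qed.

End PhiCompatible.

(** * Weak associativity and equivariance of the smash fields on W *)

Section ModuleCase.
Variables (K : fieldType) (p : laurent K).
Hypothesis char0 : forall n : nat, n.+1%:R != 0 :> K.
Hypothesis p0 : p != 0.
Variables (G : groupType) (chi chiphi : G -> K).
Hypothesis chiphi_char : is_linear_character chiphi.
Variables (H : lmodType K) (YH : H -> H -> int -> H) (oneH : H).
Variables (Delta : H -> tensor H H) (eps : H -> K) (RH : G -> H -> H).
Hypothesis H_bialg : is_Gnlvb chi YH oneH Delta eps RH.
Variables (V : lmodType K) (YV : V -> V -> int -> V) (oneV : V) (RV : G -> V -> V).
Hypothesis V_alg : is_Gnlva chi YV oneV RV.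
Variable YHV : H -> V -> int -> V.
Hypothesis V_compat : is_phi_compatible p chiphi YH oneH Delta eps YV oneV YHV.
Variables (W : lmodType K) (YWH : H -> W -> int -> W) (YWV : V -> W -> int -> W).
Hypothesis W_mod : is_equivariant_HV_module p chiphi YH oneH Delta RH YV oneV RV YHV YWH YWV.

Let ra : regular (exprz (phi p)) := regular_phi p char0.
Let a0 : phi p != 0 := phi_neq0 p char0.
Let vYH : is_vertex_map YH := nlva_vertex_map (nlvb_nlva (Gnlvb_nlvb H_bialg)).
Let vYV : is_vertex_map YV := nlva_vertex_map (Gnlva_nlva V_alg).
Let vYHV : is_vertex_map YHV :=
  nlvm_vertex_map (Hnlva_module (phic_Hmodule V_compat)).
Let vYWH : is_vertex_map YWH := phiq_vertex_map (eqm_module (HVm_H W_mod)).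
Let vYWV : is_vertex_map YWV := phiq_vertex_map (eqm_module (HVm_V W_mod)).
Let lDelta : linear Delta := coalg_Delta_linear (nlvb_coalgebra (Gnlvb_nlvb H_bialg)).

Lemma equivariant_wassoc (U : lmodType K) (YU : U -> U -> int -> U) oneU (R : G -> U -> U)
    (Y : U -> W -> int -> W) : is_vertex_map YU ->
  is_equivariant_module p chiphi YU oneU R Y -> forall u v,
  exists2 f, char_multiplier chiphi f &
    forall w, wassoc (phi p) (Ycomp Y Y u v w) f (fun i j => Y (YU u v i) w j).
Proof.
move=> vYU mY u v; have [q lq qP] := eqm_poly mY u v.
have vY := phiq_vertex_map (eqm_module mY).
have [f0 f00 f0P] := phiq_weak_assoc (eqm_module mY) u v.
exists (s2poly q (s2X1 K / s2X2 K)); first exact: char_multiplier_q.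
move=> w; set f := s2poly q _; set A := Ycomp _ _ _ _ _; set R' := (X in wassoc _ _ _ X).
have lA : in_l12 A by exact: (@Ycomp_l12 _ _ _ _ Y Y u v w).
have lR : in_l21 R' by exact: (@Yiter_l21 _ _ _ YU Y u v w).
have [/in_laurent2P [N bN] e] := f0P w; have /in_laurent2P [M bM] := qP w.
split=> //; first by exists M.
have T0 : s2eval (phi p) f0 != 0 by apply: contra_neq f00 => /(Tinj char0 p0).
have l21 : in_l21 (subst1 (phi p) (smul f A)) by exact: gsubst_in_l21 ra bM.
have key : smul (s2eval (phi p) f0) (subst1 (phi p) (smul f A)) =
    smul (s2eval (phi p) f0) (smul (s2eval (phi p) f) R').
  rewrite -(subst1_smul ra a0 f0 bM) -smulA12 // mulrC smulA12 //.
  by rewrite (subst1_smul ra a0 f bN) e -!smulA21 // mulrC.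
(* Both sides of [key] lie in W((x2))((z)), on which the field K((x2))((z)) acts, so the nonzero
   image of [f0] can be cancelled. *)
have := congr1 (smul (s2eval (phi p) f0)^-1) key.
have lTR := smul_l21 (s2eval (phi p) f) lR.
by rewrite -(smulA21 _ _ l21) -(smulA21 _ _ lTR) mulVf // !smul1.
Qed.

Lemma hUW h v u : exists N : int, forall i n, YV u (YHV h v i) n != 0 -> N <= n.
Proof. by apply: tens_laurent_unif (Hnlva_tens (phic_Hmodule V_compat) h v). Qed.

Lemma vendo_scaling (c : K) : vendo YWV (fun w => c *: w).
Proof.
split=> [|v w n]; first exact: linear_scaler.
by rewrite (lin_scale (vmap_linr vYWV v n)).
Qed.

(** Y_W^H(h',x)w involves finitely many vectors, and applying Y_W^H(h,x) to these yields finitely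
    many more. The coefficients in question are combinations of the latter, and scalings commute
    with the fields of V. *)
Lemma tameHHW h h' w : exists2 T, tame YWV T & forall i j, T (YWH h (YWH h' w j) i).
Proof.
have /boolp.choice [s sP] : forall x, exists s : seq (W * laurent K),
    forall n, YWH h x n = \sum_(q <- s) q.2 n *: q.1.
  by move=> x; have [s _ sE] := in_tens_laurent_sum (HVm_tens W_mod h x); exists s.
have [s' _ sE'] := in_tens_laurent_sum (HVm_tens W_mod h' w).
exists (endo_span YWV [seq r.1 | q <- s', r <- s q.1]); first exact: endo_span_tame.
move=> i j; rewrite sE' (lin_sum (vmap_linr vYWH h i)) big_seq.
apply: big_ind => [||q qs]; [exact: endo_span0 | exact: endo_spanD |].
rewrite (lin_scale (vmap_linr vYWH h i)); apply: endo_spanZ => //; rewrite sP big_seq.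
apply: big_ind => [||r rs]; [exact: endo_span0 | exact: endo_spanD |].
apply: (endo_span_gen (g := fun w => r.2 i *: w)); last exact: vendo_scaling.
by apply/allpairsPdep; exists q, r.
Qed.

Lemma tameHW h w : exists2 T, tame YWV T & forall i, T (YWH h w i).
Proof.
(* The field of [oneH] is the identity, so its coefficient at exponent 0 returns w. *)
have [T tT TP] := tameHHW h oneH w; exists T => // i.
have := TP i 0; rewrite (phiq_vacuum (eqm_module (HVm_H W_mod))) /delta0 eqxx.
by [].
Qed.

(** The commuted products are those of the (H,V)-module axiom. Each is a finite sum of fields
    multiplied by values of [iota21] in K((x2))((x1)), hence lies in W((x2))((x1)). *)
Lemma presHVW h v : exists2 f, char_multiplier chiphi f &
  exists s, series_pres Delta YHV YWH YWV (phi p) h v f s.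
Proof.
pose A h2 w u i j := YWV u (YWH h2 w i) j.
have lA h2 w u : in_l21 (A h2 w u) by exact: (@Ycomp_l21 _ _ _ _ YWV YWH).
have linA h2 w i j : linear (fun u => A h2 w u i j) by exact: vmap_linl.
pose C h1 h2 w m n := tlift (fun u F => smul (iota21 F) (A h2 w u) m n) (pi_phi_inv p (YHV h1 v)).
have l0 : in_l21 (fun _ _ => 0 : W) by split=> [|M]; exists 0 => m n; rewrite eqxx.
apply: (@pres_of_local _ _ ra a0 _ _ _ Delta YHV YWH YWV vYHV vYWH vYWV _
  (char_multiplier1 chiphi) (@char_multiplierM _ _ chiphi) h v C _ (fun B => in_l21 B)).
- move=> w m n; exact: (HVm_comm W_mod).
- exact: l0.
- exact: l21D.
- by move=> f g B lB; rewrite -smulA21.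
- by move=> f B; exact: summable1_l21.
- move=> h1 h2 w; apply: (@closed_big _ (fun B => in_l21 B)) => // [A1 A2|q]; first exact: l21D.
  exact: smul_l21.
move=> h1 h2; have [q lq qP] := phic_poly V_compat h1 v.
exists (s2poly q (s2X2 K / s2X1 K)); first exact: char_multiplier_inv.
have [s [s1 s2]] := pi_phi_inv_clear char0 p0 (vYHV.2 h1 v) (phic_tens V_compat h1 v) qP.
exists s; split=> // w; exact: (s1 W (A h2 w)).
Qed.

Lemma sharp_wassoc x y : exists2 f, char_multiplier chiphi f & forall w,
  wassoc (phi p) (Ycomp (YWsharp YWH YWV) (YWsharp YWH YWV) x y w) f
    (fun i j => YWsharp YWH YWV (Ysmash YH Delta YV YHV x y i) w j).
Proof.
apply: smash_wassoc => //.
- exact: hUW.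
- exact: tameHW.
- exact: tameHHW.
- exact: char_multiplier1.
- exact: char_multiplierM.
- exact: equivariant_wassoc (HVm_V W_mod).
- exact: equivariant_wassoc (HVm_H W_mod).
- exact: presHVW.
Qed.

Lemma sharp_equivariant_module :
  is_equivariant_module p chiphi (Ysmash YH Delta YV YHV) (oneV *t oneH)
    (fun g => tens_map (RV g) (RH g)) (YWsharp YWH YWV).
Proof.
have Ytens := YWsharp_tens vYWH vYWV tameHW.
have [mH mV] := (HVm_H W_mod, HVm_V W_mod).
have delta_sum (Y : W -> int -> W) w n : (forall i, Y 0 i = 0) ->
    \sum_(i \in [set: int]) Y (delta0 w i) (n - i) = Y w n.
  move=> Y0; rewrite (@fsum1 _ _ 0) => [|i /negPf i0]; last by rewrite /delta0 i0 Y0.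
  by rewrite /delta0 eqxx subr0.
split.
- split.
  + exact: (YWsharp_vertex_map vYWH vYWV tameHW).
  + move=> w; apply/funext => n; rewrite Ytens /Ydiag.
    rewrite (phiq_vacuum (eqm_module mH)) delta_sum => [|i]; last exact: vmap0r.
    by rewrite (phiq_vacuum (eqm_module mV)).
  + move=> x y; have [f fm fP] := sharp_wassoc x y.
    exists f; first exact: char_multiplier_neq0 fm.
    move=> w; have [_ _ bA e] := fP w; split; last exact: e.
    exact/in_laurent2P.
- move=> g x w; apply/funext => n.
  have lR := rep_linear (Gnlva_rep V_alg) g.
  have lRH := rep_linear (Gnlva_rep (Gnlvb_Gnlva H_bialg)) g.
  have bY := Ydiag_bilin vYWH vYWV tameHW w n.
  rewrite /YWsharp tlift_tens_map // /dilate.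
  rewrite (lin_tlift _ _ (@linear_scaler _ W _)).
  apply: eq_tlift => v h; rewrite /Ydiag.
  rewrite (lin_fsum (@linear_scaler _ W _)); last exact: (Ydiag_fs vYWH vYWV tameHW).
  apply: eq_fsum => i.
  rewrite (eqm_rep mV) (eqm_rep mH) /dilate (lin_scale (vmap_linr vYWV v (n - i))).
  rewrite scalerA -expfzDr ?subrK //.
  by rewrite invr_eq0 char_neq0.
- move=> x y; have [f [q [m [lq um fE]]] fP] := sharp_wassoc x y; exists q => // w.
  have [lA _ [N bN] _] := fP w; apply/in_laurent2P.
  (* The multiplier for associativity is a unit times q(x1/x2); truncation is unaffected by the
     inverse unit. *)
  have -> : s2poly q (s2X1 K / s2X2 K) = m^-1 * f by rewrite fE mulKr.
  rewrite smulA12 //; have [M MP] := smul_bounded m^-1 bN.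
  by exists M; exact: MP.
Qed.

End ModuleCase.

(** * The smash product as a module over itself *)

Section ShiftedSeries.
Variable K : fieldType.
Hypothesis char0 : forall n : nat, n.+1%:R != 0 :> K.

(* The coefficient of x1^i x2^j in (x1 - x2)^(i + j), expanded in nonnegative *)
(* powers of x2.                                                              *)
Definition dxz (i j : int) : K := (x_minus_z K ^ (i + j)) j i.

(** This is (x1 - x2)^k = (x1 - x2)(x1 - x2)^(k-1) with k = i + j, which holds for every integer k
    because x1 - x2 is invertible in the field of expansions. *)
Lemma dxz_rec i j : dxz i j = dxz (i - 1) j - dxz i (j - 1).
Proof.
have xz0 : x_minus_z K != 0 by rewrite -phiN1 // phi_neq0.
rewrite /dxz; set F := x_minus_z K ^ (i + j - 1).
have -> : x_minus_z K ^ (i + j) = x_minus_z K * F.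
  by rewrite /F -[X in X * _]expr1z -expfzDr //; congr (_ ^ _); lia.
have -> : i - 1 + j = i + j - 1 by lia.
have -> : i + (j - 1) = i + j - 1 by lia.
rewrite -/F {1}/x_minus_z mulrBl.
rewrite -[LHS]/((lconst (lX K) * F) j i - (lX (laurent K) * F) j i).
have -> : (lX (laurent K) * F) j = F (j - 1) by exact: mono_mulE.
have -> : (lconst (lX K) * F) j = lX K * F j by rewrite /= cauchy_delta.
by congr (_ - _); exact: mono_mulE.
Qed.

Lemma dxz_ge i j : dxz i j != 0 -> 0 <= j.
Proof.
by rewrite /dxz -phiN1 // phi_exp // leNgt; apply: contraNN => j0; rewrite Ephi_neg.
Qed.

(** A nonnegative power of x1 - x2 is a polynomial: differentiating a monomial of nonnegative
    exponent never produces a negative one, as constants are killed. *)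
Lemma dxz_ge1 i j : 0 <= i + j -> dxz i j != 0 -> 0 <= i.
Proof.
rewrite /dxz -phiN1 // phi_exp //.
case: j => j ij; last by rewrite Ephi_neg // eqxx.
rewrite EphiE // lcoefZ mulf_eq0 negb_or => /andP[_].
suff b0 : bounded_at 0 (iter j (Dp (lconst (- 1))) (mono K (i + j))).
  by rewrite leNgt; apply: contraNN => /b0 ->.
have: bounded_at 0 (mono K (i + j)) by apply: bounded_atW ij _; exact: mono_bounded.
move: (mono K _) => f f0; elim: j {ij} => // j IH n n0.
rewrite iterS {1}/Dp /= cauchy_delta /= lderivE.
have [->|n1] := eqVneq (n + 1) 0; first by rewrite mulr0z mulr0.
by rewrite IH ?mul0rz ?mulr0 //; lia.
Qed.

Lemma smul_X12 (W : lmodType K) (A : int -> int -> W) m n :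
  smul (s2X1 K - s2X2 K) A m n = A (m - 1) n - A m (n - 1).
Proof.
have X1E i j : s2X1 K i j = if (i == 1) && (j == 0) then 1 else 0.
  by rewrite /s2X1 s2in1E -mono1 monoE andbC; do 2!case: eqP.
have X2E i j : s2X2 K i j = if (i == 0) && (j == 1) then 1 else 0.
  by rewrite /s2X2 s2in2E -mono1 monoE; do 2!case: eqP.
pose B (f : series2 K) (x : int * int) := f x.1 x.2 *: A (m - x.1) (n - x.2).
have f1 : fs (B (s2X1 K)).
  exists [:: (1, 0)] => -[i j]; rewrite /B X1E inE xpair_eqE /=; case: ifP => //.
  by rewrite scale0r eqxx.
have f2 : fs (fun x => - B (s2X2 K) x).
  exists [:: (0, 1)] => -[i j]; rewrite /B X2E inE xpair_eqE /=; case: ifP => //.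
  by rewrite scale0r oppr0 eqxx.
transitivity (\sum_(x \in [set: int * int]) (B (s2X1 K) x + - B (s2X2 K) x)).
  by apply: eq_fsum => x; rewrite /B -scalerBl.
rewrite fsumD // (@fsum1 _ _ (1, 0)) => [|[i j] /negPf ij]; last by rewrite /B X1E -xpair_eqE ij scale0r.
rewrite (@fsum1 _ _ (0, 1)) => [|[i j] /negPf ij]; last by rewrite /B X2E -xpair_eqE ij scale0r oppr0.
by rewrite /B X1E X2E !eqxx !scale1r !subr0.
Qed.

Lemma X12_exp (N : nat) i j :
  ((s2X1 K - s2X2 K) ^+ N : series2 K) i j = if i + j == N then dxz i j else 0.
Proof.
elim: N i j => [|N IH] i j.
  rewrite expr0 s2coef1; have [ij|ij] := eqVneq (i + j) 0; last first.
    by rewrite ifN //; apply: contraNN ij => /andP[/eqP -> /eqP ->].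
  rewrite /dxz ij expr0z -[RHS]/((delta0 (1 : laurent K) j : laurent K) i) /delta0 andbC.
  by case: (j == 0).
rewrite exprS; set P := (_ ^+ N : series2 K).
have -> : ((s2X1 K - s2X2 K) * P) i j = P (i - 1) j - P i (j - 1).
  by rewrite s2coefM; exact: (@smul_X12 K^o (fun m n => P m n : K^o)).
rewrite /P !IH.
have -> : (i - 1 + j == N) = (i + j == N.+1) by apply/eqP/eqP; lia.
have -> : (i + (j - 1) == N) = (i + j == N.+1) by apply/eqP/eqP; lia.
by case: ifP => _; rewrite ?subr0 // -dxz_rec.
Qed.

(* f(x1 - x2) (x1 - x2)^s, expanded in nonnegative powers of x2. *)
Definition Fser (f : laurent K) (s i j : int) : K := f (i + j - s) * dxz i j.

Lemma Fser_l12 f s : in_l12 (fun i j => Fser f s i j : K^o).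
Proof.
have [N fN] := laurent_ge f; apply: in_l12P => [|j].
  by exists 0 => i j; rewrite mulf_eq0 negb_or => /andP[_]; exact: dxz_ge.
by exists (N + s - j) => i; rewrite mulf_eq0 negb_or => /andP[/fN + _]; lia.
Qed.

Lemma smul_Fser f (N : nat) s :
  smul ((s2X1 K - s2X2 K) ^+ N : series2 K) (fun i j => Fser f s i j : K^o) =
  (fun i j => Fser f (s + N%:Z) i j).
Proof.
elim: N => [|N IH]; first by rewrite smul1 addr0.
rewrite exprS smulA12; last exact: Fser_l12.
rewrite IH; apply/funext => i; apply/funext => j.
rewrite [LHS](@smul_X12 K^o) /Fser [dxz i j]dxz_rec mulrBr.
by congr (f _ * _ - f _ * _); lia.
Qed.

(** The series f(x1 - x2)(x1 - x2)^N as an element of K((x1,x2)), meant for N at least the pole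
    order of f: then only nonnegative powers of x1 - x2 occur. *)
Definition gser (f : laurent K) (N : nat) : series2 K := mks2 (Fser f N).

Lemma gserE (f : laurent K) (N : nat) i j : (forall n, f n != 0 -> - N%:Z <= n) ->
  gser f N i j = Fser f N i j.
Proof.
move=> fN; apply: (@mks2E _ 0) => m n mn; apply: contrapT => /eqP.
rewrite mulf_eq0 negb_or => /andP[/fN ? d].
have n0 := dxz_ge d; have := @dxz_ge1 m n _ d => /(_ ltac:(lia)).
by lia.
Qed.

Lemma phi1_X12 (N : nat) : s2eval (phi 1) ((s2X1 K - s2X2 K) ^+ N) = mono (laurent K) N.
Proof.
elim: N => [|N IH]; first by rewrite expr0 T1 ?oner_neq0 // mono0.
rewrite exprS TM // IH TB // /s2X1 /s2X2 T_in1 // T_in2 // -phiE phi1 //.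
by rewrite /x_plus_z addrC addKr -mono1 -mono_add.
Qed.

(** As x + z is homogeneous, only the part of [gser] of degree k + l contributes to z^k x^l. For k +
    l nonnegative that part is f(k + l - N) times (x1 - x2)^(k+l), which becomes a multiple of
    z^(k+l), so that no x survives. *)
Lemma s2eval_gser (f : laurent K) (N : nat) k l : (forall n, f n != 0 -> - N%:Z <= n) ->
  s2eval (phi 1) (gser f N) k l = if l == 0 then f (k - N%:Z) else 0.
Proof.
move=> fN; rewrite TE // /ksubst.
have hom m n : (phi (1 : laurent K) ^ m) k (l - n) != 0 -> m + n = k + l.
  by move=> nz; have := @phi_const_homog K 1 m k (l - n) char0 nz; lia.
have [kl|kl] := ltP (k + l) 0.
  have f0 : f (k + l - N%:Z) = 0 by apply/eqP; apply: contraT => /fN; lia.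
  rewrite fsum0 => [|[m n] /=].
    by case: eqP f0 => // ->; rewrite addr0.
  have [->|/hom mn] := eqVneq ((phi (1 : laurent K) ^ m) k (l - n)) 0; first by rewrite mul0r.
  by rewrite gserE // /Fser mn f0 mul0r mulr0.
have [M kM] : exists M : nat, k + l = M%:Z by exists (absz (k + l)); lia.
transitivity (f (k + l - N%:Z) * s2eval (phi 1) ((s2X1 K - s2X2 K) ^+ M) k l).
  rewrite TE // /ksubst [RHS](@fsum_morph _ K K (fun x => f (k + l - N%:Z) * x)).
  - apply: eq_fsum => -[m n] /=.
    have [->|/hom mn] := eqVneq ((phi (1 : laurent K) ^ m) k (l - n)) 0; first by rewrite !mul0r mulr0.
    by rewrite gserE // /Fser X12_exp mn kM eqxx mulrCA.
  - by move=> x y; rewrite mulrDr.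
  - exact: (@fs_ksubst _ (exprz (phi 1)) _ k l (regular_phi 1 char0)).
rewrite phi1_X12 monoE -kM.
have -> : (k == k + l) = (l == 0) by apply/eqP/eqP; lia.
have [->|_] := eqVneq l 0; first by rewrite addr0 lcoef1 /delta0 eqxx mulr1.
by rewrite lcoef0 mulr0.
Qed.

Lemma smul_mono (W : lmodType K) (A : int -> int -> W) n k l :
  smul (mono (laurent K) n) A k l = A (k - n) l.
Proof.
have mE i j : mono (laurent K) n i j = if (i == n) && (j == 0) then 1 else 0.
  by rewrite monoE; case: (i == n).
rewrite /smul (@fsum1 _ _ (n, 0)) => [|[i j] /negPf ij].
  by rewrite mE !eqxx scale1r subr0.
by rewrite mE -xpair_eqE ij scale0r.
Qed.

Definition X12_power (f : series2 K) : Prop := exists N : nat, f = (s2X1 K - s2X2 K) ^+ N.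

Lemma X12_power1 : X12_power 1. Proof. by exists 0%N. Qed.
Lemma X12_powerM f g : X12_power f -> X12_power g -> X12_power (f * g).
Proof. by move=> [M ->] [N ->]; exists (M + N)%N; rewrite exprD. Qed.

(** Under x1 = x2 + z the multiplier (x1 - x2)^k becomes z^k, which acts on the iterate as the shift
    of exponents in [weak_assoc]. *)
Lemma weak_assocP (V W : lmodType K) (YV : V -> V -> int -> V) (YW : V -> W -> int -> W) :
  is_vertex_map YV -> is_vertex_map YW ->
  weak_assoc YV YW <-> forall u v, exists2 f, X12_power f &
    forall w, wassoc (phi 1) (Ycomp YW YW u v w) f (fun i j => YW (YV u v i) w j).
Proof.
move=> vYV vYW.
have eR u v (k : nat) w : smul (s2eval (phi 1) ((s2X1 K - s2X2 K) ^+ k))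
    (fun i j => YW (YV u v i) w j) = (fun i j => YW (YV u v (i - k%:Z)) w j).
  by do 2!apply/funext => ?; rewrite phi1_X12 smul_mono.
split=> wa u v.
  have [k kP] := wa u v; exists ((s2X1 K - s2X2 K) ^+ k); first by exists k.
  move=> w; have [/in_laurent2P bA e] := kP w; split=> //.
  - exact: (@Ycomp_l12 _ _ _ _ YW YW u v w).
  - exact: (@Yiter_l21 _ _ _ YV YW u v w).
  - by rewrite eR -e phi1.
have [f [k ->] kP] := wa u v; exists k => w; have [_ _ bA e] := kP w.
split; first exact/in_laurent2P.
by rewrite -eR -e phi1.
Qed.

End ShiftedSeries.

(** * Series of the form Y(f(x1 - x2), x2) g(x1) *)

Section ShiftedAction.
Variable K : fieldType.
Hypothesis char0 : forall n : nat, n.+1%:R != 0 :> K.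
Variables (U X W : lmodType K) (Y : U -> X -> int -> W).
Hypothesis bY : forall n, bilin (fun u x => Y u x n).

(** [Yshift] for an arbitrary bilinear family, with the index of [f] already replaced by i + j, the
    degree that homogeneity of (x1 - x2)^k imposes. *)
Definition yshift (f : int -> U) (g : int -> X) (m n : int) : W :=
  \sum_(ij \in [set: int * int]) dxz K ij.1 ij.2 *: Y (f (ij.1 + ij.2)) (g (m - ij.1)) (n - ij.2).

Definition shift_bounded (f : int -> U) (g : int -> X) (N : int) : Prop :=
  forall k l n, Y (f k) (g l) n != 0 -> [/\ N <= k, N <= l & N <= n].

Lemma yshift_support f g N m n i j : shift_bounded f g N ->
  dxz K i j *: Y (f (i + j)) (g (m - i)) (n - j) != 0 ->
  [/\ N + N - n <= i, i <= m - N, 0 <= j & j <= n - N].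
Proof.
move=> fgN; rewrite scaler_eq0 negb_or => /andP[/(dxz_ge char0) j0 /fgN [? ? ?]].
by split; lia.
Qed.

Lemma yshift_fs f g N m n : shift_bounded f g N ->
  fs (fun ij : int * int =>
    dxz K ij.1 ij.2 *: Y (f (ij.1 + ij.2)) (g (m - ij.1)) (n - ij.2)).
Proof.
move=> fgN; apply: (@fs_int_pair _ _ _ (N + N - n) (m - N)) => [i j|i].
  by move=> /(yshift_support fgN) [].
by apply: (@fs_int _ _ 0 (n - N)) => j /(yshift_support fgN) [].
Qed.

Lemma shift_bounded_span (s : seq (U * laurent K)) f g :
  (forall k, f k = \sum_(q <- s) q.2 k *: q.1) ->
  (exists N, forall l, g l != 0 -> N <= l) ->
  (forall u, exists N, forall l n, Y u (g l) n != 0 -> N <= n) ->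
  exists N, shift_bounded f g N.
Proof.
move=> fE [M gM] gN.
have [|A AP] := @big_ge _ _ (int * int * int) s
  (fun q x => q.2 x.1.1 *: Y q.1 (g x.1.2) x.2) snd.
  move=> q; have [N qN] := gN q.1; exists N => -[[k l] n] /=.
  by rewrite scaler_eq0 negb_or => /andP[_ /qN].
have [|B BP] := @big_ge _ _ int s (fun q k => q.2 k *: q.1) id.
  move=> q; have [N qN] := laurent_ge q.2; exists N => k.
  by rewrite scaler_eq0 negb_or => /andP[/qN].
exists (Order.min (Order.min A B) M) => k l n nz; have [bl br] := bY n.
have := gM _ (lin_neq0 (br _) nz).
have := lin_neq0 (bl _) nz; rewrite fE => /BP.
have : A <= n; last by rewrite /=; split; lia.
apply: (AP (k, l, n)); move: nz; rewrite fE (lin_sum (bl _)).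
by under eq_bigr => q _ do rewrite (lin_scale (bl _)).
Qed.

Lemma yshift_neq0 f g N m n : shift_bounded f g N -> yshift f g m n != 0 ->
  N <= n /\ N + N + N - n <= m.
Proof.
move=> fgN /fsum_neq0 [[i j]] /= nz.
by have [? ? ? ?] := yshift_support fgN nz; split; lia.
Qed.

Lemma yshift_linearr (T : lmodType K) f (g : T -> int -> X) m n :
  (forall k, linear (fun t => g t k)) -> (forall t, exists N, shift_bounded f (g t) N) ->
  linear (fun t => yshift f (g t) m n).
Proof.
move=> lg fgN; apply: linear_fsum => [[i j]|t]; last first.
  by have [N tN] := fgN t; exact: yshift_fs tN.
move=> c t t'; have [_ br] := bY (n - j).
by rewrite /= lg (br (f (i + j))) scalerDr !scalerA mulrC.
Qed.

Lemma yshift_linearl (T : lmodType K) (f : T -> int -> U) g m n :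
  (forall k, linear (fun t => f t k)) -> (forall t, exists N, shift_bounded (f t) g N) ->
  linear (fun t => yshift (f t) g m n).
Proof.
move=> lf fgN; apply: linear_fsum => [[i j]|t]; last first.
  by have [N tN] := fgN t; exact: yshift_fs tN.
move=> c t t'; have [bl _] := bY (n - j).
by rewrite /= lf (bl (g (m - i))) scalerDr !scalerA mulrC.
Qed.

Lemma Fser_cone f (g : int -> X) v N :
  (forall l n, Y v (g l) n != 0 -> N <= l /\ N <= n) ->
  cone12 (fun i j m n => Fser f 0 i j *: Y v (g m) n).
Proof.
move=> gN; have [M fM] := laurent_ge f; split.
  exists (Order.min N 0) => i j m n; rewrite scaler_eq0 mulf_eq0 !negb_or.
  by move=> /andP[/andP[_ /(dxz_ge char0) ?] /gN]; lia.
move=> L; exists (Order.min N (M - L)) => i j m n jL nL.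
rewrite scaler_eq0 mulf_eq0 !negb_or => /andP[/andP[/fM ? _] /gN].
by lia.
Qed.

Lemma yshift_sum (s : seq (U * laurent K)) f g :
  (forall k, f k = \sum_(q <- s) q.2 k *: q.1) ->
  (forall q, exists N, forall l n, Y q (g l) n != 0 -> N <= l /\ N <= n) ->
  yshift f g = (fun m n => \sum_(q <- s)
    conv2 (fun i j m n => Fser q.2 0 i j *: Y q.1 (g m) n) m n).
Proof.
move=> fE gN; apply/funext => m; apply/funext => n; rewrite -fsum_big.
  apply: eq_fsum => -[i j] /=; have [bl _] := bY (n - j).
  rewrite fE (lin_sum (bl _)) scaler_sumr; apply: eq_bigr => q _.
  by rewrite (lin_scale (bl _)) scalerA /Fser subr0 mulrC.
move=> q; have [N gqN] := gN q.1; have [M fM] := laurent_ge q.2.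
have key i j : Fser q.2 0 i j *: Y q.1 (g (m - i)) (n - j) != 0 ->
    [/\ M + N - n <= i, i <= m - N, 0 <= j & j <= n - N].
  rewrite scaler_eq0 mulf_eq0 !negb_or => /andP[/andP[/fM ? /(dxz_ge char0) ?] /gqN [? ?]].
  by split; lia.
apply: (@fs_int_pair _ _ _ (M + N - n) (m - N)) => [i j /key []|i] //.
by apply: (@fs_int _ _ 0 (n - N)) => j /key [].
Qed.

End ShiftedAction.

(* (x - z)^k is homogeneous of degree k, so that the exponents of x and z      *)
(* determine the summation index k of [Yshift].                               *)
Lemma YshiftE (K : fieldType) (V : lmodType K) (Y : V -> V -> int -> V) f g N m n :
  (forall n : nat, n.+1%:R != 0 :> K) -> shift_bounded Y f g N ->
  Yshift Y f g m n = yshift Y f g m n.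
Proof.
move=> char0 fgN.
pose F (x : int * int * int) := (x_minus_z K ^ x.2) x.1.2 x.1.1 *:
  Y (f x.2) (g (m - x.1.1)) (n - x.1.2).
have k_eq i j k : F ((i, j), k) != 0 -> k = i + j.
  rewrite /F /= scaler_eq0 negb_or -phiN1 // => /andP[/(phi_const_homog char0) <- _].
  by rewrite addrC.
have [s sP] := yshift_fs char0 m n fgN.
have fF : fs F.
  exists [seq (x, x.1 + x.2) | x <- s] => -[[i j] k] nz; have e := k_eq _ _ _ nz.
  apply/mapP; exists (i, j); last by rewrite e.
  by apply: sP; rewrite /=; move: nz; rewrite /F /= e.
rewrite -[LHS]/(\sum_(x \in [set: int * int * int]) F x) fsum_pair //.
apply: eq_fsum => -[i j]; rewrite (@fsum1 _ _ (i + j)) // => k.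
by apply: contra_neq_eq => /k_eq.
Qed.

(** * The action of V and H on V (x) H *)

Section AdjointAction.
Variable K : fieldType.
Hypothesis char0 : forall n : nat, n.+1%:R != 0 :> K.
Variables (H : lmodType K) (YH : H -> H -> int -> H) (oneH : H).
Variables (Delta : H -> tensor H H) (eps : H -> K).
Hypothesis bH : is_nlvb YH oneH Delta eps.
Variables (V : lmodType K) (YV : V -> V -> int -> V) (oneV : V).
Variable YHV : H -> V -> int -> V.
Hypothesis hV : is_Hmodule_nlva YH oneH Delta eps YV oneV YHV.

Let vYH : is_vertex_map YH := nlva_vertex_map (nlvb_nlva bH).
Let vYV : is_vertex_map YV := nlva_vertex_map (Hnlva_nlva hV).
Let vYHV : is_vertex_map YHV := nlvm_vertex_map (Hnlva_module hV).
Let co : is_coalgebra Delta eps := nlvb_coalgebra bH.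
Let lDelta : linear Delta := coalg_Delta_linear co.

Lemma Hnlva_unif h v u : exists N : int, forall i n, YV u (YHV h v i) n != 0 -> N <= n.
Proof. exact: tens_laurent_unif vYV (Hnlva_tens hV h v). Qed.

(* V (x) H as a module over V, acting on the first factor, and over H, acting *)
(* through Delta; the smash product is then an instance of [YWsharp].         *)
Definition adjV (u : V) (t : tensor V H) (n : int) : tensor V H :=
  tens_map (fun v => YV u v n) id t.

Definition adjH (h : H) (t : tensor V H) (n : int) : tensor V H :=
  tlift (fun v x => tlift (fun h1 h2 => tens_conv (YHV h1 v) (YH h2 x) n) (Delta h)) t.

Lemma adjV_tens u v x n : adjV u (v *t x) n = YV u v n *t x.
Proof. by rewrite /adjV tens_map_tens //; exact: vmap_linr. Qed.

Lemma adjV_vertex_map : is_vertex_map adjV.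
Proof.
split=> [n|u t]; first split=> [t|u].
- apply: linear_big => q.
  apply: (@linear_comp _ _ _ _ (fun u => u *t q.2) (fun u => YV u q.1 n)).
    exact: (tens_bilin V H).1.
  exact: vmap_linl.
- by apply: tens_map_linear => //; exact: vmap_linr.
- have [|N NP] := @big_ge _ _ int (repr t) (fun q n => YV u q.1 n *t q.2) id.
    by move=> q; have [N YN] := vmap_ge vYV u q.1; exists N => n /tens_neq0 [/YN].
  exact: in_laurentI NP.
Qed.

Lemma diag_tens_fs h1 v h2 x n : fs (fun i => YHV h1 v i *t YH h2 x (n - i)).
Proof. by apply: tens_conv_fs; exact: vmap_ge. Qed.

Lemma adjH_bilin1 v x n : bilin (fun h1 h2 => tens_conv (YHV h1 v) (YH h2 x) n).
Proof.
apply: bilin_fsum => [i|h1 h2]; last exact: diag_tens_fs.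
apply: (bilin_comp2 (f := fun h1 => YHV h1 v i) (g := fun h2 => YH h2 x (n - i))).
- exact: tens_bilin.
- exact: vmap_linl.
- exact: vmap_linl.
Qed.

Lemma adjH_bilin2 h n :
  bilin (fun v x => tlift (fun h1 h2 => tens_conv (YHV h1 v) (YH h2 x) n) (Delta h)).
Proof.
apply: bilin_big => q; apply: bilin_fsum => [i|v x]; last exact: diag_tens_fs.
apply: (bilin_comp2 (f := fun v => YHV q.1 v i) (g := fun x => YH q.2 x (n - i))).
- exact: tens_bilin.
- exact: vmap_linr.
- exact: vmap_linr.
Qed.

Lemma adjH_tens h v x n : adjH h (v *t x) n =
  tlift (fun h1 h2 => tens_conv (YHV h1 v) (YH h2 x) n) (Delta h).
Proof. by rewrite /adjH tlift_tens //; exact: adjH_bilin2. Qed.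

Lemma adjH_vertex_map : is_vertex_map adjH.
Proof.
split=> [n|h t]; first split=> [t|h].
- apply: linear_big => q; apply: (linear_comp (f := tlift _)) lDelta.
  exact: tlift_linear (adjH_bilin1 q.1 q.2 n).
- exact: tlift_linear (adjH_bilin2 h n).
- have [|N NP] := @big_ge _ _ int (repr t) (fun q n => tlift (fun h1 h2 =>
      tens_conv (YHV h1 q.1) (YH h2 q.2) n) (Delta h)) id.
    move=> [v x]; apply: (@big_ge _ _ int (repr (Delta h)) (fun p n =>
      tens_conv (YHV p.1 v) (YH p.2 x) n) id) => -[h1 h2].
    have [[N YN] [M YM]] := (vmap_ge vYHV h1 v, vmap_ge vYH h2 x).
    by exists (N + M) => n; exact: tens_conv_ge.
  exact: in_laurentI NP.
Qed.

Lemma adjV_vendo (g : H -> H) : linear g -> vendo adjV (tens_map id g).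
Proof.
move=> lg; have lidg : linear (tens_map (@id V) g) by apply: tens_map_linear.
split=> // v t n; have [lV rV] := adjV_vertex_map.1 n.
apply: (@eq_linear_tens _ _ _ _ (fun t => tens_map id g (adjV v t n))
  (fun t => adjV v (tens_map id g t) n)).
- by apply: (linear_comp lidg); exact: rV.
- by apply: linear_comp lidg; exact: rV.
- by move=> v' x; rewrite adjV_tens !tens_map_tens // adjV_tens.
Qed.

(** The subspace (span of s) (x) H, given by an induction principle as in [endo_span]. Scalars are
    absorbed by x, which runs through all of H. *)
Definition lspan (s : seq V) (t : tensor V H) : Prop := forall P : tensor V H -> Prop,
  P 0 -> (forall x y, P x -> P y -> P (x + y)) ->
  (forall v x, v \in s -> P (v *t x)) -> P t.

Lemma lspan0 s : lspan s 0. Proof. by []. Qed.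

Lemma lspanD s x y : lspan s x -> lspan s y -> lspan s (x + y).
Proof. by move=> sx sy P P0 PD Pg; exact: (PD _ _ (sx P P0 PD Pg) (sy P P0 PD Pg)). Qed.

Lemma lspan_repr t : lspan [seq q.1 | q <- repr t] t.
Proof.
rewrite [X in lspan _ X]tensE big_seq; apply: big_ind => [||q qt]; first exact: lspan0.
  exact: lspanD.
by move=> P _ _ Pg; apply: Pg; exact: map_f.
Qed.

(** The first factors move by Y_V^H(h1,x), which on finitely many v involves finitely many vectors
    since its values lie in V (x) C((x)); the second factors are unconstrained in [lspan]. *)
Lemma lspan_adjH h s : exists s', forall t i, lspan s t -> lspan s' (adjH h t i).
Proof.
have /boolp.choice [d dP] : forall hv : H * V, exists s : seq (V * laurent K),
    forall n, YHV hv.1 hv.2 n = \sum_(q <- s) q.2 n *: q.1.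
  by case=> h1 v; have [d _ dE] := in_tens_laurent_sum (Hnlva_tens hV h1 v); exists d.
exists [seq r.1 | vp <- [seq (v, p) | v <- s, p <- repr (Delta h)],
                  r <- d (vp.2.1, vp.1)].
move=> t i st; have lh := (adjH_vertex_map.1 i).2 h.
apply: (st (fun t => lspan _ (adjH h t i))) => [|x y sx sy|v x vs].
- by rewrite (lin_0 lh); exact: lspan0.
- by rewrite (lin_add lh); exact: lspanD.
rewrite adjH_tens /tlift big_seq; apply: big_ind => [||p ps]; [exact: lspan0|exact: lspanD|].
rewrite /tens_conv; apply: big_ind => [||k _]; [exact: lspan0|exact: lspanD|].
rewrite (dP (p.1, v) k) (lin_sum ((tens_bilin V H).1 _)) big_seq.
apply: big_ind => [||q qd]; [exact: lspan0|exact: lspanD|].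
rewrite tensZl -tensZr => P _ _ Pg; apply: Pg.
apply/allpairsPdep; exists (v, p), q; split=> //.
by apply/allpairsP; exists (v, p).
Qed.

(** As eps(1) = 1, the map id (x) (h -> eps(h) x) sends v (x) 1 to v (x) x, and it commutes with the
    fields of V, which act on the first factor. *)
Lemma lspan_endo s t : lspan s t -> endo_span adjV [seq v *t oneH | v <- s] t.
Proof.
move=> st; apply: (st (endo_span adjV _)) => [|x y sx sy|v x vs]; first exact: endo_span0.
  exact: endo_spanD.
have leps : linear (eps : H -> K^o) := coalg_eps_linear co.
have lg : linear (fun h => eps h *: x).
  by move=> c h h'; rewrite leps scalerDl scalerA.
have -> : v *t x = tens_map id (fun h => eps h *: x) (v *t oneH).
  by rewrite tens_map_tens // (nlva_hom_one (nlvb_eps bH)) scale1r.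
by apply: endo_span_gen; [exact: map_f | exact: adjV_vendo].
Qed.

Lemma adj_tameHH h h' t :
  exists2 T, tame adjV T & forall i j, T (adjH h (adjH h' t j) i).
Proof.
have [s' s'P] := lspan_adjH h' [seq q.1 | q <- repr t].
have [s sP] := lspan_adjH h s'.
exists (endo_span adjV [seq v *t oneH | v <- s]).
  exact: endo_span_tame adjV_vertex_map _.
by move=> i j; apply: lspan_endo; apply: sP; apply: s'P; exact: lspan_repr.
Qed.

Lemma adj_tameH h t : exists2 T, tame adjV T & forall i, T (adjH h t i).
Proof.
have [s sP] := lspan_adjH h [seq q.1 | q <- repr t].
exists (endo_span adjV [seq v *t oneH | v <- s]).
  exact: endo_span_tame adjV_vertex_map _.
by move=> i; apply: lspan_endo; apply: sP; exact: lspan_repr.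
Qed.

Let ra : regular (exprz (phi (1 : laurent K))) := regular_phi 1 char0.
Let a0 : phi (1 : laurent K) != 0 := phi_neq0 1 char0.

Lemma adjV_wassoc u v : exists2 f, X12_power f & forall t,
  wassoc (phi 1) (Ycomp adjV adjV u v t) f (fun i j => adjV (YV u v i) t j).
Proof.
have [/(_ (nlva_weak_assoc (Hnlva_nlva hV)) u v) [f Xf fP] _] := weak_assocP char0 vYV vYV.
exists f => // t.
apply: (@wassoc_ext _ _ _ (fun m n => \sum_(q <- repr t) Ycomp YV YV u v q.1 m n *t q.2) _ _
  (fun i j => \sum_(q <- repr t) YV (YV u v i) q.1 j *t q.2)) => //.
- move=> m n; rewrite /Ycomp -[adjV v t n]/(\sum_(q <- repr t) YV v q.1 n *t q.2).
  rewrite (lin_sum ((adjV_vertex_map.1 m).2 u)); apply: eq_bigr => q _.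
  by rewrite adjV_tens.
- apply: wassoc_sum => // q; exact: (wassoc_lin ra ((tens_bilin V H).1 q.2) (fP q.1)).
Qed.

Lemma tens_conv2_fsum (A B : lmodType K) (f : int -> int -> A) (g : int -> int -> B) m n :
  in_l12 f -> in_l12 g ->
  tconv2 f g m n = \sum_(k \in [set: int]) \sum_(i \in [set: int]) f i k *t g (m - i) (n - k).
Proof.
move=> lf lg; have := @conv2_fs12 _ _ m n (cone12_tens lf lg) => fsF.
rewrite /tconv2 /conv2 fsum_pair //; apply: fsum_exch.
by case: fsF => s sP; exists s => -[i j]; exact: sP.
Qed.

(** The coproduct is a homomorphism, so the field of [YH h h'] is a sum over both coproducts of
    tensor products of iterates on V and on H, and [wassoc_tens] applies to each. The multipliers on
    V and H do not depend on the vectors, hence one serves for all v and x. *)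
Lemma adjH_wassoc_tens h h' : exists2 f, X12_power f & forall v x,
  wassoc (phi 1) (Ycomp adjH adjH h h' (v *t x)) f (fun i j => adjH (YH h h' i) (v *t x) j).
Proof.
have lYH := weak_assocP char0 vYH vYH; have lYHV := weak_assocP char0 vYH vYHV.
have /boolp.choice [F1 F1P] : forall qp : H * H, exists f, X12_power f /\ forall w,
    wassoc (phi 1) (Ycomp YHV YHV qp.1 qp.2 w) f (fun i j => YHV (YH qp.1 qp.2 i) w j).
  case=> q p; have [/(_ (nlvm_weak_assoc (Hnlva_module hV)) q p) [f Xf fP] _] := lYHV.
  by exists f.
have /boolp.choice [F2 F2P] : forall qp : H * H, exists f, X12_power f /\ forall w,
    wassoc (phi 1) (Ycomp YH YH qp.1 qp.2 w) f (fun i j => YH (YH qp.1 qp.2 i) w j).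
  case=> q p; have [/(_ (nlva_weak_assoc (nlvb_nlva bH)) q p) [f Xf fP] _] := lYH.
  by exists f.
exists (\prod_(q <- repr (Delta h)) \prod_(p <- repr (Delta h'))
    (F1 (q.1, p.1) * F2 (q.2, p.2))).
  do 2!apply: (S_prod (X12_power1 K) (@X12_powerM K)) => ?.
  by apply: X12_powerM; [exact: (F1P (_, _)).1 | exact: (F2P (_, _)).1].
move=> v x; pose A (q p : H * H) := tconv2 (Ycomp YHV YHV q.1 p.1 v) (Ycomp YH YH q.2 p.2 x).
pose R (q p : H * H) :=
  tconv2 (fun i j => YHV (YH q.1 p.1 i) v j) (fun i j => YH (YH q.2 p.2 i) x j).
apply: (@wassoc_ext _ _ _
  (fun m n => \sum_(q <- repr (Delta h)) \sum_(p <- repr (Delta h')) A q p m n) _ _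
  (fun m n => \sum_(q <- repr (Delta h)) \sum_(p <- repr (Delta h')) R q p m n)).
- move=> m n; rewrite exchange_big /Ycomp adjH_tens /tlift.
  have lh := (adjH_vertex_map.1 m).2 h; rewrite (lin_sum lh); apply: eq_bigr => p _.
  rewrite /tens_conv (lin_fsum lh); last exact: diag_tens_fs.
  under [RHS]eq_fsum => k do rewrite adjH_tens /tlift.
  rewrite fsum_big.
    apply: eq_bigr => q _; rewrite /A tens_conv2_fsum //.
    by apply: (@Ycomp_l12 _ _ _ _ YHV YHV).
    by apply: (@Ycomp_l12 _ _ _ _ YH YH).
  move=> q.
  have [[N YN] [M YM]] := (vmap_ge vYHV p.1 v, vmap_ge vYH p.2 x).
  apply: (@fs_int _ _ N (n - M)) => k /fsum_neq0 [i /tens_neq0 []].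
  by move=> /(vmap_neq0r vYHV) /YN ? /(vmap_neq0r vYH) /YM ?; split; lia.
- move=> i j; rewrite adjH_tens (nlva_hom_Y (nlvb_Delta bH)) /Ytens.
  have lT := tlift_linear (adjH_bilin1 v x j).
  rewrite [tlift _ (Delta h)]/tlift (lin_sum lT); apply: eq_bigr => q _.
  rewrite [tlift _ (Delta h')]/tlift (lin_sum lT); apply: eq_bigr => p _.
  rewrite /tens_conv (lin_fsum lT); last by apply: tens_conv_fs; exact: vmap_ge.
  rewrite /R /tconv2 /conv2 fsum_pair.
    by apply: eq_fsum => k; rewrite tlift_tens //; exact: adjH_bilin1.
  have l1 := @Yiter_l21 _ _ _ YH YHV q.1 p.1 v vYH vYHV.
  have l2 := @Yiter_l21 _ _ _ YH YH q.2 p.2 x vYH vYH.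
  exact: (conv2_fs21 i j (cone21_tens l1 l2)).
apply: (@wassoc_big _ _ _ ra a0 _ (repr (Delta h))
  (fun q m n => \sum_(p <- repr (Delta h')) A q p m n)
  (fun q m n => \sum_(p <- repr (Delta h')) R q p m n)
  (fun q => \prod_(p <- repr (Delta h')) (F1 (q.1, p.1) * F2 (q.2, p.2)))) => q.
apply: (@wassoc_big _ _ _ ra a0 _ (repr (Delta h')) (A q) (R q)
  (fun p => F1 (q.1, p.1) * F2 (q.2, p.2))) => p.
by apply: wassoc_tens => //; [exact: (F1P (q.1, p.1)).2 | exact: (F2P (q.2, p.2)).2].
Qed.

Lemma adjH_wassoc h h' : exists2 f, X12_power f & forall t,
  wassoc (phi 1) (Ycomp adjH adjH h h' t) f (fun i j => adjH (YH h h' i) t j).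
Proof.
have [f Xf fP] := adjH_wassoc_tens h h'; exists f => // t.
apply: (@wassoc_ext _ _ _ (fun m n => \sum_(q <- repr t) Ycomp adjH adjH h h' (q.1 *t q.2) m n)
  _ _ (fun i j => \sum_(q <- repr t) adjH (YH h h' i) (q.1 *t q.2) j)).
- move=> m n; rewrite [t in RHS]tensE /Ycomp (lin_sum ((adjH_vertex_map.1 n).2 h')).
  by rewrite (lin_sum ((adjH_vertex_map.1 m).2 h)).
- by move=> i j; rewrite [t in RHS]tensE (lin_sum ((adjH_vertex_map.1 j).2 _)).
- by apply: wassoc_sum => // q; exact: fP.
Qed.

Lemma adj_shift_bounded h1 v h2 t : exists N, shift_bounded adjV (YHV h1 v) (adjH h2 t) N.
Proof.
have [s _ sE] := in_tens_laurent_sum (Hnlva_tens hV h1 v).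
apply: (shift_bounded_span adjV_vertex_map.1 sE); first exact: vmap_ge adjH_vertex_map _ _.
move=> u; have [T [_ /(_ u)[N NP] _ _] tT] := adj_tameH h2 t.
by exists N => l n; apply: NP.
Qed.

Lemma YHV_shift_bounded h1 v h2 v' : exists N, shift_bounded YV (YHV h1 v) (YHV h2 v') N.
Proof.
have [s _ sE] := in_tens_laurent_sum (Hnlva_tens hV h1 v).
apply: (shift_bounded_span vYV.1 sE); first exact: vmap_ge vYHV _ _.
by move=> u; have [N NP] := Hnlva_unif h2 v' u; exists N => l n; exact: NP.
Qed.

Lemma tens_shift_bounded h1 v h2 v' h3 x :
  exists N, shift_bounded adjV (YHV h1 v) (tens_conv (YHV h2 v') (YH h3 x)) N.
Proof.
have [N NP] := YHV_shift_bounded h1 v h2 v'; have [M MP] := vmap_ge vYH h3 x.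
exists (Order.min N (N + M)) => k l n.
have lV := (adjV_vertex_map.1 n).2 (YHV h1 v k).
rewrite /tens_conv (lin_fsum lV); last exact: diag_tens_fs.
case/fsum_neq0 => i; rewrite adjV_tens => /tens_neq0 [/NP [? ? ?] /MP ?].
by split; lia.
Qed.

(** The coefficients of Y(Y_V^H(a, x1 - x2)v, x2) Y_V^H(b, x1)v' (x) Y(c, x1)x. Both sides of the
    commutation formula on V (x) H reduce to sums of these, with the two bracketings of the iterated
    coproduct. *)
Definition tens_shift a v b v' c x m n : tensor V H :=
  \sum_(l \in [set: int]) yshift YV (YHV a v) (YHV b v') l n *t YH c x (m - l).

Lemma tens_shift_fs a v b v' c x m n :
  fs (fun l => yshift YV (YHV a v) (YHV b v') l n *t YH c x (m - l)).
Proof.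
have [N NP] := YHV_shift_bounded a v b v'; have [M MP] := vmap_ge vYH c x.
apply: (@fs_int _ _ (N + N + N - n) (m - M)) => l /tens_neq0 [+ /MP ?].
by move=> /(yshift_neq0 char0 NP) [? ?]; split; lia.
Qed.

Lemma tens_shift_trilin v v' x m n : trilin (fun a b c => tens_shift a v b v' c x m n).
Proof.
split=> [b c|a c|a b]; apply: linear_fsum => [l|?]; try exact: tens_shift_fs.
- apply: (@linear_comp _ _ _ _ (fun u => u *t YH c x (m - l))
    (fun a => yshift YV (YHV a v) (YHV b v') l n)); first exact: (tens_bilin V H).1.
  apply: (yshift_linearl char0 vYV.1) => [k|a]; first exact: vmap_linl.
  exact: YHV_shift_bounded.
- apply: (@linear_comp _ _ _ _ (fun u => u *t YH c x (m - l))
    (fun b => yshift YV (YHV a v) (YHV b v') l n)); first exact: (tens_bilin V H).1.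
  apply: (yshift_linearr char0 vYV.1) => [k|b]; first exact: vmap_linl.
  exact: YHV_shift_bounded.
- apply: (@linear_comp _ _ _ _ (fun y => _ *t y) (fun c => YH c x (m - l))).
    exact: (tens_bilin V H).2.
  exact: vmap_linl.
Qed.

Lemma yshift_tens a v b v' c x m n :
  yshift adjV (YHV a v) (tens_conv (YHV b v') (YH c x)) m n = tens_shift a v b v' c x m n.
Proof.
pose F (ij : int * int) k : tensor V H := dxz K ij.1 ij.2 *:
  (YV (YHV a v (ij.1 + ij.2)) (YHV b v' k) (n - ij.2) *t YH c x (m - ij.1 - k)).
transitivity (\sum_(ij \in [set: int * int]) \sum_(k \in [set: int]) F ij k).
  apply: eq_fsum => -[i j] /=; rewrite /tens_conv.
  have lV := (adjV_vertex_map.1 (n - j)).2 (YHV a v (i + j)).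
  rewrite (lin_fsum lV); last exact: diag_tens_fs.
  rewrite (lin_fsum (@linear_scaler _ _ (dxz K i j))).
    by apply: eq_fsum => k; rewrite adjV_tens.
  exact: (@lin_fs _ _ _ (fun t => adjV _ t (n - j)) lV _ _ (diag_tens_fs _ _ _ _ _)).
have [N NP] := YHV_shift_bounded a v b v'; have [M MP] := vmap_ge vYH c x.
(* The new index l is the total x1-exponent of the V-factor. *)
rewrite -(@fsum_exch_shift _ _ _ F (fun ij l => l - ij.1) (fun ij l => l + ij.1)).
- apply: eq_fsum => l; rewrite /F (lin_fsum (f := fun u => u *t YH c x (m - l))).
  + apply: eq_fsum => -[i j]; rewrite /= tensZl.
    by have -> : m - i - (l - i) = m - l by lia.
  + exact: (tens_bilin V H).1.
  + exact: (yshift_fs char0 l n NP).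
- by move=> ij l; rewrite subrK.
- by move=> ij l; rewrite addrK.
have key i j k : F (i, j) k != 0 ->
    [/\ N <= i + j, N <= k & 0 <= j] /\ [/\ N <= n - j & M <= m - i - k].
  rewrite /F /= scaler_eq0 negb_or => /andP[/(dxz_ge char0) ? /tens_neq0].
  by case=> /NP [? ? ?] /MP ?.
exists [seq (ij, k) | ij <- [seq (i, j) | i <- irange (N + N - n) (m - M - N), j <- irange 0 (n - N)],
                      k <- irange N (m - M - (N + N - n))].
move=> [[i j] k] /key [[i1 k1 j1] [j2 k2]]; rewrite /= in k1 k2.
apply: allpairs_f; last by apply: in_irange; rewrite /=; lia.
by apply: allpairs_f; apply: in_irange; rewrite /=; lia.
Qed.

Lemma yshift_sumr (I : Type) (s : seq I) f (g : I -> int -> tensor V H) m n :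
  (forall q, exists N, shift_bounded adjV f (g q) N) ->
  yshift adjV f (fun k => \sum_(q <- s) g q k) m n = \sum_(q <- s) yshift adjV f (g q) m n.
Proof.
move=> gN; rewrite /yshift -fsum_big => [|q].
  apply: eq_fsum => ij; have [_ br] := adjV_vertex_map.1 (n - ij.2).
  by rewrite (lin_sum (br _)) scaler_sumr.
by have [N NP] := gN q; exact: (yshift_fs char0 m n NP).
Qed.

(** On v' (x) x the left side splits the first component of Delta(h) again, by the module algebra
    axiom, and the right side the second, by the definition of [adjH]; coassociativity identifies
    them. *)
Lemma adj_comm h v t m n : adjH h (adjV v t n) m =
  tlift (fun h1 h2 => yshift adjV (YHV h1 v) (adjH h2 t) m n) (Delta h).
Proof.
have [lHm lVn] := ((adjH_vertex_map.1 m).2 h, (adjV_vertex_map.1 n).2 v).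
move: t; apply: eq_linear_tens => [||v' x].
- exact: (linear_comp lHm lVn).
- apply: linear_big => q.
  apply: (yshift_linearr char0 adjV_vertex_map.1) => [k|t]; last exact: adj_shift_bounded.
  exact: (adjH_vertex_map.1 k).2.
rewrite adjV_tens adjH_tens.
transitivity (tlift (fun h1 h2 => tlift (fun a b => tens_shift a v b v' h2 x m n) (Delta h1))
  (Delta h)).
  apply: eq_tlift => h1 h2; rewrite /tens_conv [RHS]/tlift /tens_shift -fsum_big => [|q].
    apply: eq_fsum => l; rewrite (Hnlva_Y hV) /tlift (lin_sum ((tens_bilin V H).1 _)).
    apply: eq_bigr => q _; have [N NP] := YHV_shift_bounded q.1 v q.2 v'.
    by rewrite (YshiftE _ _ char0 NP).
  exact: tens_shift_fs.
rewrite (coassoc_tlift _ co (tens_shift_trilin v v' x m n)).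
apply: eq_tlift => a h'.
transitivity (yshift adjV (YHV a v)
    (fun k => \sum_(q <- repr (Delta h')) tens_conv (YHV q.1 v') (YH q.2 x) k) m n).
  rewrite yshift_sumr; last by move=> q; exact: tens_shift_bounded.
  by apply: eq_bigr => q _; rewrite yshift_tens.
by congr (yshift _ _ _ m n); apply/funext => k; rewrite adjH_tens.
Qed.

(** Y_V^H(h1,x)v involves finitely many scalar series f. If N is at least all their pole orders, (x1
    - x2)^N turns each f(x1 - x2) into [gser], whose substitution z^N f(z) matches the iterate. *)
Lemma adj_local h1 h2 v : exists2 Q, X12_power Q & exists s : seq (V * series2 K),
  (forall t, smul Q (yshift adjV (YHV h1 v) (adjH h2 t)) =
     (fun m n => \sum_(r <- s) smul r.2 (fun i j => adjV r.1 (adjH h2 t i) j) m n)) /\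
  (forall k l, \sum_(r <- s) s2eval (phi 1) r.2 k l *: r.1 =
     smul (s2eval (phi 1) Q) (fun i => delta0 (YHV h1 v i)) k l).
Proof.
have [s _ sE] := in_tens_laurent_sum (Hnlva_tens hV h1 v).
have [N NP] : exists N : nat, forall q, q \in s -> forall n, q.2 n != 0 -> - N%:Z <= n.
  have [||N NP] := @seq_unif _ s (fun q N => forall n, q.2 n != 0 -> N <= n).
  - by move=> q; exact: laurent_ge.
  - by move=> q N M MN NP n /NP; lia.
  - by exists (absz N) => q qs n /(NP q qs); lia.
exists ((s2X1 K - s2X2 K) ^+ N); first by exists N.
exists [seq (q.1, gser q.2 N) | q <- s]; split=> [t|k l].
  have tN u : exists M, forall l n, adjV u (adjH h2 t l) n != 0 -> M <= l /\ M <= n.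
    have [T [_ /(_ u)[M MP] _ _] tT] := adj_tameH h2 t.
    have [L LP] := vmap_ge adjH_vertex_map h2 t.
    exists (Order.min M L) => l n nz; have := MP _ _ (tT l) nz.
    by have := LP _ (vmap_neq0r adjV_vertex_map nz); lia.
  rewrite (yshift_sum char0 adjV_vertex_map.1 sE tN).
  have cone q : cone12 (fun i j m n => Fser q.2 0 i j *: adjV q.1 (adjH h2 t m) n).
    by have [M MP] := tN q.1; exact: (Fser_cone char0 q.2 MP).
  rewrite smul_sum => [|q]; last by apply: summable1_l12; exact: conv2_l12.
  do 2!apply/funext => ?; rewrite big_map !big_seq; apply: eq_bigr => q qs /=.
  rewrite smul_conv2_out; last exact: summable2_cone12.
  rewrite smulE; congr (conv2 _ _ _); do 4!apply/funext => ?.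
  rewrite -(smul_lin (U := K^o) _ _ (g := fun c => c *: _)).
  - by rewrite (smul_Fser char0) add0r gserE //; exact: NP.
  - exact: linear_scalel.
  - by apply: summable1_l12; exact: Fser_l12.
rewrite (phi1_X12 char0) smul_mono big_map /delta0.
case: (eqVneq l 0) => [->|l0].
  rewrite sE !big_seq; apply: eq_bigr => q qs /=.
  by rewrite (s2eval_gser char0) ?eqxx //; exact: NP.
rewrite big_seq big1 // => q qs /=.
by rewrite (s2eval_gser char0) ?(negPf l0) ?scale0r //; exact: NP.
Qed.

Lemma adj_pres h v : exists2 f, X12_power f &
  exists s, series_pres Delta YHV adjH adjV (phi 1) h v f s.
Proof.
pose C h1 h2 t := yshift adjV (YHV h1 v) (adjH h2 t).
have lC h1 h2 t : in_l12 (C h1 h2 t).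
  have [N NP] := adj_shift_bounded h1 v h2 t; split.
    by exists N => m n /(yshift_neq0 char0 NP) [].
  by move=> M; exists (N + N + N - M) => m n nM /(yshift_neq0 char0 NP) [? ?]; lia.
apply: (@pres_of_local _ _ ra a0 _ _ _ Delta YHV adjH adjV vYHV adjH_vertex_map
  adjV_vertex_map _ (X12_power1 K) (@X12_powerM K) h v C _ (fun B => in_l12 B)) => //.
- by move=> t m n; exact: adj_comm.
- by apply: (@bounded2_l12 _ 0) => m n; rewrite eqxx.
- by move=> A B; exact: l12D.
- by move=> f g A; exact: smulA12.
- by move=> f A; exact: summable1_l12.
- by move=> h1 h2; exact: adj_local.
Qed.

Lemma Ysmash_adj x y n : Ysmash YH Delta YV YHV x y n = YWsharp adjH adjV x y n.
Proof.
have [bl br] := Ysmash_bilin vYH vYV vYHV lDelta Hnlva_unif n.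
have [sl sr] := (YWsharp_vertex_map adjH_vertex_map adjV_vertex_map adj_tameH).1 n.
move: x; apply: eq_linear_tens => [||u h]; [exact: bl | exact: sl |].
move: y; apply: eq_linear_tens => [||v h']; [exact: br | exact: sr |].
rewrite (Ysmash_tens vYH vYV vYHV lDelta Hnlva_unif).
rewrite (YWsharp_tens adjH_vertex_map adjV_vertex_map adj_tameH) /Ydiag.
have lV k := (adjV_vertex_map.1 k).2 u.
under [RHS]eq_fsum => i do rewrite adjH_tens /tlift (lin_sum (lV _)).
pose F (q : H * H) j y := YV u (YHV q.1 v j) (y - j) *t YH q.2 h' (n - y).
have fsF q := smash_fs vYH vYV vYHV Hnlva_unif u q.1 v q.2 h' n.
have e i (q : H * H) : adjV u (tens_conv (YHV q.1 v) (YH q.2 h') i) (n - i) =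
    \sum_(j \in [set: int]) F q j (n - i + j).
  rewrite /tens_conv (lin_fsum (lV (n - i))); last exact: diag_tens_fs.
  apply: eq_fsum => j; rewrite adjV_tens /F.
  by congr (YV _ _ _ *t YH _ _ _); lia.
under [RHS]eq_fsum => i do under eq_bigr => q _ do rewrite e.
rewrite [RHS]fsum_big.
  apply: eq_bigr => q _.
  (* The index y = n - i + j is the total exponent of the V-factor, which is the outer index of the
     smash product. *)
  rewrite (@fsum_exch_shift _ _ _ (F q) (fun j i => n - i + j) (fun j i => n - i + j)) //.
  - exact: (smash_exch vYH vYV vYHV Hnlva_unif).
  - by move=> j i; lia.
  - by move=> j i; lia.
  - exact: fsF.
move=> q; apply: (@fs_fst _ _ _ (fun ij : int * int => F q ij.2 (n - ij.1 + ij.2))).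
apply: (@fs_reindex _ _ _ (fun ij : int * int => (ij.2, n - ij.1 + ij.2))
  (fun jy => (n - jy.2 + jy.1, jy.1)) _ _ (fsF q)) => -[i j] /=.
by congr (_, _); lia.
Qed.

Lemma smash_vacuum t : Ysmash YH Delta YV YHV (oneV *t oneH) t = delta0 t.
Proof.
apply/funext => n; have [_ br] := Ysmash_bilin vYH vYV vYHV lDelta Hnlva_unif n.
move: t; apply: eq_linear_tens => [||v h]; first exact: br.
  by move=> c x y; rewrite /delta0; case: ifP; rewrite ?scaler0 ?addr0.
rewrite (Ysmash_tens vYH vYV vYHV lDelta Hnlva_unif) (nlva_hom_one (nlvb_Delta bH)).
rewrite tlift_tens; last exact: trilin_bilin1 (smash_trilin vYH vYV vYHV Hnlva_unif v h n) _.
have -> : Ydiag YV YHV oneV oneH v = delta0 v.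
  apply/funext => m; rewrite /Ydiag (@fsum1 _ _ 0) => [|i /negPf i0].
    by rewrite (nlvm_vacuum (Hnlva_module hV)) (nlva_vacuum (Hnlva_nlva hV)) subr0 /delta0 eqxx.
  by rewrite (nlvm_vacuum (Hnlva_module hV)) /delta0 i0 vmap0r.
rewrite /tens_conv (nlva_vacuum (nlvb_nlva bH)) (@fsum1 _ _ 0) => [|i /negPf i0].
  rewrite subr0 /delta0 eqxx; case: ifP => // _.
  exact: lin_0 ((tens_bilin V H).2 v).
by rewrite /delta0 i0; exact: lin_0 ((tens_bilin V H).1 _).
Qed.

(** Y_V^H(h1,x) sends the vacuum to eps(h1) times itself, so the counit law collapses the coproduct
    and leaves Y(u,x)1 (x) Y(h,x)1. *)
Lemma smash_creation t : (forall n, n < 0 -> Ysmash YH Delta YV YHV t (oneV *t oneH) n = 0) /\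
  Ysmash YH Delta YV YHV t (oneV *t oneH) 0 = t.
Proof.
have key u h n : Ysmash YH Delta YV YHV (u *t h) (oneV *t oneH) n =
    tens_conv (YV u oneV) (YH h oneH) n.
  rewrite (Ysmash_tens vYH vYV vYHV lDelta Hnlva_unif).
  have Yd h1 : Ydiag YV YHV u h1 oneV = (fun i => eps h1 *: YV u oneV i).
    apply/funext => i; rewrite /Ydiag (@fsum1 _ _ 0) => [|j /negPf j0].
      by rewrite (Hnlva_vacuum hV) subr0 /delta0 eqxx (lin_scale (vmap_linr vYV u i)).
    by rewrite (Hnlva_vacuum hV) /delta0 j0 vmap0r.
  rewrite -[in RHS](coalg_counitl co h) /tlift /tens_conv -fsum_big => [|q].
    apply: eq_fsum => i; rewrite (lin_sum (vmap_linl vYH _ _)).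
    rewrite (lin_sum ((tens_bilin V H).2 _)); apply: eq_bigr => q _.
    by rewrite Yd (lin_scale (vmap_linl vYH _ _)) tensZl tensZr.
  rewrite Yd; apply: (@tens_conv_fs _ _ _ (fun i => eps q.1 *: YV u oneV i)); last exact: vmap_ge.
  have [N NP] := vmap_ge vYV u oneV; exists N => i; rewrite scaler_eq0 negb_or.
  by case/andP => _ /NP.
have bl n := (Ysmash_bilin vYH vYV vYHV lDelta Hnlva_unif n).1.
have [cV cH] := (nlva_creation (Hnlva_nlva hV), nlva_creation (nlvb_nlva bH)).
split=> [n n0|].
  move: t; apply: (@eq_linear_tens _ _ _ _ (fun t => _ t _ n) (fun=> 0)) => [||u h].
  - exact: (bl _ (oneV *t oneH)).
  - by move=> c x y; rewrite scaler0 addr0.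
  rewrite key; apply: fsum0 => i; case: (ltP i 0) => [i0|i0].
    by rewrite (cV u).1 //; exact: lin_0 ((tens_bilin V H).1 _).
  by rewrite (cH h).1; [exact: lin_0 ((tens_bilin V H).2 _) | lia].
move: t; apply: (@eq_linear_tens _ _ _ _ (fun t => _ t _ 0) id) => [||u h].
- exact: (bl _ (oneV *t oneH)).
- by [].
rewrite key /tens_conv (@fsum1 _ _ 0) => [|i i0].
  by rewrite subr0 (cV u).2 (cH h).2.
case: (ltP i 0) => [ilt|ige].
  by rewrite (cV u).1 //; exact: lin_0 ((tens_bilin V H).1 _).
by rewrite (cH h).1; [exact: lin_0 ((tens_bilin V H).2 _) | lia].
Qed.

Lemma smash_nlva : is_nlva (Ysmash YH Delta YV YHV) (oneV *t oneH).
Proof.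
have vS := Ysmash_vertex_map vYH vYV vYHV lDelta Hnlva_unif.
split; [exact: vS | exact: smash_vacuum | exact: smash_creation |].
apply/(weak_assocP char0 vS vS) => x y.
have [f Xf fP] := @smash_wassoc _ _ _ _ YH Delta YV YHV adjH adjV vYH vYV vYHV
  adjH_vertex_map adjV_vertex_map lDelta Hnlva_unif adj_tameH adj_tameHH _ ra a0 _
  (X12_power1 K) (@X12_powerM K) adjV_wassoc adjH_wassoc adj_pres x y.
have E : Ysmash YH Delta YV YHV = YWsharp adjH adjV.
  by do 3!apply/funext => ?; exact: Ysmash_adj.
by exists f => // t; have := fP t; rewrite E.
Qed.

End AdjointAction.

(** * The group action on the smash product *)

Section SmashEquivariance.
Variable K : fieldType.
Hypothesis char0 : forall n : nat, n.+1%:R != 0 :> K.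
Variables (G : groupType) (chi : G -> K).
Hypothesis chi_char : is_linear_character chi.
Variables (H : lmodType K) (YH : H -> H -> int -> H) (oneH : H).
Variables (Delta : H -> tensor H H) (eps : H -> K) (RH : G -> H -> H).
Hypothesis H_bialg : is_Gnlvb chi YH oneH Delta eps RH.
Variables (V : lmodType K) (YV : V -> V -> int -> V) (oneV : V) (RV : G -> V -> V).
Hypothesis V_alg : is_Gnlva chi YV oneV RV.
Variable YHV : H -> V -> int -> V.
Hypothesis hV : is_Hmodule_nlva YH oneH Delta eps YV oneV YHV.
Hypothesis RV_YHV : forall (g : G) (h : H) (v : V),
  (fun n => RV g (YHV h v n)) = dilate (chi g) (YHV (RH g h) (RV g v)).

Let bH : is_nlvb YH oneH Delta eps := Gnlvb_nlvb H_bialg.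
Let H_alg : is_Gnlva chi YH oneH RH := Gnlvb_Gnlva H_bialg.
Let vYH : is_vertex_map YH := nlva_vertex_map (nlvb_nlva bH).
Let vYV : is_vertex_map YV := nlva_vertex_map (Hnlva_nlva hV).
Let vYHV : is_vertex_map YHV := nlvm_vertex_map (Hnlva_module hV).
Let lDelta : linear Delta := coalg_Delta_linear (nlvb_coalgebra bH).
Let lRV : forall g, linear (RV g) := rep_linear (Gnlva_rep V_alg).
Let lRH : forall g, linear (RH g) := rep_linear (Gnlva_rep H_alg).
Let Hunif := Hnlva_unif hV.

Lemma rep_cancel (X : lmodType K) (R : G -> X -> X) g x :
  is_representation R -> R g^-1%g (R g x) = x /\ R g (R g^-1%g x) = x.
Proof. by case=> _ R1 RM; rewrite -!RM mulVg mulgV R1. Qed.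

Lemma Gnlva_conj (X : lmodType K) (Y : X -> X -> int -> X) one R g u v n :
  is_Gnlva chi Y one R -> R g (Y u v n) = chi g ^ n *: Y (R g u) (R g v) n.
Proof.
move=> GX; rewrite -[in LHS](rep_cancel g v (Gnlva_rep GX)).1.
exact: (congr1 (@^~ n) (Gnlva_Y GX g u (R g v))).
Qed.

Lemma Ydiag_conj g u h v n :
  RV g (Ydiag YV YHV u h v n) = chi g ^ n *: Ydiag YV YHV (RV g u) (RH g h) (RV g v) n.
Proof.
have fsY u' h' v' := YdiagHV_fs vYV vYHV Hunif u' h' v' n.
rewrite /Ydiag (lin_fsum (lRV g)) // (lin_fsum (@linear_scaler _ _ _)) //.
apply: eq_fsum => i; rewrite (Gnlva_conj _ _ _ _ V_alg).
have -> : RV g (YHV h v i) = chi g ^ i *: YHV (RH g h) (RV g v) i.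
  exact: (congr1 (@^~ i) (RV_YHV g h v)).
rewrite (lin_scale (vmap_linr vYV _ _)) scalerA -expfzDr ?subrK //.
exact: char_neq0.
Qed.

Local Notation Rs := (fun g => tens_map (RV g) (RH g)).

Lemma lRs g : linear (Rs g).
Proof. exact: tens_map_linear. Qed.

Lemma smash_representation : is_representation Rs.
Proof.
split=> [g|x|g g' x]; first exact: lRs.
- move: x; apply: (@eq_linear_tens _ _ _ _ (Rs 1%g) id) => [||v h]; [exact: lRs | by [] |].
  by rewrite tens_map_tens // (rep_one (Gnlva_rep V_alg)) (rep_one (Gnlva_rep H_alg)).
- move: x; apply: (@eq_linear_tens _ _ _ _ (Rs (g * g')%g) (fun x => Rs g (Rs g' x))) => [||v h].
  + exact: lRs.
  + exact: (linear_comp (lRs g) (lRs g')).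
  by rewrite !tens_map_tens // (rep_mul (Gnlva_rep V_alg)) (rep_mul (Gnlva_rep H_alg)).
Qed.

(** The coproduct commutes with G, and on a term with exponents i and n - i the factors chi(g)^i and
    chi(g)^(n-i) multiply to chi(g)^n. *)
Lemma Ysmash_conj g x y n : Rs g (Ysmash YH Delta YV YHV x y n) =
  chi g ^ n *: Ysmash YH Delta YV YHV (Rs g x) (Rs g y) n.
Proof.
have [bl br] := Ysmash_bilin vYH vYV vYHV lDelta Hunif n.
move: x; apply: eq_linear_tens => [||u h].
- exact: (linear_comp (lRs g) (bl y)).
- exact: (linear_comp (@linear_scaler _ _ _) (linear_comp (bl _) (lRs g))).
move: y; apply: eq_linear_tens => [||v h'].
- exact: (linear_comp (lRs g) (br _)).
- exact: (linear_comp (@linear_scaler _ _ _) (linear_comp (br _) (lRs g))).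
rewrite !tens_map_tens // !(Ysmash_tens vYH vYV vYHV lDelta Hunif) (Gnlvb_Delta H_bialg).
have bC u' v' h2 := trilin_bilin1 (smash_trilin vYH vYV vYHV Hunif v' h2 n) u'.
rewrite tlift_tens_map // (lin_tlift _ _ (lRs g)) (lin_tlift _ _ (@linear_scaler _ _ _)).
apply: eq_tlift => h1 h2; rewrite /tens_conv.
rewrite (lin_fsum (lRs g)); last exact: smash_tens_fs.
rewrite (lin_fsum (@linear_scaler _ _ _)); last exact: smash_tens_fs.
apply: eq_fsum => i; rewrite tens_map_tens // Ydiag_conj (Gnlva_conj _ _ _ _ H_alg).
by rewrite tensZl tensZr scalerA -expfzDr ?char_neq0 // addrC subrK.
Qed.

Lemma smash_Gnlva : is_Gnlva chi (Ysmash YH Delta YV YHV) (oneV *t oneH) Rs.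
Proof.
split; [exact: (smash_nlva char0 bH hV) | exact: smash_representation | move=> g | move=> g x y].
- by rewrite tens_map_tens // (Gnlva_one V_alg) (Gnlva_one H_alg).
- apply/funext => n; rewrite Ysmash_conj /dilate.
  by rewrite (rep_cancel g y smash_representation).2.
Qed.

End SmashEquivariance.

Theorem theorem4p23 (R : realType) (p : laurent R[i]) (p_neq0 : p != 0)
  (G : groupType) (chi chiphi : G -> R[i])
  (chi_char : is_linear_character chi)
  (chiphi_char : is_linear_character chiphi)
  (chi_chiphi : phi_character_rel p chiphi chi)
  (H : lmodType R[i]) (YH : H -> H -> int -> H) (oneH : H)
  (Delta : H -> tensor H H) (eps : H -> R[i]) (RH : G -> H -> H)
  (H_bialg : is_Gnlvb chi YH oneH Delta eps RH)
  (V : lmodType R[i]) (YV : V -> V -> int -> V) (oneV : V) (RV : G -> V -> V)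
  (V_alg : is_Gnlva chi YV oneV RV)
  (YHV : H -> V -> int -> V)
  (V_compat : is_phi_compatible p chiphi YH oneH Delta eps YV oneV YHV)
  (W : lmodType R[i]) (YWH : H -> W -> int -> W) (YWV : V -> W -> int -> W)
  (W_mod : is_equivariant_HV_module p chiphi YH oneH Delta RH YV oneV RV YHV
             YWH YWV)
  (RV_YHV : forall (g : G) (h : H) (v : V),
     (fun n => RV g (YHV h v n)) = dilate (chi g) (YHV (RH g h) (RV g v))) :
  let Ysharp := Ysmash YH Delta YV YHV in
  let Rsharp := fun g : G => tens_map (RV g) (RH g) in
  is_Gnlva chi Ysharp (oneV *t oneH) Rsharp /\
  is_equivariant_module p chiphi Ysharp (oneV *t oneH) Rsharp (YWsharp YWH YWV).
Proof.
have char0 (n : nat) : n.+1%:R != 0 :> R[i] by rewrite pnatr_eq0.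
move=> Ysharp Rsharp; split.
  exact: (smash_Gnlva char0 chi_char H_bialg V_alg (phic_Hmodule V_compat) RV_YHV).
exact: (sharp_equivariant_module char0 p_neq0 chiphi_char H_bialg V_alg V_compat W_mod).
Qed.
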